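(* Let $\kappa>0$, let $k\in\mathbb{R}^2$ with $|k|=\kappa$, and let $\psi_0(x)=e^{ikx}$. Let $L=L_{x_0,\theta}$, with $x_0\in\mathbb{R}^2$ and $\theta\in\mathbb{S}^1$, be a straight line such that $L\subset\mathcal{U}$. Suppose that $\theta\neq k/|k|$ and $-\theta\neq k/|k|$. Then, for fixed $k$, the intensity $|\psi_0+\psi_1|^2$ on $L$ uniquely determines the radiation solution $\psi_1$ in the entire region $\mathcal{U}$. That is, if $\psi_1$ and $\tilde\psi_1$ are two radiation solutions in $\mathcal{U}$ with $|\psi_0+\psi_1|^2=|\psi_0+\tilde\psi_1|^2$ on $L$, then $\psi_1=\tilde\psi_1$ on $\mathcal{U}$.
   Context: $\mathcal{U}$ is a region (open connected set) in $\mathbb{R}^2$ consisting of all points outside a closed bounded regular curve $S$. The Helmholtz equation is $\Delta\psi(x)+\kappa^2\psi(x)=0$, $x\in\mathcal{U}$, with $\kappa>0$ and $\Delta$ the Laplacian in $x$. For $k,x\in\mathbb{R}^2$, $kx$ denotes the scalar product; $\psi_0(x)=e^{ikx}$ with $|k|=\kappa$ is the plane wave solution. A radiation solution is a complex-valued solution $\psi_1$ of the Helmholtz equation in $\mathcal{U}$ of class $C^2$ satisfying the Sommerfeld radiation condition $\sqrt{|x|}\left(\frac{\partial}{\partial|x|}-i\kappa\right)\psi_1(x)\to0$ as $|x|\to+\infty$, uniformly in $x/|x|$. For $x_0\in\mathbb{R}^2$ and $\theta\in\mathbb{S}^1$ (the unit circle): $L_{x_0,\theta}=\{x_0+s\theta: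 -\infty<s<+\infty\}$. *)

(* Defs.v *)
From Stdlib Require Import Reals.
From Coquelicot Require Export Coquelicot.
Open Scope R_scope.

(* Coquelicot's product uniform structure on R * R induces the usual topology
   of the plane; its balls are squares, hence the separate Euclidean norm. *)
Notation plane := (R * R)%type.

Definition dot (x y : plane) : R := fst x * fst y + snd x * snd y.

Definition enorm (x : plane) : R := sqrt (dot x x).

Definition pscal (s : R) (x : plane) : plane := (s * fst x, s * snd x).

Definition padd (x y : plane) : plane := (fst x + fst y, snd x + snd y).

Definition line (x0 theta : plane) (x : plane) : Prop :=
  exists s : R, x = padd x0 (pscal s theta).

Definition connected_set (A : plane -> Prop) : Prop :=
  forall O1 O2 : plane -> Prop,
    open O1 -> open O2 ->
    (forall x, A x -> O1 x \/ O2 x) ->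
    (forall x, A x -> ~ (O1 x /\ O2 x)) ->
    (forall x, A x -> O1 x) \/ (forall x, A x -> O2 x).

Definition same_component (A : plane -> Prop) (x y : plane) : Prop :=
  exists B : plane -> Prop,
    connected_set B /\ (forall z, B z -> A z) /\ B x /\ B y.

(* C^1 on the closed interval [a, b] (one-sided derivatives at the endpoints),
   encoded by a C^1 extension to the whole line. *)
Definition regular_arc (gamma : R -> plane) (a b : R) : Prop :=
  exists g1 g2 : R -> R,
    (forall t, ex_derive g1 t /\ continuous (Derive g1) t /\
               ex_derive g2 t /\ continuous (Derive g2) t) /\
    (forall t, a <= t <= b ->
       gamma t = (g1 t, g2 t) /\ (Derive g1 t, Derive g2 t) <> (0, 0)).

(* Finitely many regular arcs joined end to end: corners are allowed, and so
   are self-intersections. Boundedness is automatic. *)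
Definition closed_regular_curve (S : plane -> Prop) : Prop :=
  exists (gamma : R -> plane) (n : nat) (t : nat -> R),
    (0 < n)%nat /\
    (forall i : nat, (i < n)%nat ->
       t i < t (i + 1)%nat /\ regular_arc gamma (t i) (t (i + 1)%nat)) /\
    gamma (t O) = gamma (t n) /\
    (forall x, S x <-> exists s, t O <= s <= t n /\ x = gamma s).

(* The points outside S: the unbounded component of the complement. *)
Definition outside (S : plane -> Prop) (x : plane) : Prop :=
  forall M : R, exists y, M < enorm y /\ same_component (fun z => ~ S z) x y.

Record exterior_region (U : plane -> Prop) : Prop := {
  exterior_open : open U;
  exterior_connected : connected_set U;
  exterior_of_curve : exists S : plane -> Prop,
    closed_regular_curve S /\ (forall x, U x <-> outside S x)
}.

(* Derivatives of complex-valued functions of real variables are taken on the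
   real and imaginary parts. *)
Definition cex_derive (f : R -> C) (t : R) : Prop :=
  ex_derive (fun s => Re (f s)) t /\ ex_derive (fun s => Im (f s)) t.

Definition cDerive (f : R -> C) (t : R) : C :=
  (Derive (fun s => Re (f s)) t, Derive (fun s => Im (f s)) t).

Definition ex_d1 (f : plane -> C) (x : plane) : Prop :=
  cex_derive (fun s => f (s, snd x)) (fst x).

Definition ex_d2 (f : plane -> C) (x : plane) : Prop :=
  cex_derive (fun s => f (fst x, s)) (snd x).

Definition d1 (f : plane -> C) (x : plane) : C :=
  cDerive (fun s => f (s, snd x)) (fst x).

Definition d2 (f : plane -> C) (x : plane) : C :=
  cDerive (fun s => f (fst x, s)) (snd x).

(* Meant for open U only, where continuity and partial derivatives at the
   points of U do not depend on the values of f off U. *)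
Fixpoint class_C (n : nat) (U : plane -> Prop) (f : plane -> C) : Prop :=
  (forall x, U x -> continuous f x) /\
  match n with
  | O => True
  | S m =>
      (forall x, U x -> ex_d1 f x /\ ex_d2 f x) /\
      class_C m U (d1 f) /\ class_C m U (d2 f)
  end.

Definition laplacian (f : plane -> C) (x : plane) : C :=
  Cplus (d1 (d1 f) x) (d2 (d2 f) x).

Definition helmholtz (kappa : R) (U : plane -> Prop) (psi : plane -> C) : Prop :=
  forall x, U x ->
    Cplus (laplacian psi x) (Cmult (RtoC (kappa ^ 2)) (psi x)) = RtoC 0.

(* The derivative at r = |x| of r |-> f (r x / |x|), for x <> 0. *)
Definition radial_derive (f : plane -> C) (x : plane) : C :=
  cDerive (fun r => f (pscal (r / enorm x) x)) (enorm x).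

(* M does not depend on the direction: uniformity in x / |x|. *)
Definition sommerfeld (kappa : R) (U : plane -> Prop) (psi : plane -> C) : Prop :=
  forall eps : R, 0 < eps ->
  exists M : R, 0 < M /\
    forall x, U x -> M < enorm x ->
      Cmod (Cmult (RtoC (sqrt (enorm x)))
              (Cminus (radial_derive psi x)
                 (Cmult (Cmult Ci (RtoC kappa)) (psi x)))) < eps.

Record radiation_solution (kappa : R) (U : plane -> Prop) (psi : plane -> C)
  : Prop := {
  radiation_C2 : class_C 2 U psi;
  radiation_helmholtz : helmholtz kappa U psi;
  radiation_sommerfeld : sommerfeld kappa U psi
}.

(* exp (i k.x), by Euler's formula. *)
Definition plane_wave (k : plane) (x : plane) : C := (cos (dot k x), sin (dot k x)).

(* Main.v *)
(* Let [d] be the difference of the two solutions.  In polar coordinates about a point of the line, each angular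
   mode of a radiating solution is a Hankel function, [sqrt r] times which is [exp (i r)] times an asymptotic
   series in [1/r]; an ODE argument shows that the amplitude of order [n] is at most of order [exp (- 4 n)], so the
   modes can be summed.  Hence along a ray [d] is either zero or exactly of the order of a power of [1/r]: if all
   coefficients of the summed expansion vanish, so do all moments of the amplitudes against polynomials in [n^2],
   hence the amplitudes.  Equality of the intensities reads
   [2 Re (conj psi0 d) = - Re (d (conj psi1 + conj psi1'))], whose right side is smaller than [d]; since [psi0] and
   [d] have different wave numbers along the ray, the leading term of [d] would have to vanish, so [d = 0] there.
   By reflection and unique continuation [d = 0] on the whole line.  On the side of the line away from the curve,
   the odd reflection of [d] is then an entire radiating solution, hence zero, and unique continuation ends the
   proof. *)

Require Import Defs.
From Stdlib Require Import Reals.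
From Coquelicot Require Import Coquelicot.
From Stdlib Require Import Ranalysis5 Lra Lia Psatz Classical ClassicalEpsilon Compare_dec Factorial Wf_nat.
(* Stdlib has its own [d1] and [d2]. *)
Import Defs.
Open Scope R_scope.

(** * Angular modes of solutions of the Helmholtz equation *)

(** The obstacle is uniformity in the order. The coefficient [kk n j] of the expansion of a mode is
    a polynomial of degree [j] in [n^2], so the expansion is only good beyond a radius comparable
    with [n^2], and no single radius serves all modes. Exponential decay of the amplitudes pays for
    this. The rate 4 is dictated by the moments: the interpolation weights that isolate one
    amplitude grow at most like [exp (n)] times [exp (2 n)], up to a constant, so that [exp (- 4 n)]
    still leaves a tail of size [exp (- n)]. The decay itself is a tunnelling effect: for radii up
    to [n / 2] Bessel's equation is repulsive, and the conserved flux cannot be larger than what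
    gets through this barrier. Everything is done with real functions: a complex solution is a pair
    of real solutions, coupled only by the radiation condition. Only cosine modes occur, because
    they already determine the value at angle 0, and the reference direction [p0] is free. After
    rescaling, the line is the axis, the wave number is 1, and the plane wave restricted to the line
    has wave number [al]. *)

Definition cont2 (g : R -> R -> R) (x y : R) : Prop :=
  continuous (fun z : plane => g (fst z) (snd z)) (x, y).

Definition C1on (V : plane -> Prop) (g gx gy : R -> R -> R) : Prop :=
  forall x y, V (x, y) ->
    is_derive (fun s => g s y) x (gx x y) /\ is_derive (fun s => g x s) y (gy x y) /\
    cont2 gx x y /\ cont2 gy x y.

(** The gradient is carried along as explicit functions because the radiation condition, the modes
    and the reflections all refer to it; the second derivatives only serve inside proofs and stay
    existential. *)
Definition helm (k : R) (V : plane -> Prop) (g gx gy : R -> R -> R) : Prop :=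
  C1on V g gx gy /\
  exists gxx gxy gyx gyy,
    C1on V gx gxx gxy /\ C1on V gy gyx gyy /\
    forall x y, V (x, y) -> gxx x y + gyy x y + k ^ 2 * g x y = 0.

Lemma C1on_filterdiff V g gx gy x y :
  open V -> C1on V g gx gy -> V (x, y) ->
  filterdiff (fun u : plane => g (fst u) (snd u)) (locally (x, y))
    (fun u : plane => fst u * gx x y + snd u * gy x y).
Proof.
intros HV H Hxy.
eapply filterdiff_ext_lin.
- apply (is_derive_filterdiff g x y gx (gy x y)).
  + generalize (HV _ Hxy); apply filter_imp. intros [a b] Hab. apply (H a b Hab).
  + apply (H x y Hxy).
  + apply (H x y Hxy).
- reflexivity.
Qed.

Lemma C1on_cont V g gx gy x y :
  open V -> C1on V g gx gy -> V (x, y) -> cont2 g x y.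
Proof.
intros HV H Hxy.
apply (filterdiff_continuous (K := R_AbsRing) (U := prod_NormedModule R_AbsRing R_NormedModule R_NormedModule)
  (V := R_NormedModule) (fun z : plane => g (fst z) (snd z)) (x, y)).
eexists. apply (C1on_filterdiff V g gx gy); auto.
Qed.

Lemma C1on_chain V g gx gy (X Y : R -> R) t X' Y' :
  open V -> C1on V g gx gy -> V (X t, Y t) ->
  is_derive X t X' -> is_derive Y t Y' ->
  is_derive (fun s => g (X s) (Y s)) t (X' * gx (X t) (Y t) + Y' * gy (X t) (Y t)).
Proof.
intros HV H Hxy HX HY. unfold is_derive.
eapply filterdiff_ext_lin.
- exact (filterdiff_comp'_2 X Y g t _ _ (fun a b => a * gx (X t) (Y t) + b * gy (X t) (Y t))
    HX HY (C1on_filterdiff V g gx gy _ _ HV H Hxy)).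
- intros u. simpl. unfold scal; simpl; unfold mult; simpl. ring.
Qed.

Lemma cont2_comp {T : UniformSpace} g (X Y : T -> R) (t : T) :
  cont2 g (X t) (Y t) -> continuous X t -> continuous Y t ->
  continuous (fun s => g (X s) (Y s)) t.
Proof. intros H HX HY. apply (continuous_comp_2 X Y g); auto. Qed.

Lemma is_derive_cont (f : R -> R) x l : is_derive f x l -> continuous f x.
Proof. intros H. apply (ex_derive_continuous (K := R_AbsRing) (V := R_NormedModule)). now exists l. Qed.

Lemma continuous_Rplus {T : UniformSpace} (f g : T -> R) t :
  continuous f t -> continuous g t -> continuous (fun s => f s + g s) t.
Proof. intros; apply (continuous_plus f g); auto. Qed.

Lemma continuous_Rmult {T : UniformSpace} (f g : T -> R) t :
  continuous f t -> continuous g t -> continuous (fun s => f s * g s) t.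
Proof. intros; apply (continuous_mult f g); auto. Qed.

Lemma continuous_cos {T : UniformSpace} (f : T -> R) t :
  continuous f t -> continuous (fun s => cos (f s)) t.
Proof. intros; apply (continuous_comp f cos); auto. apply continuity_pt_filterlim, continuity_cos. Qed.

Lemma continuous_sin {T : UniformSpace} (f : T -> R) t :
  continuous f t -> continuous (fun s => sin (f s)) t.
Proof. intros; apply (continuous_comp f sin); auto. apply continuity_pt_filterlim, continuity_sin. Qed.

Lemma is_derive_Rmult_r (f : R -> R) x l k : is_derive f x l -> is_derive (fun u => f u * k) x (l * k).
Proof. intros H. auto_derive. now exists l. replace (Derive (fun u : R => f u) x) with l by (symmetry; now apply is_derive_unique). ring. Qed.

Lemma is_derive_Rplus (f g : R -> R) x l m :
  is_derive f x l -> is_derive g x m -> is_derive (fun u => f u + g u) x (l + m).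
Proof. intros; apply (is_derive_plus f g); auto. Qed.

Lemma is_derive_Rscal (f : R -> R) x l k : is_derive f x l -> is_derive (fun u => k * f u) x (k * l).
Proof. intros; apply is_derive_scal; auto. Qed.

Lemma continuous_Ropp {T : UniformSpace} (f : T -> R) t :
  continuous f t -> continuous (fun s => - f s) t.
Proof. intros; apply (continuous_opp f); auto. Qed.

Lemma continuous_Rminus {T : UniformSpace} (f g : T -> R) t :
  continuous f t -> continuous g t -> continuous (fun s => f s - g s) t.
Proof. intros; apply (continuous_minus f g); auto. Qed.

Ltac cts_step :=
  match goal with
  | |- continuous (fun z => z) _ => apply continuous_id
  | |- continuous (fun _ => ?c) _ => apply continuous_const
  | |- continuous (fun z => fst z) (_, _) => apply continuous_fst
  | |- continuous (fun z => snd z) (_, _) => apply continuous_snd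
  | |- continuous (fun z => @?f z + @?g z) _ => apply (continuous_Rplus f g)
  | |- continuous (fun z => @?f z - @?g z) _ => apply (continuous_Rminus f g)
  | |- continuous (fun z => @?f z * @?g z) _ => apply (continuous_Rmult f g)
  | |- continuous (fun z => - @?f z) _ => apply (continuous_Ropp f)
  | |- continuous (fun z => cos (@?f z)) _ => apply (continuous_cos f)
  | |- continuous (fun z => sin (@?f z)) _ => apply (continuous_sin f)
  | |- continuous cos _ => apply (continuous_cos (fun z => z))
  | |- continuous sin _ => apply (continuous_sin (fun z => z))
  end.
Ltac cts := repeat (cts_step; cbv beta).

Lemma cont2_slice (F : R -> R -> R) x y : cont2 F x y -> continuous (F x) y.
Proof.
intros H. apply (cont2_comp F (fun _ => x) (fun s => s)); auto.
apply continuous_const. apply continuous_id.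
Qed.

Lemma is_derive_RInt_slice (F Fr : R -> R -> R) (r1 r2 a b r : R) :
  r1 < r < r2 ->
  (forall s t, r1 < s < r2 -> is_derive (fun u => F u t) s (Fr s t)) ->
  (forall s t, r1 < s < r2 -> cont2 F s t) ->
  (forall s t, r1 < s < r2 -> cont2 Fr s t) ->
  is_derive (fun s => RInt (F s) a b) r (RInt (Fr r) a b).
Proof.
intros Hr HD HC HCr.
assert (L : locally r (fun s => r1 < s < r2)).
{ apply (open_and (fun s => r1 < s) (fun s => s < r2)); auto using open_gt, open_lt. }
replace (RInt (Fr r) a b) with (RInt (fun t => Derive (fun u => F u t) r) a b).
2:{ apply RInt_ext. intros t _. apply is_derive_unique. apply HD; auto. }
apply is_derive_RInt_param.
- revert L; apply filter_imp. intros s Hs t _. eexists. apply HD; auto.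
- intros t _. apply continuity_2d_pt_ext_loc with (f := Fr).
  + apply locally_2d_locally.
    apply (filter_imp (fun z : plane => r1 < fst z < r2)).
    * intros z Hz. symmetry. apply is_derive_unique. apply HD; auto.
    * exact (continuous_fst (U := R_UniformSpace) (V := R_UniformSpace) r t _ L).
  + apply continuity_2d_pt_filterlim. apply (HCr r t Hr).
- revert L; apply filter_imp. intros s Hs. apply (ex_RInt_continuous (F s)).
  intros z _. apply cont2_slice, HC; auto.
Qed.

(* [px], [py] are polar coordinates about [c]; angles are measured from [p0]. *)
Definition px (c : plane) (p0 r p : R) : R := fst c + r * cos (p0 + p).
Definition py (c : plane) (p0 r p : R) : R := snd c + r * sin (p0 + p).

(** An unnormalised cosine coefficient on a circle. Sine coefficients are omitted: they do not
    contribute to the value at angle 0, which is the direction [p0]. *)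
Definition coef (g : R -> R -> R) (c : plane) (p0 : R) (n : nat) (r : R) : R :=
  RInt (fun p => g (px c p0 r p) (py c p0 r p) * cos (INR n * p)) (- PI) PI.

Definition coef1 (gx gy : R -> R -> R) (c : plane) (p0 : R) (n : nat) (r : R) : R :=
  RInt (fun p => (cos (p0 + p) * gx (px c p0 r p) (py c p0 r p) +
                  sin (p0 + p) * gy (px c p0 r p) (py c p0 r p)) * cos (INR n * p)) (- PI) PI.

Definition coef2 (gxx gxy gyx gyy : R -> R -> R) (c : plane) (p0 : R) (n : nat) (r : R) : R :=
  RInt (fun p => (cos (p0 + p) * (cos (p0 + p) * gxx (px c p0 r p) (py c p0 r p) +
                                sin (p0 + p) * gxy (px c p0 r p) (py c p0 r p)) +
               sin (p0 + p) * (cos (p0 + p) * gyx (px c p0 r p) (py c p0 r p) +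
                                sin (p0 + p) * gyy (px c p0 r p) (py c p0 r p))) * cos (INR n * p)) (- PI) PI.

Definition annulus_in (V : plane -> Prop) (c : plane) (r1 r2 : R) : Prop :=
  forall r p, r1 < r < r2 -> V (fst c + r * cos p, snd c + r * sin p).

Section Polar.
Variables (V : plane -> Prop) (c : plane) (r1 r2 p0 : R).
Hypothesis HV : open V.
Hypothesis HA : annulus_in V c r1 r2.

Lemma derive_px_r r p : is_derive (fun u => px c p0 u p) r (cos (p0 + p)).
Proof. unfold px. auto_derive; auto. ring. Qed.
Lemma derive_py_r r p : is_derive (fun u => py c p0 u p) r (sin (p0 + p)).
Proof. unfold py. auto_derive; auto. ring. Qed.
Lemma derive_px_p r p : is_derive (fun u => px c p0 r u) p (- r * sin (p0 + p)).
Proof. unfold px. auto_derive; auto. ring. Qed.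
Lemma derive_py_p r p : is_derive (fun u => py c p0 r u) p (r * cos (p0 + p)).
Proof. unfold py. auto_derive; auto. ring. Qed.

Lemma polar_cont0 g r p :
  (forall x y, V (x, y) -> cont2 g x y) -> r1 < r < r2 ->
  cont2 (fun s t => g (px c p0 s t) (py c p0 s t)) r p.
Proof.
intros H Hr. unfold cont2. cbn [fst snd].
apply (cont2_comp g (fun z : plane => px c p0 (fst z) (snd z))
   (fun z : plane => py c p0 (fst z) (snd z)) (r, p)).
- apply H. apply HA; auto.
- unfold px. cts.
- unfold py. cts.
Qed.

Lemma polar_cont g gx gy r p :
  C1on V g gx gy -> r1 < r < r2 -> cont2 (fun s t => g (px c p0 s t) (py c p0 s t)) r p.
Proof. intros H. apply polar_cont0. intros x y. apply (C1on_cont V g gx gy); auto. Qed.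

Lemma coef_derive g gx gy n r :
  C1on V g gx gy -> r1 < r < r2 ->
  is_derive (coef g c p0 n) r (coef1 gx gy c p0 n r).
Proof.
intros H Hr. unfold coef, coef1.
apply (is_derive_RInt_slice
   (fun s p => g (px c p0 s p) (py c p0 s p) * cos (INR n * p))
   (fun s p => (cos (p0 + p) * gx (px c p0 s p) (py c p0 s p) +
                  sin (p0 + p) * gy (px c p0 s p) (py c p0 s p)) * cos (INR n * p)) r1 r2); auto.
- intros s t Hs. apply (is_derive_Rmult_r (fun u => g (px c p0 u t) (py c p0 u t))).
  apply (C1on_chain V g gx gy (fun u => px c p0 u t) (fun u => py c p0 u t)); auto.
  apply HA; auto. apply derive_px_r. apply derive_py_r.
- intros s t Hs. unfold cont2. cts. apply (polar_cont g gx gy s t H Hs).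
- intros s t Hs. unfold cont2. cts.
  apply (polar_cont0 gx _ _ (fun x y h => proj1 (proj2 (proj2 (H x y h)))) Hs).
  apply (polar_cont0 gy _ _ (fun x y h => proj2 (proj2 (proj2 (H x y h)))) Hs).
Qed.

Lemma coef1_derive gx gy gxx gxy gyx gyy n r :
  C1on V gx gxx gxy -> C1on V gy gyx gyy -> r1 < r < r2 ->
  is_derive (coef1 gx gy c p0 n) r (coef2 gxx gxy gyx gyy c p0 n r).
Proof.
intros Hx Hy Hr.
set (Grr := fun s p => cos (p0 + p) * (cos (p0 + p) * gxx (px c p0 s p) (py c p0 s p) +
                                sin (p0 + p) * gxy (px c p0 s p) (py c p0 s p)) +
               sin (p0 + p) * (cos (p0 + p) * gyx (px c p0 s p) (py c p0 s p) +
                                sin (p0 + p) * gyy (px c p0 s p) (py c p0 s p))).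
change (coef2 gxx gxy gyx gyy c p0 n r) with (RInt (fun p => Grr r p * cos (INR n * p)) (-PI) PI).
unfold coef1.
apply (is_derive_RInt_slice
 (fun s p => (cos (p0 + p) * gx (px c p0 s p) (py c p0 s p) +
                sin (p0 + p) * gy (px c p0 s p) (py c p0 s p)) * cos (INR n * p))
 (fun s p => Grr s p * cos (INR n * p)) r1 r2); auto.
- intros s t Hs. unfold Grr. apply (is_derive_Rmult_r (fun u => (cos (p0 + t) * gx (px c p0 u t) (py c p0 u t) +
                sin (p0 + t) * gy (px c p0 u t) (py c p0 u t)))).
  apply (is_derive_Rplus (fun u => cos (p0 + t) * gx (px c p0 u t) (py c p0 u t))).
  + apply (is_derive_Rscal (fun u => gx (px c p0 u t) (py c p0 u t))).
    apply (C1on_chain V gx gxx gxy (fun u => px c p0 u t) (fun u => py c p0 u t)); auto.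
    apply HA; auto. apply derive_px_r. apply derive_py_r.
  + apply (is_derive_Rscal (fun u => gy (px c p0 u t) (py c p0 u t))).
    apply (C1on_chain V gy gyx gyy (fun u => px c p0 u t) (fun u => py c p0 u t)); auto.
    apply HA; auto. apply derive_px_r. apply derive_py_r.
- intros s t Hs. unfold cont2. cts.
  apply (polar_cont gx gxx gxy); auto. apply (polar_cont gy gyx gyy); auto.
- intros s t Hs. unfold cont2, Grr. cts.
  + apply (polar_cont0 gxx _ _ (fun x y h => proj1 (proj2 (proj2 (Hx x y h)))) Hs).
  + apply (polar_cont0 gxy _ _ (fun x y h => proj2 (proj2 (proj2 (Hx x y h)))) Hs).
  + apply (polar_cont0 gyx _ _ (fun x y h => proj1 (proj2 (proj2 (Hy x y h)))) Hs).
  + apply (polar_cont0 gyy _ _ (fun x y h => proj2 (proj2 (proj2 (Hy x y h)))) Hs).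
Qed.

(** Bessel's equation for a mode: separation of variables in polar coordinates, carried out under
    the integral sign. *)
Lemma coef_derive2 k g gx gy n r :
  helm k V g gx gy -> r1 < r < r2 -> r <> 0 ->
  is_derive (coef1 gx gy c p0 n) r
    (- coef1 gx gy c p0 n r / r - (k ^ 2 - INR n ^ 2 / r ^ 2) * coef g c p0 n r).
Proof.
intros [H [gxx [gxy [gyx [gyy [Hx [Hy HE]]]]]]] Hr Hr0.
assert (D := coef1_derive gx gy gxx gxy gyx gyy n r Hx Hy Hr).
set (Gp := fun p => - r * sin (p0 + p) * gx (px c p0 r p) (py c p0 r p) +
                    r * cos (p0 + p) * gy (px c p0 r p) (py c p0 r p)).
set (Gpp := fun p => - r * cos (p0 + p) * gx (px c p0 r p) (py c p0 r p)
                     - r * sin (p0 + p) * gy (px c p0 r p) (py c p0 r p)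
  + - r * sin (p0 + p) * (- r * sin (p0 + p) * gxx (px c p0 r p) (py c p0 r p) +
                    r * cos (p0 + p) * gxy (px c p0 r p) (py c p0 r p))
  + r * cos (p0 + p) * (- r * sin (p0 + p) * gyx (px c p0 r p) (py c p0 r p) +
                    r * cos (p0 + p) * gyy (px c p0 r p) (py c p0 r p))).
(* Integrating by parts twice in the angle; the boundary terms cancel by periodicity. *)
assert (I : is_RInt (fun p => Gpp p * cos (INR n * p) +
     INR n ^ 2 * (g (px c p0 r p) (py c p0 r p) * cos (INR n * p))) (-PI) PI 0).
{ set (P := fun p => Gp p * cos (INR n * p) + INR n * (g (px c p0 r p) (py c p0 r p) * sin (INR n * p))).
  replace 0 with (minus (P PI) (P (- PI))).
  apply (is_RInt_derive P).
  - intros p _. unfold P, Gp.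
    assert (Vp : V (px c p0 r p, py c p0 r p)) by (apply HA; auto).
    set (f1 := fun s : R => g (px c p0 r s) (py c p0 r s)) in *.
    set (f2 := fun s : R => gx (px c p0 r s) (py c p0 r s)) in *.
    set (f3 := fun s : R => gy (px c p0 r s) (py c p0 r s)) in *.
    assert (D1 : is_derive f1 p _) by exact (C1on_chain V g gx gy (px c p0 r) (py c p0 r) p _ _ HV H Vp (derive_px_p r p) (derive_py_p r p)).
    assert (D2 : is_derive f2 p _) by exact (C1on_chain V gx gxx gxy (px c p0 r) (py c p0 r) p _ _ HV Hx Vp (derive_px_p r p) (derive_py_p r p)).
    assert (D3 : is_derive f3 p _) by exact (C1on_chain V gy gyx gyy (px c p0 r) (py c p0 r) p _ _ HV Hy Vp (derive_px_p r p) (derive_py_p r p)).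
    change (is_derive (fun q => (- r * sin (p0 + q) * f2 q + r * cos (p0 + q) * f3 q) * cos (INR n * q) +
       INR n * (f1 q * sin (INR n * q))) p (Gpp p * cos (INR n * p) + INR n ^ 2 * (f1 p * cos (INR n * p)))).
    auto_derive.
    + repeat split; eexists; eassumption.
    + apply is_derive_unique in D1; apply is_derive_unique in D2; apply is_derive_unique in D3.
      change (Derive (fun x : R => f1 x) p) with (Derive f1 p).
      change (Derive (fun x : R => f2 x) p) with (Derive f2 p).
      change (Derive (fun x : R => f3 x) p) with (Derive f3 p). rewrite D1, D2, D3.
      unfold Gpp, f1, f2, f3. ring.
  - intros p _. unfold Gpp.
    assert (K : forall h, (forall x y, V (x, y) -> cont2 h x y) -> continuous (fun p => h (px c p0 r p) (py c p0 r p)) p).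
    { intros h Hh. apply (cont2_slice (fun s p => h (px c p0 s p) (py c p0 s p))).
      apply polar_cont0; auto. }
    assert (K1 := K g (fun x y => C1on_cont V g gx gy x y HV H)).
    assert (K2 := K gx (fun x y h => proj1 (proj2 (proj2 (H x y h))))).
    assert (K3 := K gy (fun x y h => proj2 (proj2 (proj2 (H x y h))))).
    assert (K4 := K gxx (fun x y h => proj1 (proj2 (proj2 (Hx x y h))))).
    assert (K5 := K gxy (fun x y h => proj2 (proj2 (proj2 (Hx x y h))))).
    assert (K6 := K gyx (fun x y h => proj1 (proj2 (proj2 (Hy x y h))))).
    assert (K7 := K gyy (fun x y h => proj2 (proj2 (proj2 (Hy x y h))))).
    cts; assumption.
  - unfold P, Gp, minus, plus, opp; simpl. unfold px, py.
    replace (cos (p0 + PI)) with (cos (p0 + - PI))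
      by (rewrite <- (cos_period _ 1); f_equal; simpl; ring).
    replace (sin (p0 + PI)) with (sin (p0 + - PI))
      by (rewrite <- (sin_period _ 1); f_equal; simpl; ring).
    replace (cos (INR n * - PI)) with (cos (INR n * PI)) by (rewrite <- cos_neg; f_equal; ring).
    replace (INR n * - PI) with (- (INR n * PI)) by ring.
    assert (S0 : sin (INR n * PI) = 0).
    { apply sin_eq_0_1. exists (Z.of_nat n). now rewrite INR_IZR_INZ. }
    rewrite sin_neg, S0. ring. }
assert (E0 : ex_RInt (fun p => g (px c p0 r p) (py c p0 r p) * cos (INR n * p)) (-PI) PI).
{ apply (ex_RInt_continuous (fun p => g (px c p0 r p) (py c p0 r p) * cos (INR n * p))). intros p _.
  apply (cont2_slice (fun s p => g (px c p0 s p) (py c p0 s p) * cos (INR n * p))).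
  unfold cont2; cts. apply (polar_cont g gx gy); auto. }
assert (E1 : ex_RInt (fun p => (cos (p0 + p) * gx (px c p0 r p) (py c p0 r p) +
                  sin (p0 + p) * gy (px c p0 r p) (py c p0 r p)) * cos (INR n * p)) (-PI) PI).
{ apply (ex_RInt_continuous (fun p => (cos (p0 + p) * gx (px c p0 r p) (py c p0 r p) +
                  sin (p0 + p) * gy (px c p0 r p) (py c p0 r p)) * cos (INR n * p))). intros p _.
  apply (cont2_slice (fun s p => (cos (p0 + p) * gx (px c p0 s p) (py c p0 s p) +
                  sin (p0 + p) * gy (px c p0 s p) (py c p0 s p)) * cos (INR n * p))).
  unfold cont2; cts. apply (polar_cont gx gxx gxy); auto. apply (polar_cont gy gyx gyy); auto. }
replace (- coef1 gx gy c p0 n r / r - (k ^ 2 - INR n ^ 2 / r ^ 2) * coef g c p0 n r)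
  with (coef2 gxx gxy gyx gyy c p0 n r); auto.
unfold coef2.
apply is_RInt_unique.
eapply is_RInt_ext.
(* In polar form the second radial derivative is [- g_r / r - g_pp / r^2 - k^2 g], with [Gpp] for
   [g_pp]. Adding the vanishing integral [I] with weight [- / r^2] trades [g_pp] for [- n^2 g]. *)
2:{ replace (- coef1 gx gy c p0 n r / r - (k ^ 2 - INR n ^ 2 / r ^ 2) * coef g c p0 n r)
   with (plus (plus (scal (-/r) (coef1 gx gy c p0 n r)) (scal (- (k ^ 2 - INR n ^ 2 / r ^ 2)) (coef g c p0 n r)))
      (scal (- / r^2) 0)).
    - apply @is_RInt_plus. apply @is_RInt_plus.
      + apply @is_RInt_scal. apply RInt_correct. exact E1.
      + apply @is_RInt_scal. apply RInt_correct. exact E0.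
      + apply @is_RInt_scal. exact I.
    - unfold plus, scal; simpl; unfold mult; simpl. field; auto. }
intros p _. unfold plus, scal; simpl; unfold mult; simpl.
assert (Vp : V (px c p0 r p, py c p0 r p)) by (apply HA; auto).
specialize (HE _ _ Vp).
unfold Gpp.
set (X := px c p0 r p) in *. set (Y := py c p0 r p) in *.
replace (gyy X Y) with (- gxx X Y - k ^ 2 * g X Y) by (clear - HE; lra).
assert (S2 : (sin (p0+p))^2 = 1 - (cos (p0+p))^2).
{ generalize (sin2_cos2 (p0+p)); unfold Rsqr; lra. }
generalize (gxx X Y) (gxy X Y) (gyx X Y) (gx X Y) (gy X Y) (g X Y) (cos (INR n * p)).
revert S2; generalize (sin (p0 + p)) (cos (p0 + p)); intros S C S2 u1 u2 u3 u4 u5 u6 u7.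
field_simplify_eq; auto. ring [S2].
Qed.
End Polar.

(** * Pointwise convergence of cosine series *)

(** Lemmas about abstract structures leave equations in the carrier of the structure; [ring] and
    [field] want to see the type [R]. *)
Ltac req := cbv beta; lazymatch goal with |- @eq _ ?a ?b => change (@eq R a b) end.

Lemma sum_n_S (u : nat -> R) n : sum_n u (S n) = sum_n u n + u (S n).
Proof. exact (sum_Sn (G := R_AbelianMonoid) u n). Qed.

Lemma continuous_bounded (f : R -> R) a b :
  (forall x, a <= x <= b -> continuous f x) -> exists M, 0 < M /\ forall x, a <= x <= b -> Rabs (f x) <= M.
Proof.
intros H. destruct (Rle_dec a b) as [Hab|Hab].
2:{ exists 1; split; [lra|]. intros; lra. }
destruct (continuity_ab_maj (fun x => Rabs (f x)) a b Hab) as [m [Hm _]].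
{ intros c Hc. apply continuity_pt_filterlim. apply (continuous_comp f Rabs). apply H; auto.
  apply continuity_pt_filterlim, Rcontinuity_abs. }
exists (Rabs (f m) + 1). split. generalize (Rabs_pos (f m)); lra.
intros x Hx. specialize (Hm x Hx). simpl in Hm. lra.
Qed.

(** The halved constant term of a cosine series; with it the partial sums of cosines form the
    Dirichlet kernel [dker]. *)
Definition ew (n : nat) : R := match n with O => / 2 | _ => 1 end.

Lemma ew_abs n : Rabs (ew n) <= 1.
Proof. destruct n; simpl; rewrite Rabs_pos_eq; lra. Qed.

Definition dker (N : nat) (p : R) : R := sum_n (fun n => ew n * cos (INR n * p)) N.

(** Each [2 sin (p / 2) cos (n p)] is the difference of two consecutive sines at half-integer
    frequencies, so the sum telescopes. *)
Lemma dker_closed N p : 2 * sin (p / 2) * dker N p = sin ((INR N + / 2) * p).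
Proof.
unfold dker. induction N as [|N IH].
- rewrite sum_O. simpl. rewrite Rmult_0_l, cos_0. replace ((0 + / 2) * p) with (p / 2) by field. field.
- rewrite sum_n_S. rewrite Rmult_plus_distr_l, IH. unfold ew.
  rewrite S_INR.
  replace ((INR N + / 2) * p) with ((INR N + 1) * p - p / 2) by field.
  replace ((INR N + 1 + / 2) * p) with ((INR N + 1) * p + p / 2) by field.
  rewrite sin_plus, sin_minus. ring.
Qed.

Lemma dker_cont N p : continuous (dker N) p.
Proof.
unfold dker. induction N as [|N IH].
- apply (continuous_ext (fun p => ew 0 * cos (INR 0 * p))). intros; now rewrite sum_O. cts.
- apply (continuous_ext (fun p => sum_n (fun n => ew n * cos (INR n * p)) N + ew (S N) * cos (INR (S N) * p))).
  intros; now rewrite sum_n_S. cts. exact IH.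
Qed.

Lemma ex_RInt_cont (f : R -> R) a b : (forall x, continuous f x) -> ex_RInt f a b.
Proof. intros H. apply (ex_RInt_continuous f). auto. Qed.

Lemma RInt_Rplus (f g : R -> R) a b : (forall x, continuous f x) -> (forall x, continuous g x) ->
  RInt (fun x => f x + g x) a b = RInt f a b + RInt g a b.
Proof. intros. apply (RInt_plus f g); apply ex_RInt_cont; auto. Qed.

Lemma RInt_Rscal (f : R -> R) k a b : (forall x, continuous f x) ->
  RInt (fun x => k * f x) a b = k * RInt f a b.
Proof. intros. apply (RInt_scal f); apply ex_RInt_cont; auto. Qed.

Lemma is_RInt_FTC (F f : R -> R) a b v :
  (forall x, Rmin a b <= x <= Rmax a b -> is_derive F x (f x)) ->
  (forall x, Rmin a b <= x <= Rmax a b -> continuous f x) ->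
  F b - F a = v -> is_RInt f a b v.
Proof. intros H1 H2 <-. apply (is_RInt_derive F f); auto. Qed.

Lemma RInt_dker N : RInt (dker N) 0 PI = PI / 2.
Proof.
induction N as [|N IH].
- rewrite (RInt_ext _ (fun _ => / 2)). rewrite RInt_const. change ((PI - 0) * / 2 = PI / 2). field.
  intros x _. unfold dker. rewrite sum_O. simpl. rewrite Rmult_0_l, cos_0. ring.
- rewrite (RInt_ext _ (fun p => dker N p + 1 * cos (INR (S N) * p))).
  2:{ intros x _. unfold dker. now rewrite sum_n_S. }
  rewrite RInt_Rplus, IH.
  2: apply dker_cont.
  2: intros; cts.
  assert (K : RInt (fun p => 1 * cos (INR (S N) * p)) 0 PI = 0).
  { assert (HS : INR (S N) <> 0) by (apply not_0_INR; lia).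
    apply is_RInt_unique.
    assert (Z : / INR (S N) * sin (INR (S N) * PI) - / INR (S N) * sin (INR (S N) * 0) = 0).
    { rewrite Rmult_0_r, sin_0, sin_eq_0_1. ring.
      exists (Z.of_nat (S N)). now rewrite INR_IZR_INZ. }
    apply (is_RInt_FTC (fun p => / INR (S N) * sin (INR (S N) * p)) (fun p => 1 * cos (INR (S N) * p))).
    - intros x _. revert HS; generalize (INR (S N)); intros m Hm. auto_derive; auto. field; auto.
    - intros x _. cts.
    - exact Z. }
  rewrite K. apply Rplus_0_r.
Qed.

Lemma coef_sum_dker (h : R -> R) N : (forall p, continuous h p) ->
  sum_n (fun n => ew n * RInt (fun p => h p * cos (INR n * p)) (- PI) PI) N =
  RInt (fun p => h p * dker N p) (-PI) PI.
Proof.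
intros Hh. induction N as [|N IH].
- rewrite sum_O. rewrite <- RInt_Rscal by (intros; cts; auto).
  apply RInt_ext. intros p _. unfold dker. rewrite sum_O. req. ring.
- rewrite sum_n_S, IH.
  rewrite <- RInt_Rscal by (intros; cts; auto).
  rewrite <- RInt_Rplus.
  + apply RInt_ext. intros p _. unfold dker. rewrite sum_n_S. req. ring.
  + intros; cts; auto. apply dker_cont.
  + intros; cts; auto.
Qed.

Lemma dker_even N p : dker N (- p) = dker N p.
Proof.
unfold dker. apply sum_n_ext. intros n. f_equal. rewrite <- cos_neg. f_equal. ring.
Qed.

(** The kernel is even and has integral [PI / 2] on the half period. Folding the integral at 0
    therefore gives an error term whose factor [h p + h (- p) - 2 h 0] vanishes at 0, where the
    kernel is large. *)
Lemma fourier_even (h : R -> R) N : (forall p, continuous h p) ->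
  RInt (fun p => h p * dker N p) (-PI) PI - PI * h 0 =
  RInt (fun p => (h p + h (- p) - 2 * h 0) * dker N p) 0 PI.
Proof.
intros Hh.
assert (C1 : forall p, continuous (fun p => h p * dker N p) p) by (intros; cts; auto using dker_cont).
assert (Cm : forall p, continuous (fun p => h (- p)) p).
{ intros p. apply (continuous_comp (fun p => - p) h); auto. apply (continuous_Ropp (fun p : R => p)). apply continuous_id. }
rewrite <- (RInt_Chasles (fun p => h p * dker N p) (-PI) 0 PI) by (apply ex_RInt_cont; auto).
replace (RInt (fun p => h p * dker N p) (-PI) 0) with (RInt (fun p => h (-p) * dker N p) 0 PI).
2:{ set (F := fun p => h p * dker N p) in *.
    assert (X1 := opp_RInt_swap F 0 (-PI) (ex_RInt_cont F _ _ C1)).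
    assert (X2 := is_RInt_comp_opp F 0 PI (RInt F 0 (-PI))).
    rewrite Ropp_0 in X2. specialize (X2 (RInt_correct F _ _ (ex_RInt_cont F _ _ C1))).
    rewrite <- X1. apply is_RInt_unique.
    eapply is_RInt_ext. 2: apply (is_RInt_opp _ _ _ _ X2).
    intros p _. unfold F. rewrite dker_even. apply Ropp_involutive. }
rewrite (RInt_ext (fun p => (h p + h (- p) - 2 * h 0) * dker N p)
   (fun p => h (- p) * dker N p + h p * dker N p + (-2 * h 0) * dker N p)).
2:{ intros; req; ring. }
rewrite RInt_Rplus, RInt_Rplus, RInt_Rscal, RInt_dker; auto.
unfold plus; simpl. req. field.
- apply dker_cont.
- intros; cts; auto using dker_cont.
- intros; cts; auto using dker_cont.
- intros; cts; auto using dker_cont.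
Qed.

Lemma sin_ge_half x : 0 <= x <= 1 -> x / 2 <= sin x.
Proof.
intros Hx.
destruct (MVT_gen sin 0 x cos) as [c [Hc E]].
- intros; auto_derive; auto; ring.
- intros; apply continuity_sin.
- rewrite Rmin_left, Rmax_right in Hc by lra. rewrite sin_0, !Rminus_0_r in E.
  assert (HP := PI2_1). assert (HP3 := PI2_3_2).
  assert (cos (PI / 3) <= cos c) by (apply cos_decr_1; lra).
  rewrite cos_PI3 in H. nra.
Qed.

Lemma RInt_abs_le (f : R -> R) a b M : a <= b -> ex_RInt f a b ->
  (forall x, a < x < b -> Rabs (f x) <= M) -> Rabs (RInt f a b) <= (b - a) * M.
Proof.
intros Hab Hex HM.
eapply Rle_trans. apply abs_RInt_le; auto.
replace ((b - a) * M) with (RInt (fun _ => M) a b) by (rewrite RInt_const; reflexivity).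
apply RInt_le; auto.
- apply (ex_RInt_norm f a b Hex).
- apply ex_RInt_const.
Qed.

Lemma mvt_bound (f df : R -> R) a b M :
  (forall x, Rmin a b <= x <= Rmax a b -> is_derive f x (df x)) ->
  (forall x, Rmin a b <= x <= Rmax a b -> Rabs (df x) <= M) ->
  Rabs (f b - f a) <= M * Rabs (b - a).
Proof.
intros Hd HM.
destruct (MVT_gen f a b df) as [c [Hc E]].
- intros; apply Hd; lra.
- intros x Hx. apply continuity_pt_filterlim. eapply is_derive_cont. apply Hd; auto.
- rewrite E, Rabs_mult. apply Rmult_le_compat_r; auto using Rabs_pos.
Qed.

(** The error integral is cut at a small [d]. Below [d] the integrand is bounded independently of
    [N], since the first factor is of order [p] and the kernel at most of order [1 / p]. Above [d]
    one integration by parts gains a factor [1 / N]. *)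
Theorem fourier_pointwise (h dh : R -> R) :
  (forall p, is_derive h p (dh p)) -> (forall p, continuous dh p) ->
  is_series (fun n => ew n * RInt (fun p => h p * cos (INR n * p)) (- PI) PI) (PI * h 0).
Proof.
intros Hd Hc.
assert (Hh : forall p, continuous h p).
{ intros p. eapply is_derive_cont; apply Hd. }
destruct (continuous_bounded dh (-PI) PI) as [B [HB HB']]; [auto|].
generalize PI2_1; intros HPI.
set (f := fun p => h p + h (- p) - 2 * h 0).
assert (Df : forall p, is_derive f p (dh p - dh (- p))).
{ intros p. unfold f. auto_derive. repeat split; eexists; apply Hd.
  rewrite (is_derive_unique (fun x : R => h x) p _ (Hd p)), (is_derive_unique (fun x : R => h x) (-p) _ (Hd (-p))). ring. }
assert (Cdf : forall p, continuous (fun p => dh p - dh (- p)) p).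
{ intros p. apply (continuous_minus dh); auto. apply (continuous_comp (fun p => - p) dh); auto.
  apply (continuous_Ropp (fun p : R => p)). apply continuous_id. }
assert (Cf : forall p, continuous f p).
{ intros p. eapply is_derive_cont; apply Df. }
assert (F : forall p, 0 <= p <= PI -> Rabs (f p) <= 2 * B * p).
{ intros p Hp. replace (f p) with (f p - f 0) by (unfold f; rewrite Ropp_0; ring).
  replace (2 * B * p) with (2 * B * Rabs (p - 0)) by (rewrite Rminus_0_r, Rabs_pos_eq; lra).
  apply mvt_bound with (df := fun p => dh p - dh (- p)). intros; apply Df.
  rewrite Rmin_left, Rmax_right by lra. intros x Hx.
  unfold Rminus. eapply Rle_trans. apply Rabs_triang. rewrite Rabs_Ropp.
  generalize (HB' x) (HB' (-x)). lra. }
change (is_lim_seq (sum_n (fun n => ew n * RInt (fun p => h p * cos (INR n * p)) (- PI) PI)) (PI * h 0)).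
apply is_lim_seq_spec. intros eps.
(* The part below [d] will be at most [4 B d], hence below [eps / 2]; [d <= 1] keeps [sin_ge_half]
   applicable. *)
set (d := Rmin 1 (eps / (8 * B + 1))).
assert (He := cond_pos eps).
assert (Hd0 : 0 < d <= 1).
{ split. apply Rmin_glb_lt; try lra. apply Rdiv_lt_0_compat; lra. apply Rmin_l. }
assert (Hde : d * (4 * B) < eps / 2).
{ apply Rle_lt_trans with (eps / (8 * B + 1) * (4 * B)).
  apply Rmult_le_compat_r. lra. apply Rmin_r.
  apply Rmult_lt_reg_r with (8 * B + 1). lra. replace (eps / (8 * B + 1) * (4 * B) * (8 * B + 1)) with (eps * (4 * B)) by (field; lra). nra. }
(* By the closed form of the kernel, [f p * dker N p] is [q p * sin ((N + 1/2) p)], and [q] is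
   smooth away from 0. *)
set (q := fun p => f p / (2 * sin (p / 2))).
set (dq := fun p => ((dh p - dh (- p)) * (2 * sin (p / 2)) - f p * cos (p / 2)) / (2 * sin (p / 2)) ^ 2).
assert (Sp : forall p, d <= p <= PI -> 0 < sin (p / 2)).
{ intros p Hp. apply sin_gt_0; lra. }
assert (Dq : forall p, d <= p <= PI -> is_derive q p (dq p)).
{ intros p Hp. specialize (Sp p Hp). unfold q.
  auto_derive. split. eexists; apply Df. split; auto. change (p * / 2) with (p / 2). lra.
  rewrite (is_derive_unique (fun x : R => f x) p _ (Df p)). unfold dq. change (p * / 2) with (p / 2). field. lra. }
assert (Cs : forall p, continuous (fun p => sin (p / 2)) p).
{ intros p. unfold Rdiv. cts. }
assert (Cdq : forall p, d <= p <= PI -> continuous dq p).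
{ intros p Hp. specialize (Sp p Hp). unfold dq, Rdiv, Rminus.
  apply continuous_Rmult.
  - apply continuous_Rplus. apply continuous_Rmult. apply Cdf. cts.
    apply (continuous_opp (fun p => f p * cos (p * / 2))). cts. auto.
  - apply (continuous_comp (fun p => (2 * sin (p * /2)) ^ 2) Rinv).
    + apply (continuous_ext (fun p => (2 * sin (p * / 2)) * (2 * sin (p * / 2)))). intros; simpl; ring. cts.
    + apply continuous_Rinv. apply pow_nonzero. change (p * / 2) with (p / 2). lra. }
destruct (continuous_bounded dq d PI Cdq) as [Q' [HQ' HQ'']].
destruct (continuous_bounded q d PI) as [Q [HQ HQb]].
{ intros p Hp. eapply is_derive_cont; apply Dq; auto. }
destruct (INR_unbounded (2 * (2 * Q + 4 * Q') / eps)) as [N0 HN0].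
exists N0. intros N HN.
rewrite coef_sum_dker, fourier_even by auto.
assert (CD : forall p, continuous (fun p => f p * dker N p) p) by (intros; cts; auto using dker_cont).
change (Rabs (RInt (fun p => f p * dker N p) 0 PI) < eps).
rewrite <- (RInt_Chasles (fun p => f p * dker N p) 0 d PI) by (apply ex_RInt_cont; auto).
eapply Rle_lt_trans. apply (Rabs_triang (RInt (fun p => f p * dker N p) 0 d) (RInt (fun p => f p * dker N p) d PI)).
assert (I1 : Rabs (RInt (fun p => f p * dker N p) 0 d) <= (d - 0) * (4 * B)).
{ apply RInt_abs_le. lra. apply ex_RInt_cont; auto. intros p Hp.
  rewrite Rabs_mult.
  assert (K : Rabs (dker N p) * (p / 2) <= 1).
  { assert (E := dker_closed N p).
    assert (S1 : p / 2 <= 2 * sin (p / 2)). { generalize (sin_ge_half (p/2)); lra. }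
    apply Rle_trans with (Rabs (2 * sin (p / 2) * dker N p)).
    - rewrite Rabs_mult, Rmult_comm, (Rabs_pos_eq (2 * _)) by lra. apply Rmult_le_compat_r; auto using Rabs_pos.
    - rewrite E. apply Rabs_le. apply SIN_bound. }
  apply Rle_trans with (2 * B * p * Rabs (dker N p)).
  apply Rmult_le_compat_r; auto using Rabs_pos. apply F; lra.
  replace (2 * B * p * Rabs (dker N p)) with ((4 * B) * (Rabs (dker N p) * (p / 2))) by field.
  rewrite <- (Rmult_1_r (4 * B)) at 2. apply Rmult_le_compat_l; lra. }
set (m := INR N + / 2).
assert (Hm : 0 < m). { unfold m. generalize (pos_INR N); lra. }
assert (I2 : Rabs (RInt (fun p => f p * dker N p) d PI) <= (2 * Q + 4 * Q') / m).
{ set (g1 := fun p => - (q p * cos (m * p)) / m).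
  assert (R1 : is_RInt (fun p => q p * sin (m * p) + - / m * (dq p * cos (m * p))) d PI (minus (g1 PI) (g1 d))).
  { apply (is_RInt_derive g1).
    - rewrite Rmin_left, Rmax_right by lra. intros p Hp. unfold g1. auto_derive.
      eexists; apply Dq; auto.
      rewrite (is_derive_unique (fun x : R => q x) p _ (Dq p Hp)). field. lra.
    - rewrite Rmin_left, Rmax_right by lra. intros p Hp.
      assert (continuous q p). { eapply is_derive_cont; apply Dq; auto. }
      cts; auto. }
  assert (ex2 : ex_RInt (fun p => dq p * cos (m * p)) d PI).
  { apply (ex_RInt_continuous (fun p => dq p * cos (m * p))). rewrite Rmin_left, Rmax_right by lra. intros p Hp. cts; auto. }
  assert (R2 := @is_RInt_plus R_NormedModule _ _ _ _ _ _ R1 (@is_RInt_scal R_NormedModule _ _ _ (/ m) _ (RInt_correct _ _ _ ex2))).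
  assert (R3 : RInt (fun p => f p * dker N p) d PI =
     g1 PI + - g1 d + / m * RInt (fun p => dq p * cos (m * p)) d PI).
  { apply is_RInt_unique. eapply is_RInt_ext. 2: apply R2.
    rewrite Rmin_left, Rmax_right by lra. intros p Hp.
    change (q p * sin (m * p) + - / m * (dq p * cos (m * p)) + / m * (dq p * cos (m * p)) = f p * dker N p).
    assert (Sp1 : 0 < sin (p / 2)) by (apply Sp; lra).
    unfold m at 1. rewrite <- dker_closed. unfold q. field. lra. }
  rewrite R3.
  assert (B2 : Rabs (RInt (fun p => dq p * cos (m * p)) d PI) <= (PI - d) * Q').
  { apply RInt_abs_le; auto. lra. intros p Hp. rewrite Rabs_mult. rewrite <- (Rmult_1_r Q').
    apply Rmult_le_compat; auto using Rabs_pos. apply HQ''; lra. apply Rabs_le, COS_bound. }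
  assert (B3 : (PI - d) * Q' <= 4 * Q'). { apply Rmult_le_compat_r. lra. generalize PI_4; lra. }
  assert (G : forall p, d <= p <= PI -> Rabs (g1 p) <= Q / m).
  { intros p Hp. unfold g1, Rdiv. rewrite Rabs_mult, Rabs_Ropp, Rabs_mult.
    rewrite (Rabs_pos_eq (/ m)) by (left; apply Rinv_0_lt_compat; lra).
    apply Rmult_le_compat_r. left; apply Rinv_0_lt_compat; lra.
    rewrite <- (Rmult_1_r Q). apply Rmult_le_compat; auto using Rabs_pos. apply Rabs_le, COS_bound. }
  eapply Rle_trans. apply Rabs_triang. eapply Rle_trans. apply Rplus_le_compat_r, Rabs_triang.
  rewrite Rabs_Ropp, Rabs_mult. rewrite (Rabs_pos_eq (/ m)) by (left; apply Rinv_0_lt_compat; lra).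
  assert (G1 := G PI). assert (G2 := G d).
  replace ((2 * Q + 4 * Q') / m) with (Q / m + Q / m + / m * (4 * Q')) by (field; lra).
  apply Rplus_le_compat. apply Rplus_le_compat. apply G1; lra. apply G2; lra.
  apply Rmult_le_compat_l. left; apply Rinv_0_lt_compat; lra. lra. }
assert (I3 : (2 * Q + 4 * Q') / m < eps / 2).
{ assert (INR N0 <= INR N) by (apply le_INR; auto).
  apply Rmult_lt_reg_r with m; auto. replace ((2 * Q + 4 * Q') / m * m) with (2 * Q + 4 * Q') by (field; lra).
  assert (2 * (2 * Q + 4 * Q') / eps < m) by (unfold m; lra).
  apply Rmult_lt_compat_r with (r := eps) in H0; auto.
  replace (2 * (2 * Q + 4 * Q') / eps * eps) with (2 * (2 * Q + 4 * Q')) in H0 by (field; lra). lra. }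
lra.
Qed.

(** * Unique continuation *)

Lemma derive_nonneg_incr (f df : R -> R) a b : a <= b ->
  (forall x, a <= x <= b -> is_derive f x (df x)) ->
  (forall x, a <= x <= b -> 0 <= df x) -> f a <= f b.
Proof.
intros Hab Hd Hp.
destruct (MVT_gen f a b df) as [c [Hc E]]; rewrite ?Rmin_left, ?Rmax_right in * by lra.
- intros; apply Hd; lra.
- intros x Hx. apply continuity_pt_filterlim. eapply is_derive_cont. apply Hd; lra.
- generalize (Hp c Hc). nra.
Qed.

Lemma is_derive_mult_R (f g : R -> R) x df dg :
  is_derive f x df -> is_derive g x dg -> is_derive (fun t => f t * g t) x (df * g x + f x * dg).
Proof.
intros Hf Hg. apply (is_derive_mult f g x df dg Hf Hg).
intros; apply Rmult_comm.
Qed.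

Lemma is_derive_eq (f : R -> R) x l l' : is_derive f x l -> l = l' -> is_derive f x l'.
Proof. now intros H <-. Qed.

(** To the right of [x0] the function [E] times [exp (- c (t - x0))] is nonincreasing, to the left
    [E] times [exp (c (t - x0))] is nondecreasing; both vanish at [x0]. *)
Lemma gronwall_zero (E dE : R -> R) (a b c x0 x : R) :
  a < x0 < b -> a < x < b ->
  (forall y, a < y < b -> is_derive E y (dE y)) ->
  (forall y, a < y < b -> 0 <= E y) ->
  (forall y, a < y < b -> Rabs (dE y) <= c * E y) -> E x0 = 0 -> E x = 0.
Proof.
intros Hx0 Hx HD HP HB H0.
apply Rle_antisym; [|apply HP; auto].
assert (De : forall s y, is_derive (fun t => exp (s * (t - x0))) y (s * exp (s * (y - x0)))).
{ intros s y. auto_derive; auto. unfold Rminus; ring. }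
destruct (Rle_dec x0 x) as [L|L].
- assert (M := derive_nonneg_incr (fun t => - (E t * exp (- c * (t - x0))))
    (fun t => (c * E t - dE t) * exp (- c * (t - x0))) x0 x L).
  assert (M' : - (E x0 * exp (- c * (x0 - x0))) <= - (E x * exp (- c * (x - x0)))).
  { apply M.
    - intros t Ht. eapply is_derive_eq.
      apply (is_derive_opp (fun t => E t * exp (- c * (t - x0)))).
      apply is_derive_mult_R. apply HD; lra. apply De.
      change (- (dE t * exp (- c * (t - x0)) + E t * (- c * exp (- c * (t - x0)))) = (c * E t - dE t) * exp (- c * (t - x0))). ring.
    - intros t Ht. apply Rmult_le_pos. 2: left; apply exp_pos.
      assert (Ha : a < t < b) by lra. assert (Q := HB t Ha). generalize (Rle_abs (dE t)); lra. }
  rewrite H0, Rmult_0_l, Ropp_0 in M'. generalize (exp_pos (- c * (x - x0))). intros. nra.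
- assert (M := derive_nonneg_incr (fun t => (E t * exp (c * (t - x0))))
    (fun t => (c * E t + dE t) * exp (c * (t - x0))) x x0).
  assert (M' : (E x * exp (c * (x - x0))) <= (E x0 * exp (c * (x0 - x0)))).
  { apply M. lra.
    - intros t Ht. eapply is_derive_eq.
      apply is_derive_mult_R. apply HD; lra. apply De.
      req; ring.
    - intros t Ht. apply Rmult_le_pos. 2: left; apply exp_pos.
      assert (Ha : a < t < b) by lra. assert (Q := HB t Ha). generalize (Rabs_maj2 (dE t)); lra. }
  rewrite H0, Rmult_0_l in M'. generalize (exp_pos (c * (x - x0))). intros. nra.
Qed.

Lemma fourier_polar V g gx gy c r1 r2 p0 r :
  open V -> C1on V g gx gy -> annulus_in V c r1 r2 -> r1 < r < r2 ->
  is_series (fun n => ew n * coef g c p0 n r) (PI * g (px c p0 r 0) (py c p0 r 0)).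
Proof.
intros HV H HA Hr.
apply (fourier_pointwise (fun p => g (px c p0 r p) (py c p0 r p))
  (fun p => - r * sin (p0 + p) * gx (px c p0 r p) (py c p0 r p) +
            r * cos (p0 + p) * gy (px c p0 r p) (py c p0 r p))).
- intros p. apply (C1on_chain V g gx gy (px c p0 r) (py c p0 r)); auto.
  apply HA; auto. apply derive_px_p. apply derive_py_p.
- intros p.
  assert (K1 : continuous (fun p => gx (px c p0 r p) (py c p0 r p)) p).
  { apply (cont2_slice (fun s p => gx (px c p0 s p) (py c p0 s p))).
    apply (polar_cont0 V c r1 r2 p0 HA); auto. intros x y h; apply (H x y h). }
  assert (K2 : continuous (fun p => gy (px c p0 r p) (py c p0 r p)) p).
  { apply (cont2_slice (fun s p => gy (px c p0 s p) (py c p0 s p))).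
    apply (polar_cont0 V c r1 r2 p0 HA); auto. intros x y h; apply (H x y h). }
  cts; assumption.
Qed.

Lemma is_series_zero (u : nat -> R) l : (forall n, u n = 0) -> is_series u l -> l = 0.
Proof.
intros Hu H.
assert (Z : forall n, sum_n u n = 0).
{ induction n as [|n IH]. rewrite sum_O; auto. rewrite sum_n_S, IH, Hu. req; ring. }
assert (L : is_lim_seq (sum_n u) l) by exact H.
apply is_lim_seq_unique in L. rewrite (Lim_seq_ext _ (fun _ => 0)), Lim_seq_const in L by auto.
now injection L.
Qed.

Lemma fourier_polar_zero V g gx gy c r1 r2 p0 r :
  open V -> C1on V g gx gy -> annulus_in V c r1 r2 -> r1 < r < r2 ->
  (forall n, coef g c p0 n r = 0) -> g (px c p0 r 0) (py c p0 r 0) = 0.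
Proof.
intros HV H HA Hr Hz.
assert (S := fourier_polar V g gx gy c r1 r2 p0 r HV H HA Hr).
apply is_series_zero in S. 2: intros n; rewrite Hz; ring.
generalize PI_RGT_0. nra.
Qed.

(** For a solution [u] of Bessel's equation with derivative [v], the expression on the left is the
    derivative of [u^2 + v^2]. The constant depends only on the lower bound [a] of the radius, as
    [gronwall_zero] requires. *)
Lemma bessel_energy_bound K r a k n u v :
  0 < a <= r -> K = k ^ 2 - n ^ 2 / r ^ 2 ->
  Rabs (2 * u * v + 2 * v * (- v / r - K * u)) <= (1 + 2 / a + k ^ 2 + n ^ 2 / a ^ 2) * (u ^ 2 + v ^ 2).
Proof.
intros Hr ->.
assert (I : 0 < / r <= / a).
{ split. apply Rinv_0_lt_compat; lra. apply Rinv_le_contravar; lra. }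
replace (n ^ 2 / r ^ 2) with (n ^ 2 * (/ r) ^ 2) by (field; lra).
replace (n ^ 2 / a ^ 2) with (n ^ 2 * (/ a) ^ 2) by (field; lra).
replace (2 / a) with (2 * / a) by (field; lra).
replace (- v / r) with (- v * / r) by (field; lra).
set (i := / r) in *. set (j := / a) in *. clearbody i j.
assert (i ^ 2 <= j ^ 2) by nra.
assert (n ^ 2 * i ^ 2 <= n ^ 2 * j ^ 2) by (apply Rmult_le_compat_l; nra).
set (N := n ^ 2 * i ^ 2) in *. set (M := n ^ 2 * j ^ 2) in *.
assert (0 <= N) by (unfold N; apply Rmult_le_pos; apply pow2_ge_0).
clearbody N M.
assert (A1 : Rabs (2 * (u * v)) <= u ^ 2 + v ^ 2) by (apply Rabs_le; generalize (pow2_ge_0 (u+v)) (pow2_ge_0 (u-v)); intros; split; lra).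
assert (A3 : Rabs (k ^ 2 - N) <= k ^ 2 + M) by (assert (K0 := pow2_ge_0 k); apply Rabs_le; split; lra).
replace (2 * u * v + 2 * v * (- v * i - (k ^ 2 - N) * u)) with
  (2 * (u * v) + (- (2 * (v ^ 2 * i)) + - ((k ^ 2 - N) * (2 * (u * v))))) by ring.
eapply Rle_trans. apply Rabs_triang.
assert (A2 : Rabs (- (2 * (v ^ 2 * i))) <= 2 * j * (u ^ 2 + v ^ 2)).
{ rewrite Rabs_Ropp, Rabs_pos_eq by nra.
  assert (v ^ 2 * i <= (u ^ 2 + v ^ 2) * j) by (apply Rmult_le_compat; nra). lra. }
assert (A4 : Rabs (- ((k ^ 2 - N) * (2 * (u * v)))) <= (k ^ 2 + M) * (u ^ 2 + v ^ 2)).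
{ rewrite Rabs_Ropp, Rabs_mult. apply Rmult_le_compat; auto using Rabs_pos. }
eapply Rle_trans. apply Rplus_le_compat_l, Rabs_triang. lra.
Qed.

Lemma sq_sum_zero u v : u ^ 2 + v ^ 2 = 0 -> u = 0 /\ v = 0.
Proof. intros; split; nra. Qed.

(** Every mode about the centre vanishes near it and solves a linear second-order equation, hence
    vanishes up to radius [rho]. No analyticity is involved; the Fourier series then gives the value
    in the chosen direction. *)
Lemma unique_continuation_disc k V g gx gy b rho eps :
  open V -> helm k V g gx gy -> 0 < eps ->
  (forall r p, 0 <= r < rho -> V (fst b + r * cos p, snd b + r * sin p)) ->
  (forall r p, 0 <= r < eps -> g (fst b + r * cos p) (snd b + r * sin p) = 0) ->
  forall r p, 0 <= r < rho -> g (fst b + r * cos p) (snd b + r * sin p) = 0.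
Proof.
intros HV H Heps HD HZ r p Hr.
destruct (Rlt_dec r eps) as [L|L]; [apply HZ; lra|].
assert (HA : annulus_in V b 0 rho). { intros s q Hs. apply HD; lra. }
assert (Z1 : forall n s, 0 < s < eps -> coef g b p n s = 0).
{ intros n s Hs. unfold coef. rewrite (RInt_ext _ (fun _ => 0)).
  rewrite RInt_const. apply Rmult_0_r.
  intros q _. unfold px, py. rewrite HZ by lra. apply Rmult_0_l. }
assert (HC := proj1 H).
assert (Z2 : forall n s, 0 < s < eps -> coef1 gx gy b p n s = 0).
{ intros n s Hs.
  assert (D := coef_derive V b 0 rho p HV HA g gx gy n s HC ltac:(lra)).
  apply is_derive_unique in D. rewrite <- D.
  rewrite (Derive_ext_loc _ (fun _ => 0)). apply Derive_const.
  apply (filter_imp (fun s => 0 < s < eps)). intros; apply Z1; auto.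
  apply (open_and (fun s => 0 < s) (fun s => s < eps)); auto using open_gt, open_lt. }
replace r with r by ring.
assert (G := fourier_polar_zero V g gx gy b 0 rho p r HV HC HA ltac:(lra)).
unfold px, py in G. rewrite Rplus_0_r in G. apply G.
intros n.
assert (Q := gronwall_zero (fun s => coef g b p n s ^ 2 + coef1 gx gy b p n s ^ 2)
  (fun s => 2 * coef g b p n s * coef1 gx gy b p n s + 2 * coef1 gx gy b p n s *
     (- coef1 gx gy b p n s / s - (k ^ 2 - INR n ^ 2 / s ^ 2) * coef g b p n s))
   (* Bessel's equation is singular at 0, so the propagation takes place above [eps / 4] and starts
      at [eps / 2], where mode and derivative are known to vanish. *)
   (eps / 4) rho (1 + 2 / (eps / 4) + k ^ 2 + INR n ^ 2 / (eps / 4) ^ 2) (eps / 2) r).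
apply (sq_sum_zero _ (coef1 gx gy b p n r)). apply Q; try lra.
- intros s Hs.
  assert (D1 := coef_derive V b 0 rho p HV HA g gx gy n s HC ltac:(lra)).
  assert (D2 := coef_derive2 V b 0 rho p HV HA k g gx gy n s H ltac:(lra) ltac:(lra)).
  set (A1 := coef g b p n) in *. set (B1 := coef1 gx gy b p n) in *.
  apply (is_derive_ext (fun s => A1 s * A1 s + B1 s * B1 s)). intros; simpl; ring.
  eapply is_derive_eq. apply is_derive_Rplus; apply is_derive_mult_R; eassumption. req; ring.
- intros; nra.
- intros s Hs. apply bessel_energy_bound; auto. lra.
- rewrite Z1, Z2 by lra. ring.
Qed.

Lemma locally_plane (x : plane) (P : plane -> Prop) :
  locally x P <-> exists e, 0 < e /\ forall a b, Rabs a < e -> Rabs b < e -> P (fst x + a, snd x + b).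
Proof.
split.
- intros [e H]. exists e. split. apply cond_pos. intros a b Ha Hb. apply H.
  split; unfold ball; simpl; unfold AbsRing_ball, abs, minus, plus, opp; simpl.
  replace (fst x + a + - fst x) with a by ring; auto.
  replace (snd x + b + - snd x) with b by ring; auto.
- intros [e [He H]]. exists (mkposreal e He). intros [y1 y2] [H1 H2].
  unfold ball in *; simpl in *; unfold AbsRing_ball, abs, minus, plus, opp in *; simpl in *.
  replace (y1, y2) with (fst x + (y1 - fst x), snd x + (y2 - snd x)) by (f_equal; ring).
  apply H; auto.
Qed.

Lemma continuous_pair {T : UniformSpace} (f g : T -> R) t :
  continuous f t -> continuous g t -> continuous (fun s => (f s, g s) : plane) t.
Proof.
intros Hf Hg. apply (continuous_comp_2 f g (fun u v => (u, v) : plane)); auto.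
apply (continuous_ext (fun z : plane => z)). now intros []. apply continuous_id.
Qed.

Lemma sqr_eq_sign b x : x ^ 2 = b ^ 2 -> 0 <= b * x -> b = x.
Proof.
intros H H'. assert (K : (x - b) * (x + b) = 0) by (simpl in H; lra).
apply Rmult_integral in K. destruct K as [K|K]. lra. assert (x = - b) by lra. subst x. nra.
Qed.

Lemma polar_exists a b : exists p, a = sqrt (a ^ 2 + b ^ 2) * cos p /\ b = sqrt (a ^ 2 + b ^ 2) * sin p.
Proof.
set (r := sqrt (a ^ 2 + b ^ 2)).
assert (Hr : r * r = a ^ 2 + b ^ 2) by (apply sqrt_sqrt; nra).
assert (Hr0 : 0 <= r) by apply sqrt_pos.
destruct (Req_dec r 0) as [Z|NZ].
- exists 0. rewrite Z in *. split; nra.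
- assert (Hp : 0 < r) by lra.
  assert (B : -1 <= a / r <= 1).
  { assert (a <= r) by nra. assert (- r <= a).
    { destruct (Rle_dec (- r) a); auto. exfalso. assert (r < - a) by lra. nra. }
    assert (Ea : a / r * r = a) by (field; lra).
    split; apply Rmult_le_reg_r with r; auto; rewrite Ea; lra. }
  assert (E : cos (acos (a / r)) = a / r) by (apply cos_acos; auto).
  assert (S : (r * sin (acos (a / r))) ^ 2 = b ^ 2).
  { rewrite Rpow_mult_distr. generalize (sin2_cos2 (acos (a / r))). unfold Rsqr. rewrite E. intros H.
    replace (sin (acos (a / r)) ^ 2) with (1 - (a / r) * (a / r)) by (simpl; lra).
    field_simplify; try lra. }
  destruct (Rle_dec 0 (b * (r * sin (acos (a / r))))) as [L|L].
  + exists (acos (a / r)). split. rewrite E. field; lra. apply sqr_eq_sign; auto.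
  + exists (- acos (a / r)). rewrite cos_neg, sin_neg. split. rewrite E. field; lra. apply sqr_eq_sign. rewrite <- S. ring. lra.
Qed.

Lemma polar_abs r p : 0 <= r -> Rabs (r * cos p) <= r /\ Rabs (r * sin p) <= r.
Proof.
intros Hr. rewrite !Rabs_mult, (Rabs_pos_eq r) by auto. split; rewrite <- (Rmult_1_r r) at 2;
apply Rmult_le_compat_l; auto; apply Rabs_le. apply COS_bound. apply SIN_bound.
Qed.

Lemma norm2_lt a b e : Rabs a < e -> Rabs b < e -> sqrt (a ^ 2 + b ^ 2) < 2 * e.
Proof.
intros Ha Hb. assert (He : 0 < e) by (generalize (Rabs_pos a); lra).
apply Rsqr_incrst_0; try lra. 2: apply sqrt_pos.
rewrite Rsqr_sqrt by nra. unfold Rsqr.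
apply Rabs_def2 in Ha. apply Rabs_def2 in Hb. nra.
Qed.

Definition zero_near (g : R -> R -> R) (x : plane) : Prop :=
  locally x (fun z => g (fst z) (snd z) = 0).

(** The disc of radius [e / 2] about the point with offset [(a, b)] stays inside the square of
    half-side [e] and covers the square of half-side [e / 8]: two points of the small square differ
    by less than [e / 4] in each coordinate. *)
Lemma zero_near_disc k V g gx gy (x : plane) e :
  open V -> helm k V g gx gy -> 0 < e ->
  (forall a b, Rabs a < e -> Rabs b < e -> V (fst x + a, snd x + b)) ->
  forall a b, Rabs a < e / 8 -> Rabs b < e / 8 -> zero_near g (fst x + a, snd x + b) ->
  forall u v, Rabs u < e / 8 -> Rabs v < e / 8 -> g (fst x + u) (snd x + v) = 0.
Proof.
intros HV H He HB a b Ha Hb Hz u v Hu Hv.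
apply locally_plane in Hz. destruct Hz as [d [Hd Hz]]. simpl in Hz.
set (y := (fst x + a, snd x + b)).
destruct (polar_exists (u - a) (v - b)) as [p [E1 E2]].
set (r := sqrt ((u - a) ^ 2 + (v - b) ^ 2)) in *.
assert (Hr : r < 2 * (e / 4)).
{ apply norm2_lt. eapply Rle_lt_trans. apply Rabs_triang. rewrite Rabs_Ropp; lra.
  eapply Rle_lt_trans. apply Rabs_triang. rewrite Rabs_Ropp; lra. }
assert (Hr0 : 0 <= r) by apply sqrt_pos.
replace (fst x + u) with (fst y + r * cos p) by (unfold y; simpl; lra).
replace (snd x + v) with (snd y + r * sin p) by (unfold y; simpl; lra).
apply (unique_continuation_disc k V g gx gy y (e / 2) d HV H Hd).
- intros s q Hs. destruct (polar_abs s q) as [P1 P2]. lra.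
  unfold y; simpl. rewrite !Rplus_assoc. apply HB; eapply Rle_lt_trans; try apply Rabs_triang; lra.
- intros s q Hs. destruct (polar_abs s q) as [P1 P2]. lra. apply Hz; lra.
- lra.
Qed.

(** Zeros in a neighbourhood form an open set, and by the disc lemma so do the other points of [V].
    The set [A] itself need not be open; it will also be a line. *)
Lemma unique_continuation k V g gx gy (A : plane -> Prop) a :
  open V -> helm k V g gx gy -> connected_set A -> (forall x, A x -> V x) ->
  A a -> zero_near g a -> forall x, A x -> zero_near g x.
Proof.
intros HV H HA HAV Ha Hz.
destruct (HA (zero_near g) (fun x => V x /\ ~ zero_near g x)) as [L|L]; auto.
- intros x Hx. apply (locally_locally x _ Hx).
- intros x [Vx Nx].
  destruct (proj1 (locally_plane x V) (HV x Vx)) as [e [He HB]].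
  apply locally_plane. exists (e / 8). split. lra. intros u v Hu Hv. split.
  apply HB; lra.
  intros Hzz. apply Nx. apply locally_plane. exists (e / 8). split; [lra|]. intros a' b' Ha' Hb'. simpl.
  apply (zero_near_disc k V g gx gy x e HV H He HB u v Hu Hv Hzz); auto.
- intros x Hx. destruct (classic (zero_near g x)); auto.
- intros x Hx [H1 [_ H2]]. auto.
- exfalso. apply (proj2 (L a Ha)); auto.
Qed.

(** A separation would give a continuous function with values 1 and -1 along the segment between two
    points of [A], against the intermediate value theorem. *)
Lemma convex_connected (A : plane -> Prop) :
  (forall a b t, A a -> A b -> 0 <= t <= 1 -> A (fst a + t * (fst b - fst a), snd a + t * (snd b - snd a))) ->
  connected_set A.
Proof.
intros HC O1 O2 HO1 HO2 Hcov Hdis.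
apply NNPP. intros N. apply not_or_and in N. destruct N as [N1 N2].
apply not_all_ex_not in N1. destruct N1 as [a Na]. apply imply_to_and in Na. destruct Na as [Aa Na].
apply not_all_ex_not in N2. destruct N2 as [b Nb]. apply imply_to_and in Nb. destruct Nb as [Ab Nb].
(* The parameter is clamped so that the path is defined and continuous on the whole real line, which
   [IVT] asks for. *)
set (cl := fun t => Rmax 0 (Rmin t 1)).
set (P := fun t : R => (fst a + cl t * (fst b - fst a), snd a + cl t * (snd b - snd a)) : plane).
assert (Hcl : forall t, 0 <= cl t <= 1).
{ intros t. unfold cl, Rmax, Rmin. destruct (Rle_dec t 1); destruct (Rle_dec 0 _); lra. }
assert (AP : forall t, A (P t)) by (intros t; apply HC; auto).
assert (Ccl : forall t, continuous cl t).
{ intros t. apply (continuous_ext (fun t => (1 + (t + 1 - Rabs (t - 1)) / 2 - 1 + Rabs ((t + 1 - Rabs (t - 1)) / 2)) / 2)).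
  { intros s. unfold cl, Rmax, Rmin, Rabs. destruct (Rle_dec s 1); destruct (Rle_dec 0 _);
    destruct (Rcase_abs (s - 1)); destruct (Rcase_abs _); lra. }
  assert (CA : forall f : R -> R, continuous f t -> continuous (fun s => Rabs (f s)) t).
  { intros f Hf. apply (continuous_comp f Rabs); auto. apply continuity_pt_filterlim, Rcontinuity_abs. }
  unfold Rdiv. cts; apply CA; cts. apply CA; cts. }
assert (CP : forall t (O : plane -> Prop), open O -> O (P t) -> locally t (fun s => O (P s))).
{ intros t O HO HP.
  assert (C : continuous P t).
  { unfold P. apply continuous_pair; cts; auto. }
  apply (C O). apply HO; auto. }
set (f := fun t => if excluded_middle_informative (O1 (P t)) then 1 else -1).
assert (Cf : forall t, continuity_pt f t).
{ intros t. apply continuity_pt_filterlim. destruct (classic (O1 (P t))) as [H|H].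
  - apply (continuous_ext_loc _ (fun _ => 1)). 2: apply continuous_const.
    generalize (CP t O1 HO1 H). apply filter_imp. intros s Hs. unfold f.
    destruct (excluded_middle_informative _); tauto.
  - assert (H2 : O2 (P t)) by (destruct (Hcov _ (AP t)); tauto).
    apply (continuous_ext_loc _ (fun _ => -1)). 2: apply continuous_const.
    generalize (CP t O2 HO2 H2). apply filter_imp. intros s Hs. unfold f.
    destruct (excluded_middle_informative _); auto. exfalso. apply (Hdis _ (AP s)); auto. }
assert (P0 : P 0 = a).
{ unfold P. replace (cl 0) with 0. destruct a; simpl; f_equal; ring. unfold cl, Rmax, Rmin.
  destruct (Rle_dec 0 1); destruct (Rle_dec _ _); lra. }
assert (P1 : P 1 = b).
{ unfold P. replace (cl 1) with 1. destruct b; simpl; f_equal; ring. unfold cl, Rmax, Rmin.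
  destruct (Rle_dec 1 1); destruct (Rle_dec _ _); lra. }
destruct (IVT f 0 1) as [z [_ Hz]].
- exact Cf.
- lra.
- unfold f. rewrite P0. destruct (excluded_middle_informative _). tauto. lra.
- unfold f. rewrite P1. destruct (excluded_middle_informative _). lra. destruct (Hcov b Ab); tauto.
- unfold f in Hz. destruct (excluded_middle_informative _); lra.
Qed.

(** * Odd and even reflection in the horizontal axis *)

Definition odd_ext (h : R -> R -> R) (x y : R) : R := if Rle_dec 0 y then h x y else - h x (- y).
Definition even_ext (h : R -> R -> R) (x y : R) : R := h x (Rabs y).

Section Reflection.
Variables (V W : plane -> Prop).
Hypothesis HV : open V.
Hypothesis HW : open W.
Hypothesis HWV : forall x y, W (x, y) -> V (x, Rabs y).

Lemma even_cont h x y : (forall a b, V (a, b) -> cont2 h a b) -> W (x, y) -> cont2 (even_ext h) x y.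
Proof.
intros Hc Hxy. unfold cont2, even_ext.
apply (cont2_comp h (fun z : plane => fst z) (fun z : plane => Rabs (snd z)) (x, y)).
- apply Hc. apply HWV; auto.
- apply continuous_fst.
- apply (continuous_comp (fun z : plane => snd z) Rabs). apply continuous_snd.
  apply continuity_pt_filterlim, Rcontinuity_abs.
Qed.

Lemma odd_cont h x y : (forall a b, V (a, b) -> cont2 h a b) -> (forall a, W (a, 0) -> h a 0 = 0) ->
  W (x, y) -> cont2 (odd_ext h) x y.
Proof.
intros Hc H0 Hxy.
assert (E := even_cont h x y Hc Hxy).
assert (K : forall (Q : R -> Prop), open Q -> Q y -> locally ((x, y) : plane) (fun z : plane => Q (snd z))).
{ intros Q HQ Hy. apply (continuous_snd (U := R_UniformSpace) (V := R_UniformSpace) x y). apply HQ; auto. }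
destruct (Rtotal_order y 0) as [L|[L|L]].
- apply (continuous_ext_loc _ (fun z : plane => - even_ext h (fst z) (snd z))).
  + generalize (K (fun y => y < 0) (open_lt 0) L). apply filter_imp. intros [a b] Hb. simpl in *.
    unfold odd_ext, even_ext. destruct (Rle_dec 0 b); try lra. now rewrite Rabs_left.
  + apply continuous_Ropp. exact E.
(* On the axis the odd extension has the same absolute value as the even one, which is continuous
   and vanishes there. *)
- subst y. unfold cont2.
  assert (Z : even_ext h x 0 = 0) by (unfold even_ext; rewrite Rabs_R0; auto).
  assert (Z' : odd_ext h x 0 = 0) by (unfold odd_ext; destruct (Rle_dec 0 0); [auto|lra]).
  intros P HP. simpl in HP. rewrite Z' in HP. destruct HP as [e HP].
  assert (E' := E (fun u => Rabs u < e)). unfold filtermap in *. simpl in E'. rewrite Z in E'.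
  assert (L : locally (T := R_UniformSpace) 0 (fun u => Rabs u < e)).
  { exists e. intros u Hu. unfold ball in Hu; simpl in Hu; unfold AbsRing_ball, abs, minus, plus, opp in Hu; simpl in Hu.
    now rewrite Ropp_0, Rplus_0_r in Hu. }
  specialize (E' L). revert E'. apply filter_imp. intros [a b] Hab. simpl in *. apply HP.
  unfold ball; simpl; unfold AbsRing_ball, abs, minus, plus, opp; simpl. rewrite Ropp_0, Rplus_0_r.
  unfold odd_ext, even_ext in *. destruct (Rle_dec 0 b).
  rewrite (Rabs_pos_eq b) in Hab; auto. rewrite Rabs_Ropp. rewrite (Rabs_left b) in Hab; auto. lra.
- apply (continuous_ext_loc _ (fun z : plane => even_ext h (fst z) (snd z))); auto.
  generalize (K (fun y => 0 < y) (open_gt 0) L). apply filter_imp. intros [a b] Hb. simpl in *.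
  unfold odd_ext, even_ext. destruct (Rle_dec 0 b); try lra. now rewrite Rabs_pos_eq.
Qed.

Lemma is_derive_refl (f : R -> R) y l : is_derive f (- y) l -> is_derive (fun s => f (- s)) y (- l).
Proof.
intros H. eapply is_derive_eq.
apply (is_derive_comp f (fun s => - s) y l (-1) H).
auto_derive; auto. change (-1 * l = - l). ring.
Qed.

Lemma derive_odd (f : R -> R) l : is_derive f 0 l -> f 0 = 0 ->
  is_derive (fun s => if Rle_dec 0 s then f s else - f (- s)) 0 l.
Proof.
intros H H0. apply is_derive_Reals. apply is_derive_Reals in H.
intros e He. destruct (H e He) as [d Hd]. exists d. intros s Hs Hsd.
destruct (Rle_dec 0 0); [|lra]. rewrite H0, Rplus_0_l, Rminus_0_r.
destruct (Rle_dec 0 s).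
- specialize (Hd s Hs Hsd). rewrite H0, Rplus_0_l, Rminus_0_r in Hd. auto.
- specialize (Hd (- s)). rewrite H0, Rplus_0_l, Rminus_0_r, Rabs_Ropp in Hd.
  replace (- f (- s) / s) with (f (- s) / - s) by (field; auto). apply Hd; auto. lra.
Qed.

Lemma derive_even (f : R -> R) : is_derive f 0 0 -> is_derive (fun s => f (Rabs s)) 0 0.
Proof.
intros H. apply is_derive_Reals. apply is_derive_Reals in H.
intros e He. destruct (H e He) as [d Hd]. exists d. intros s Hs Hsd.
rewrite Rabs_R0. rewrite Rplus_0_l. specialize (Hd (Rabs s)). rewrite Rplus_0_l, Rabs_Rabsolu in Hd.
specialize (Hd (Rabs_no_R0 s Hs) Hsd). rewrite Rminus_0_r in *.
unfold Rdiv in *. rewrite Rabs_mult in *. rewrite Rabs_inv in *. now rewrite Rabs_Rabsolu in Hd.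
Qed.

Lemma locally_neg y : y < 0 -> locally (T := R_UniformSpace) y (fun s => s < 0).
Proof. intros; apply (open_lt 0); auto. Qed.
Lemma locally_pos y : 0 < y -> locally (T := R_UniformSpace) y (fun s => 0 < s).
Proof. intros; apply (open_gt 0); auto. Qed.

(** The tangential derivative of a function vanishing on the axis vanishes there too, which lets the
    lemma be applied again to [hx]. The normal derivative is extended evenly and needs no
    condition. *)
Lemma odd_C1 h hx hy : C1on V h hx hy -> (forall a, W (a, 0) -> h a 0 = 0) ->
  (forall a, W (a, 0) -> hx a 0 = 0) /\ C1on W (odd_ext h) (odd_ext hx) (even_ext hy).
Proof.
intros H H0.
assert (H0x : forall a, W (a, 0) -> hx a 0 = 0).
{ intros a Ha. assert (Va := HWV a 0 Ha). rewrite Rabs_R0 in Va.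
  destruct (H a 0 Va) as [D _]. apply is_derive_unique in D. rewrite <- D.
  rewrite (Derive_ext_loc _ (fun _ => 0)). apply Derive_const.
  apply (filter_imp (fun s => W (s, 0))).
  2: exact (continuous_pair (fun s => s) (fun _ => 0) a (continuous_id a) (continuous_const 0 a) W (HW _ Ha)).
  intros s Hs. apply H0; auto. }
split; auto.
intros x y Hxy. assert (Vxy := HWV x y Hxy). destruct (H _ _ Vxy) as [D1 [D2 _]].
split; [|split; [|split]].
- unfold odd_ext. destruct (Rle_dec 0 y) as [L|L].
  rewrite Rabs_pos_eq in D1; auto. rewrite Rabs_left in D1 by lra.
  apply (is_derive_opp (fun s => h s (- y))); auto.
- unfold even_ext. destruct (Rtotal_order y 0) as [L|[L|L]].
  + rewrite Rabs_left in * by auto.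
    apply (is_derive_ext_loc (fun s => - h x (- s))).
    { generalize (locally_neg y L). apply filter_imp. intros s Hs. unfold odd_ext.
      destruct (Rle_dec 0 s); lra. }
    eapply is_derive_eq. apply (is_derive_opp (fun s => h x (- s))). apply is_derive_refl; eauto.
    apply Ropp_involutive.
  + subst y. rewrite Rabs_R0 in *. unfold odd_ext. apply (derive_odd (fun s => h x s)); auto.
  + rewrite Rabs_pos_eq in * by lra.
    apply (is_derive_ext_loc (fun s => h x s)); auto.
    generalize (locally_pos y L). apply filter_imp. intros s Hs. unfold odd_ext.
    destruct (Rle_dec 0 s); lra.
- apply odd_cont; auto. intros a b Hab; apply (H a b Hab).
- apply even_cont; auto. intros a b Hab; apply (H a b Hab).
Qed.

Lemma even_C1 h hx hy : C1on V h hx hy -> (forall a, W (a, 0) -> hy a 0 = 0) ->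
  C1on W (even_ext h) (even_ext hx) (odd_ext hy).
Proof.
intros H H0 x y Hxy. assert (Vxy := HWV x y Hxy). destruct (H _ _ Vxy) as [D1 [D2 _]].
split; [|split; [|split]].
- exact D1.
- unfold even_ext. destruct (Rtotal_order y 0) as [L|[L|L]].
  + rewrite Rabs_left in D2 by auto.
    apply (is_derive_ext_loc (fun s => h x (- s))).
    { generalize (locally_neg y L). apply filter_imp. intros s Hs. now rewrite Rabs_left. }
    unfold odd_ext. destruct (Rle_dec 0 y); [lra|]. apply (is_derive_refl (fun s => h x s)); auto.
  + subst y. rewrite Rabs_R0 in *. unfold odd_ext. destruct (Rle_dec 0 0); [|lra].
    rewrite H0 in * by auto. apply (derive_even (fun s => h x s)); auto.
  + rewrite Rabs_pos_eq in D2 by lra.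
    apply (is_derive_ext_loc (fun s => h x s)).
    generalize (locally_pos y L). apply filter_imp. intros s Hs. rewrite Rabs_pos_eq; auto; lra.
    unfold odd_ext. destruct (Rle_dec 0 y); auto. lra.
- apply even_cont; auto. intros a b Hab; apply (H a b Hab).
- apply odd_cont; auto. intros a b Hab; apply (H a b Hab).
Qed.

(* The equation forces the normal second derivative to vanish on the axis, which is what makes
   the odd extension of a solution vanishing there twice differentiable. *)
Lemma odd_helm k g gx gy : helm k V g gx gy -> (forall a, W (a, 0) -> g a 0 = 0) ->
  helm k W (odd_ext g) (odd_ext gx) (even_ext gy).
Proof.
intros [H [gxx [gxy [gyx [gyy [Hx [Hy HE]]]]]]] H0.
destruct (odd_C1 _ _ _ H H0) as [H1 C1].
destruct (odd_C1 _ _ _ Hx H1) as [H2 C2].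
split; auto. exists (odd_ext gxx), (even_ext gxy), (even_ext gyx), (odd_ext gyy).
split; auto. split.
- apply even_C1; auto. intros a Ha. assert (Va := HWV a 0 Ha). rewrite Rabs_R0 in Va.
  specialize (HE a 0 Va). rewrite H0, H2 in HE by auto. lra.
- intros x y Hxy. assert (Vxy := HWV x y Hxy). specialize (HE _ _ Vxy). unfold odd_ext.
  destruct (Rle_dec 0 y). rewrite Rabs_pos_eq in HE; auto. rewrite Rabs_left in HE by lra. lra.
Qed.
End Reflection.

(** * Bessel's equation at infinity *)

Definition tends (f : R -> R) (l : R) : Prop :=
  forall eps, 0 < eps -> exists M, forall r, M < r -> Rabs (f r - l) < eps.

Lemma tends_const l : tends (fun _ => l) l.
Proof. intros e He. exists 0. intros. rewrite Rminus_diag, Rabs_R0; auto. Qed.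

Lemma tends_ext f g l M : (forall r, M < r -> f r = g r) -> tends f l -> tends g l.
Proof.
intros H Hf e He. destruct (Hf e He) as [M' HM]. exists (Rmax M M'). intros r Hr.
rewrite <- H. apply HM. eapply Rle_lt_trans; [apply Rmax_r|eauto]. eapply Rle_lt_trans; [apply Rmax_l|eauto].
Qed.

Lemma tends_eq f l l' : tends f l -> l = l' -> tends f l'.
Proof. now intros H <-. Qed.

Lemma tends_plus f g l m : tends f l -> tends g m -> tends (fun r => f r + g r) (l + m).
Proof.
intros Hf Hg e He. destruct (Hf (e / 2) ltac:(lra)) as [M1 H1]. destruct (Hg (e / 2) ltac:(lra)) as [M2 H2].
exists (Rmax M1 M2). intros r Hr.
replace (f r + g r - (l + m)) with ((f r - l) + (g r - m)) by ring.
eapply Rle_lt_trans. apply Rabs_triang.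
specialize (H1 r ltac:(eapply Rle_lt_trans; [apply Rmax_l|eauto])).
specialize (H2 r ltac:(eapply Rle_lt_trans; [apply Rmax_r|eauto])). lra.
Qed.

Lemma tends_mult_bounded f g B M : (forall r, M < r -> Rabs (g r) <= B) -> tends f 0 ->
  tends (fun r => f r * g r) 0.
Proof.
intros HB Hf e He.
assert (HB0 : 0 <= B) by (eapply Rle_trans; [apply Rabs_pos|apply (HB (M + 1)); lra]).
destruct (Hf (e / (B + 1))) as [M1 H1]. apply Rdiv_lt_0_compat; lra.
exists (Rmax M M1). intros r Hr.
specialize (H1 r ltac:(eapply Rle_lt_trans; [apply Rmax_r|eauto])).
specialize (HB r ltac:(eapply Rle_lt_trans; [apply Rmax_l|eauto])).
rewrite Rminus_0_r in *. rewrite Rabs_mult.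
apply Rle_lt_trans with (Rabs (f r) * (B + 1)). apply Rmult_le_compat_l; [apply Rabs_pos|lra].
apply Rmult_lt_reg_r with (/ (B + 1)). apply Rinv_0_lt_compat; lra.
rewrite Rmult_assoc, Rinv_r by lra. lra.
Qed.

Lemma tends_scal f l c : tends f l -> tends (fun r => c * f r) (c * l).
Proof.
intros Hf.
assert (H : tends (fun r => (f r - l) * c) 0).
{ apply (tends_mult_bounded (fun r => f r - l) (fun _ => c) (Rabs c) 0). intros; lra.
  intros e He. destruct (Hf e He) as [M HM]. exists M. intros r Hr. rewrite Rminus_0_r; auto. }
replace (c * l) with (0 + c * l) by ring.
apply (tends_ext (fun r => (f r - l) * c + c * l) _ _ 0). intros; ring.
apply tends_plus; auto using tends_const.
Qed.

Lemma tends_minus f g l m : tends f l -> tends g m -> tends (fun r => f r - g r) (l - m).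
Proof.
intros Hf Hg. apply (tends_ext (fun r => f r + (-1) * g r) _ _ 0). intros; ring.
replace (l - m) with (l + (-1) * m) by ring. apply tends_plus, tends_scal; auto.
Qed.

Lemma tends_bounded f l : tends f l -> exists M, forall r, M < r -> Rabs (f r) <= Rabs l + 1.
Proof.
intros H. destruct (H 1 ltac:(lra)) as [M HM]. exists M. intros r Hr. specialize (HM r Hr).
replace (f r) with (l + (f r - l)) by ring. eapply Rle_trans. apply Rabs_triang. lra.
Qed.

Lemma tends_mult f g l m : tends f l -> tends g m -> tends (fun r => f r * g r) (l * m).
Proof.
intros Hf Hg. destruct (tends_bounded g m Hg) as [M HM].
apply (tends_ext (fun r => (f r - l) * g r + l * g r) _ _ 0). intros; ring.
replace (l * m) with (0 + l * m) by ring. apply tends_plus. 2: apply tends_scal; auto.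
apply (tends_mult_bounded (fun r => f r - l) g (Rabs m + 1) M); auto.
replace 0 with (l - l) by ring. apply tends_minus; auto using tends_const.
Qed.

Lemma tends_dominated f g : tends g 0 -> (exists M, forall r, M < r -> Rabs (f r) <= g r) -> tends f 0.
Proof.
intros Hg [M HM] e He. destruct (Hg e He) as [M1 H1]. exists (Rmax M M1). intros r Hr.
rewrite Rminus_0_r.
specialize (H1 r ltac:(eapply Rle_lt_trans; [apply Rmax_r|eauto])).
specialize (HM r ltac:(eapply Rle_lt_trans; [apply Rmax_l|eauto])).
rewrite Rminus_0_r in H1. generalize (Rle_abs (g r)). lra.
Qed.

Lemma tends_inv : tends (fun r => / r) 0.
Proof.
intros e He. exists (/ e). intros r Hr. assert (0 < / e) by (apply Rinv_0_lt_compat; auto).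
rewrite Rminus_0_r, Rabs_pos_eq. 2: left; apply Rinv_0_lt_compat; lra.
rewrite <- (Rinv_inv e). apply Rinv_lt_contravar; auto. apply Rmult_lt_0_compat; lra.
Qed.

Lemma tends_unique f l m : tends f l -> tends f m -> l = m.
Proof.
intros H1 H2. destruct (Req_dec l m) as [E|E]; auto. exfalso.
assert (P : 0 < Rabs (l - m)) by (apply Rabs_pos_lt; lra).
destruct (H1 (Rabs (l - m) / 2) ltac:(lra)) as [M1 K1]. destruct (H2 (Rabs (l - m) / 2) ltac:(lra)) as [M2 K2].
set (r := Rmax M1 M2 + 1). assert (L1 := Rmax_l M1 M2). assert (L2 := Rmax_r M1 M2).
specialize (K1 r ltac:(unfold r; lra)). specialize (K2 r ltac:(unfold r; lra)).
rewrite Rabs_minus_sym in K1.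
assert (T := Rabs_triang (l - f r) (f r - m)). replace (l - f r + (f r - m)) with (l - m) in T by ring. lra.
Qed.

Lemma tends_le f l M B : tends f l -> (forall r, M < r -> f r <= B) -> l <= B.
Proof.
intros H HB. apply Rnot_lt_le. intros L. destruct (H (l - B) ltac:(lra)) as [M1 K].
set (r := Rmax M M1 + 1). assert (L1 := Rmax_l M M1). assert (L2 := Rmax_r M M1).
specialize (K r ltac:(unfold r; lra)). specialize (HB r ltac:(unfold r; lra)).
apply Rabs_def2 in K. lra.
Qed.

Lemma tends_ge f l M B : tends f l -> (forall r, M < r -> B <= f r) -> B <= l.
Proof.
intros H HB. assert (K := tends_le (fun r => -1 * f r) (-1 * l) M (- B)).
assert (-1 * l <= - B). apply K. apply tends_scal; auto. intros r Hr; specialize (HB r Hr); lra. lra.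
Qed.

(** The function [f - K / r] is nondecreasing, [f + K / r] is nonincreasing, and the first stays
    below the second; so the first converges, and [K / r] tends to 0. *)
Lemma tends_of_derive (f df : R -> R) R0 K : 0 <= R0 ->
  (forall r, R0 < r -> is_derive f r (df r)) ->
  (forall r, R0 < r -> Rabs (df r) <= K / r ^ 2) -> exists l, tends f l.
Proof.
intros HR HD HB.
set (a := R0 + 1).
set (up := fun r => f r - K / r). set (dn := fun r => f r + K / r).
assert (Dk : forall r, 0 < r -> is_derive (fun r => K / r) r (- (K / r ^ 2))).
{ intros r Hr. auto_derive. lra. field. lra. }
assert (Mu : forall r s, R0 < r -> r <= s -> up r <= up s).
{ intros r s Hr Hs. apply (derive_nonneg_incr up (fun t => df t - - (K / t ^ 2))); auto.
  - intros t Ht. apply (is_derive_minus f). apply HD; lra. apply Dk; lra.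
  - intros t Ht. specialize (HB t ltac:(lra)). generalize (Rabs_maj2 (df t)); lra. }
assert (Md : forall r s, R0 < r -> r <= s -> dn s <= dn r).
{ intros r s Hr Hs. apply Ropp_le_cancel.
  apply (derive_nonneg_incr (fun t => - dn t) (fun t => - (df t + - (K / t ^ 2)))); auto.
  - intros t Ht. apply (is_derive_opp dn). apply (is_derive_plus f). apply HD; lra. apply Dk; lra.
  - intros t Ht. specialize (HB t ltac:(lra)). generalize (Rle_abs (df t)); lra. }
assert (K0 : 0 <= K).
{ specialize (HB a ltac:(unfold a; lra)). assert (0 <= K / a ^ 2) by (eapply Rle_trans; [apply Rabs_pos|eauto]).
  assert (0 < a ^ 2) by (apply pow_lt; unfold a; lra).
  replace K with (K / a ^ 2 * a ^ 2) by (field; unfold a; lra). apply Rmult_le_pos; lra. }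
assert (UD : forall r, R0 < r -> up r <= dn r).
{ intros r Hr. unfold up, dn. assert (0 <= K / r). apply Rmult_le_pos; auto. left; apply Rinv_0_lt_compat; lra. lra. }
destruct (completeness (fun y => exists r, a <= r /\ y = up r)) as [l [L1 L2]].
- exists (dn a). intros y [r [Hr ->]]. eapply Rle_trans. apply UD. unfold a in *; lra. apply Md; unfold a in *; lra.
- exists (up a). exists a. split; auto; lra.
- exists l.
  assert (T : tends up l).
  { intros e He. destruct (Classical_Prop.classic (exists r, a <= r /\ l - e < up r)) as [[r0 [H1 H2]]|N].
    - exists r0. intros r Hr. assert (up r0 <= up r) by (apply Mu; unfold a in *; lra).
      assert (up r <= l) by (apply L1; exists r; split; auto; lra). apply Rabs_def1; lra.
    - exfalso. assert (l <= l - e). apply L2. intros y [r [Hr ->]].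
      apply Rnot_lt_le. intros Q. apply N. exists r; auto. lra. }
  apply (tends_ext (fun r => up r + K * / r) _ _ 0). intros; unfold up; unfold Rdiv; ring.
  replace l with (l + K * 0) by ring. apply tends_plus; auto. apply tends_scal, tends_inv.
Qed.

Lemma exp_mono x y : x <= y -> exp x <= exp y.
Proof. intros [H|H]. left; now apply exp_increasing. subst; lra. Qed.

(** Multiplying by [sqrt r] removes the first-order term of Bessel's equation and replaces [n^2] by
    [n^2 - 1/4]. *)
Definition nu (n : nat) : R := INR n ^ 2 - / 4.

(* [sqrt r] times a solution of Bessel's equation of order [n], with its derivative. *)
Definition wsol (n : nat) (R0 : R) (w w1 : R -> R) : Prop :=
  forall r, R0 < r -> is_derive w r (w1 r) /\ is_derive w1 r ((nu n / r ^ 2 - 1) * w r).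

Definition osc (a b r : R) : R := a * cos r - b * sin r.

(* [w] behaves at infinity like the real part of [(a + i b) exp (i r)]. *)
Definition asy (w w1 : R -> R) (a b : R) : Prop :=
  tends (fun r => w r - osc a b r) 0 /\ tends (fun r => w1 r - osc (- b) a r) 0.

(** A majorant of the absolute value of [nu n] that stays at least 1 for [n = 0]. *)
Definition mm (n : nat) : R := INR n ^ 2 + 1.

Lemma nu_le_mm n : Rabs (nu n) <= mm n.
Proof. unfold nu, mm. assert (H := pow2_ge_0 (INR n)). apply Rabs_le. split; lra. Qed.

Lemma mm_pos n : 1 <= mm n.
Proof. unfold mm. assert (H := pow2_ge_0 (INR n)). lra. Qed.

Lemma pow_inv_derive (j : nat) x : 0 < x -> is_derive (fun x => (/ x) ^ j) x (- INR j * (/ x) ^ (j + 1)).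
Proof.
intros Hx. auto_derive. lra. destruct j. simpl; ring. rewrite Nat.add_1_r. cbn [Nat.pred].
rewrite <- !tech_pow_Rmult. generalize (INR (S j)). intros. field. lra.
Qed.

Lemma derive_exp_inv c r : r <> 0 -> is_derive (fun t => exp (c / t)) r (- (c / r ^ 2) * exp (c / r)).
Proof. intros Hr. auto_derive; auto. change (c * / r) with (c / r). field; auto. Qed.

(** The constant part of the equation only rotates [(w, w1)] and preserves [w^2 + w1^2]; what
    remains is the term in [1 / r^2], which is integrable at infinity. *)
Lemma energy_derive n R0 w w1 r : wsol n R0 w w1 -> R0 < r ->
  is_derive (fun t => w t ^ 2 + w1 t ^ 2) r (2 * (nu n / r ^ 2) * (w r * w1 r)).
Proof.
intros H Hr. destruct (H r Hr) as [D1 D2].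
apply (is_derive_ext (fun t => w t * w t + w1 t * w1 t)). intros; simpl; ring.
eapply is_derive_eq. apply is_derive_Rplus; apply is_derive_mult_R; eassumption. req; ring.
Qed.

Lemma energy_derive_bound n r u v : 0 < r ->
  Rabs (2 * (nu n / r ^ 2) * (u * v)) <= mm n / r ^ 2 * (u ^ 2 + v ^ 2).
Proof.
intros Hr. replace (2 * (nu n / r ^ 2) * (u * v)) with (nu n / r ^ 2 * (2 * (u * v))) by (field; lra).
assert (Hp : 0 < r ^ 2) by (apply pow_lt; auto).
rewrite Rabs_mult. apply Rmult_le_compat; auto using Rabs_pos.
- unfold Rdiv. rewrite Rabs_mult, (Rabs_pos_eq (/ r ^ 2)).
  apply Rmult_le_compat_r. left; apply Rinv_0_lt_compat; auto. apply nu_le_mm. left; apply Rinv_0_lt_compat; auto.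
- apply Rabs_le. generalize (pow2_ge_0 (u + v)) (pow2_ge_0 (u - v)). intros; split; lra.
Qed.

(** The factor [exp (mm n / t)] has logarithmic derivative [- mm n / t^2], just enough to outweigh
    the growth of the energy. The opposite exponent in [energy_incr] outweighs its decay. *)
Lemma energy_decr n R0 w w1 r s : 0 <= R0 -> wsol n R0 w w1 -> R0 < r -> r <= s ->
  (w s ^ 2 + w1 s ^ 2) * exp (mm n / s) <= (w r ^ 2 + w1 r ^ 2) * exp (mm n / r).
Proof.
intros HR H Hr Hs. apply Ropp_le_cancel.
apply (derive_nonneg_incr (fun t => - ((w t ^ 2 + w1 t ^ 2) * exp (mm n / t)))
  (fun t => (mm n / t ^ 2 * (w t ^ 2 + w1 t ^ 2) - 2 * (nu n / t ^ 2) * (w t * w1 t)) * exp (mm n / t))); auto.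
- intros t Ht. eapply is_derive_eq.
  apply (is_derive_opp (fun t => (w t ^ 2 + w1 t ^ 2) * exp (mm n / t))).
  apply is_derive_mult_R. apply (energy_derive n R0); auto; lra. apply derive_exp_inv; lra.
  unfold opp; simpl. req; ring.
- intros t Ht. apply Rmult_le_pos. 2: left; apply exp_pos.
  assert (K := energy_derive_bound n t (w t) (w1 t) ltac:(lra)).
  generalize (Rle_abs (2 * (nu n / t ^ 2) * (w t * w1 t))). lra.
Qed.

Lemma energy_incr n R0 w w1 r s : 0 <= R0 -> wsol n R0 w w1 -> R0 < r -> r <= s ->
  (w r ^ 2 + w1 r ^ 2) * exp (- mm n / r) <= (w s ^ 2 + w1 s ^ 2) * exp (- mm n / s).
Proof.
intros HR H Hr Hs.
apply (derive_nonneg_incr (fun t => ((w t ^ 2 + w1 t ^ 2) * exp (- mm n / t)))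
  (fun t => (mm n / t ^ 2 * (w t ^ 2 + w1 t ^ 2) + 2 * (nu n / t ^ 2) * (w t * w1 t)) * exp (- mm n / t))); auto.
- intros t Ht. eapply is_derive_eq.
  apply is_derive_mult_R. apply (energy_derive n R0); auto; lra. apply derive_exp_inv; lra.
  req. field. lra.
- intros t Ht. apply Rmult_le_pos. 2: left; apply exp_pos.
  assert (K := energy_derive_bound n t (w t) (w1 t) ltac:(lra)).
  generalize (Rabs_maj2 (2 * (nu n / t ^ 2) * (w t * w1 t))). lra.
Qed.

Lemma osc_le a b r : Rabs (osc a b r) <= Rabs a + Rabs b.
Proof.
unfold osc, Rminus. eapply Rle_trans. apply Rabs_triang. rewrite Rabs_Ropp, !Rabs_mult.
assert (Rabs (cos r) <= 1) by (apply Rabs_le, COS_bound). assert (Rabs (sin r) <= 1) by (apply Rabs_le, SIN_bound).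
generalize (Rabs_pos a) (Rabs_pos b). nra.
Qed.

Lemma osc_sq a b r : osc a b r ^ 2 + osc (- b) a r ^ 2 = a ^ 2 + b ^ 2.
Proof.
unfold osc. generalize (sin2_cos2 r). unfold Rsqr. intros H.
transitivity ((a ^ 2 + b ^ 2) * (sin r * sin r + cos r * cos r)). ring. rewrite H; ring.
Qed.

Lemma wsol_bounded n R0 w w1 : 0 <= R0 -> wsol n R0 w w1 ->
  exists B, 0 < B /\ forall r, R0 + 1 <= r -> Rabs (w r) <= B /\ Rabs (w1 r) <= B.
Proof.
intros HR H. set (a := R0 + 1).
set (E := (w a ^ 2 + w1 a ^ 2) * exp (mm n / a)).
exists (E + 1).
assert (HE : forall r, a <= r -> w r ^ 2 + w1 r ^ 2 <= E).
{ intros r Hr. assert (K := energy_decr n R0 w w1 a r HR H ltac:(unfold a; lra) Hr). fold E in K.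
  assert (1 <= exp (mm n / r)).
  { rewrite <- exp_0. apply exp_mono. apply Rmult_le_pos. generalize (mm_pos n); lra.
    left; apply Rinv_0_lt_compat. unfold a in *; lra. }
  assert (0 <= w r ^ 2 + w1 r ^ 2) by (generalize (pow2_ge_0 (w r)) (pow2_ge_0 (w1 r)); lra). nra. }
assert (E0 : 0 <= E).
{ eapply Rle_trans. 2: apply (HE a); lra. generalize (pow2_ge_0 (w a)) (pow2_ge_0 (w1 a)); lra. }
split. lra. intros r Hr. specialize (HE r Hr).
generalize (pow2_ge_0 (w r)) (pow2_ge_0 (w1 r)). intros.
split; apply Rabs_le; split; nra.
Qed.

(** Variation of constants: the coordinates of [(w, w1)] in the rotating frame, [w cos r - w1 sin r]
    and [- (w sin r + w1 cos r)], have derivatives of order [1 / r^2] and hence limits. *)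
Lemma asy_exists n R0 w w1 : 0 <= R0 -> wsol n R0 w w1 -> exists a b, asy w w1 a b.
Proof.
intros HR H. destruct (wsol_bounded n R0 w w1 HR H) as [B [HB Hb]].
assert (W1 : forall r t, R0 + 1 < r -> Rabs t <= 1 -> Rabs (- (nu n / r ^ 2) * (w r * t)) <= (mm n * B) / r ^ 2).
{ intros r t Hr Ht. rewrite Rabs_mult, Rabs_Ropp. unfold Rdiv. rewrite Rabs_mult.
  assert (Hp : 0 < / r ^ 2) by (apply Rinv_0_lt_compat, pow_lt; lra). rewrite (Rabs_pos_eq (/ r ^ 2)) by lra.
  replace (mm n * B * / r ^ 2) with (mm n * / r ^ 2 * (B * 1)) by ring.
  apply Rmult_le_compat. apply Rmult_le_pos; [apply Rabs_pos|lra]. apply Rabs_pos.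
  apply Rmult_le_compat_r; [lra|apply nu_le_mm].
  rewrite Rabs_mult. apply Rmult_le_compat; auto using Rabs_pos. apply Hb; lra. }
destruct (tends_of_derive (fun r => w r * cos r - w1 r * sin r) (fun r => - (nu n / r ^ 2) * (w r * sin r)) (R0 + 1) (mm n * B)) as [a Ha].
{ lra. }
{ intros r Hr. destruct (H r ltac:(lra)) as [D1 D2]. eapply is_derive_eq.
  apply (is_derive_minus (fun r => w r * cos r) (fun r => w1 r * sin r)); apply is_derive_mult_R; eauto.
  apply is_derive_cos. apply is_derive_sin. unfold minus, plus, opp; simpl. req; ring. }
{ intros r Hr. apply W1; auto. apply Rabs_le, SIN_bound. }
destruct (tends_of_derive (fun r => - (w r * sin r + w1 r * cos r)) (fun r => - (nu n / r ^ 2) * (w r * cos r)) (R0 + 1) (mm n * B)) as [b Hb'].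
{ lra. }
{ intros r Hr. destruct (H r ltac:(lra)) as [D1 D2]. eapply is_derive_eq.
  apply (is_derive_opp (fun r => w r * sin r + w1 r * cos r)). apply is_derive_Rplus; apply is_derive_mult_R; eauto.
  apply is_derive_sin. apply is_derive_cos. unfold opp; simpl. req; ring. }
{ intros r Hr. apply W1; auto. apply Rabs_le, COS_bound. }
exists a, b.
assert (Ha0 : tends (fun r => (w r * cos r - w1 r * sin r) - a) 0).
{ replace 0 with (a - a) by ring. apply tends_minus; auto using tends_const. }
assert (Hb0 : tends (fun r => - (w r * sin r + w1 r * cos r) - b) 0).
{ replace 0 with (b - b) by ring. apply tends_minus; auto using tends_const. }
assert (CB : forall r : R, 0 < r -> Rabs (cos r) <= 1) by (intros; apply Rabs_le, COS_bound).
assert (SB : forall r : R, 0 < r -> Rabs (sin r) <= 1) by (intros; apply Rabs_le, SIN_bound).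
split.
- apply (tends_ext (fun r => (w r * cos r - w1 r * sin r - a) * cos r - (- (w r * sin r + w1 r * cos r) - b) * sin r) _ _ 0).
  + intros r _. unfold osc. generalize (sin2_cos2 r). unfold Rsqr. intros T.
    transitivity (w r * (sin r * sin r + cos r * cos r) - (a * cos r - b * sin r)). ring. rewrite T; ring.
  + replace 0 with (0 - 0) by ring. apply tends_minus; eapply tends_mult_bounded; eauto.
- apply (tends_ext (fun r => (-1) * ((w r * cos r - w1 r * sin r - a) * sin r) - (- (w r * sin r + w1 r * cos r) - b) * cos r) _ _ 0).
  + intros r _. unfold osc. generalize (sin2_cos2 r). unfold Rsqr. intros T.
    transitivity (w1 r * (sin r * sin r + cos r * cos r) - (- b * cos r - a * sin r)). ring. rewrite T; ring.
  + replace 0 with (-1 * 0 - 0) by ring. apply tends_minus. apply tends_scal. eapply tends_mult_bounded; eauto. eapply tends_mult_bounded; eauto.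
Qed.

Lemma tends_prod f g p q B : tends (fun r => f r - p r) 0 -> tends (fun r => g r - q r) 0 ->
  (forall r, Rabs (p r) <= B) -> (forall r, Rabs (q r) <= B) -> tends (fun r => f r * g r - p r * q r) 0.
Proof.
intros Hf Hg Hp Hq.
apply (tends_ext (fun r => (f r - p r) * (g r - q r) + ((f r - p r) * q r + (g r - q r) * p r)) _ _ 0). intros; ring.
replace 0 with (0 * 0 + (0 + 0)) by ring. apply tends_plus. apply tends_mult; auto.
apply tends_plus; eapply (tends_mult_bounded _ _ B 0); eauto.
Qed.

Lemma asy_energy w w1 a b : asy w w1 a b -> tends (fun r => w r ^ 2 + w1 r ^ 2) (a ^ 2 + b ^ 2).
Proof.
intros [H1 H2].
assert (B1 : forall r, Rabs (osc a b r) <= Rabs a + Rabs b) by (intros; apply osc_le).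
assert (B2 : forall r, Rabs (osc (- b) a r) <= Rabs a + Rabs b).
{ intros; eapply Rle_trans. apply osc_le. rewrite Rabs_Ropp; lra. }
apply (tends_ext (fun r => (w r * w r - osc a b r * osc a b r) + (w1 r * w1 r - osc (- b) a r * osc (- b) a r) + (a ^ 2 + b ^ 2)) _ _ 0).
- intros r _. rewrite <- (osc_sq a b r). ring.
- apply (tends_eq _ (0 + 0 + (a ^ 2 + b ^ 2))); [|ring].
  apply tends_plus; [apply tends_plus; eapply tends_prod; eauto | apply tends_const].
Qed.

(** Let [s] tend to infinity in [energy_incr]. The amplitude at infinity thus controls the solution
    at every radius; in particular a zero amplitude leaves only the zero solution. *)
Lemma asy_energy_bound n R0 w w1 a b r : 0 <= R0 -> wsol n R0 w w1 -> asy w w1 a b -> R0 < r ->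
  w r ^ 2 + w1 r ^ 2 <= (a ^ 2 + b ^ 2) * exp (mm n / r).
Proof.
intros HR H HA Hr.
assert (K : (w r ^ 2 + w1 r ^ 2) * exp (- mm n / r) <= a ^ 2 + b ^ 2).
{ apply (tends_ge _ _ r _ (asy_energy _ _ _ _ HA)). intros s Hs.
  eapply Rle_trans. apply (energy_incr n R0 w w1 r s); auto; lra.
  rewrite <- (Rmult_1_r (w s ^ 2 + w1 s ^ 2)) at 2. apply Rmult_le_compat_l.
  generalize (pow2_ge_0 (w s)) (pow2_ge_0 (w1 s)); lra.
  rewrite <- exp_0. apply exp_mono. unfold Rdiv. rewrite Ropp_mult_distr_l_reverse.
  assert (0 <= mm n * / s). apply Rmult_le_pos. generalize (mm_pos n); lra. left; apply Rinv_0_lt_compat; lra. lra. }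
replace (w r ^ 2 + w1 r ^ 2) with ((w r ^ 2 + w1 r ^ 2) * exp (- mm n / r) * exp (mm n / r)).
apply Rmult_le_compat_r; auto. left; apply exp_pos.
rewrite Rmult_assoc, <- exp_plus. replace (- mm n / r + mm n / r) with 0. rewrite exp_0; ring. unfold Rdiv; ring.
Qed.

Lemma asy_zero n R0 w w1 r : 0 <= R0 -> wsol n R0 w w1 -> asy w w1 0 0 -> R0 < r -> w r = 0.
Proof.
intros HR H HA Hr. assert (K := asy_energy_bound n R0 w w1 0 0 r HR H HA Hr).
generalize (pow2_ge_0 (w r)) (pow2_ge_0 (w1 r)). intros. apply (sq_sum_zero (w r) (w1 r)).
replace (0 ^ 2 + 0 ^ 2) with 0 in K by ring. lra.
Qed.

(* The outgoing condition [w' - i w -> 0] for [w + i v]. *)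
Definition outgoing (w w1 v v1 : R -> R) : Prop :=
  tends (fun r => w1 r + v r) 0 /\ tends (fun r => v1 r - w r) 0.

(** The outgoing condition says that [v] is asymptotically [- w1], which multiplies the complex
    amplitude [a + i b] by [- i]. *)
Lemma outgoing_asy w w1 v v1 a b : outgoing w w1 v v1 -> asy w w1 a b -> asy v v1 b (- a).
Proof.
intros [O1 O2] [H1 H2]. split.
- apply (tends_ext (fun r => (w1 r + v r) - (w1 r - osc (- b) a r)) _ _ 0).
  intros; unfold osc; ring. replace 0 with (0 - 0) by ring. apply tends_minus; auto.
- apply (tends_ext (fun r => (v1 r - w r) + (w r - osc a b r)) _ _ 0).
  intros; unfold osc; ring. replace 0 with (0 + 0) by ring. apply tends_plus; auto.
Qed.

Lemma flux_const n R0 w w1 v v1 r s : wsol n R0 w w1 -> wsol n R0 v v1 -> R0 < r -> r <= s ->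
  w r * v1 r - v r * w1 r = w s * v1 s - v s * w1 s.
Proof.
intros Hw Hv Hr Hs.
assert (D : forall t, r <= t <= s -> is_derive (fun t => w t * v1 t - v t * w1 t) t 0).
{ intros t Ht. destruct (Hw t ltac:(lra)) as [A1 A2]. destruct (Hv t ltac:(lra)) as [B1 B2].
  eapply is_derive_eq. apply (is_derive_minus (fun t => w t * v1 t) (fun t => v t * w1 t)); apply is_derive_mult_R; eauto.
  unfold minus, plus, opp; simpl. req; ring. }
apply Rle_antisym.
- apply (derive_nonneg_incr (fun t => w t * v1 t - v t * w1 t) (fun _ => 0)); auto. intros; lra.
- apply Ropp_le_cancel.
  apply (derive_nonneg_incr (fun t => - (w t * v1 t - v t * w1 t)) (fun _ => - 0)); auto.
  intros. apply (is_derive_opp (fun t => w t * v1 t - v t * w1 t)); auto. intros; lra.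
Qed.

(** The Wronskian of the two parts is the radial flux of [w + i v]. It does not depend on [r], and
    at infinity the leading terms give the squared modulus of the amplitude. *)
Lemma flux_value n R0 w w1 v v1 a b r : wsol n R0 w w1 -> wsol n R0 v v1 ->
  asy w w1 a b -> asy v v1 b (- a) -> R0 < r -> w r * v1 r - v r * w1 r = a ^ 2 + b ^ 2.
Proof.
intros Hw Hv [A1 A2] [B1 B2] Hr.
apply (tends_unique (fun s => w s * v1 s - v s * w1 s)).
- apply (tends_ext (fun _ => w r * v1 r - v r * w1 r) _ _ r). intros s Hs.
  apply (flux_const n R0); auto; lra. apply tends_const.
- set (B := Rabs a + Rabs b).
  assert (Q1 : forall r, Rabs (osc a b r) <= B) by (intros; apply osc_le).
  assert (Q2 : forall r, Rabs (osc (- b) a r) <= B).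
  { intros; eapply Rle_trans. apply osc_le. rewrite Rabs_Ropp; unfold B; lra. }
  assert (Q3 : forall r, Rabs (osc b (- a) r) <= B).
  { intros; eapply Rle_trans. apply osc_le. rewrite Rabs_Ropp; unfold B; lra. }
  assert (Q4 : forall r, Rabs (osc (- - a) b r) <= B).
  { intros; eapply Rle_trans. apply osc_le. rewrite !Rabs_Ropp; unfold B; lra. }
  apply (tends_ext (fun s => (w s * v1 s - osc a b s * osc (- - a) b s) - (v s * w1 s - osc b (- a) s * osc (- b) a s) + (a ^ 2 + b ^ 2)) _ _ 0).
  + intros s _. rewrite <- (osc_sq a b s). unfold osc. ring.
  + apply (tends_eq _ (0 - 0 + (a ^ 2 + b ^ 2))); [|ring].
    apply tends_plus. 2: apply tends_const. apply tends_minus; eapply tends_prod; eauto.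
Qed.

(** * Decay of the amplitudes in the order *)

(** At a positive interior maximum the derivative is 0, while a positive second derivative makes [z]
    increase immediately to the right. *)
Lemma max_principle (z z1 z2 : R -> R) a b :
  (forall x, a <= x <= b -> is_derive z x (z1 x)) ->
  (forall x, a <= x <= b -> is_derive z1 x (z2 x)) ->
  (forall x, a <= x <= b -> 0 < z x -> 0 < z2 x) ->
  z a <= 0 -> z b <= 0 -> forall x, a <= x <= b -> z x <= 0.
Proof.
intros D1 D2 H Ha Hb x Hx. apply Rnot_lt_le. intros Hz.
destruct (continuity_ab_maj z a b ltac:(lra)) as [c [Hc Hcab]].
{ intros t Ht. apply continuity_pt_filterlim. eapply is_derive_cont; eauto. }
assert (Zc : 0 < z c) by (specialize (Hc x Hx); lra).
assert (Nc : a < c < b).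
{ destruct Hcab as [[L1|L1] [L2|L2]]; subst; lra. }
assert (E : z1 c = 0).
{ apply (deriv_maximum z a b c (exist _ (z1 c) (proj1 (is_derive_Reals z c (z1 c)) (D1 c Hcab)))); try lra.
  intros t Ht1 Ht2. apply Hc; lra. }
assert (P := H c Hcab Zc).
destruct (proj1 (is_derive_Reals z1 c (z2 c)) (D2 c Hcab) (z2 c / 2) ltac:(lra)) as [d Hd].
assert (Hd0 := cond_pos d).
set (e := Rmin (d / 2) (b - c)).
assert (He : 0 < e /\ e <= d / 2 /\ e <= b - c).
{ unfold e. split. apply Rmin_glb_lt; lra. split. apply Rmin_l. apply Rmin_r. }
destruct (MVT_cor2 z z1 c (c + e)) as [s [E1 Hs]].
- lra.
- intros t Ht. apply is_derive_Reals. apply D1; lra.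
- assert (K := Hd (s - c) ltac:(lra) ltac:(rewrite Rabs_pos_eq; lra)).
  replace (c + (s - c)) with s in K by ring. rewrite E, Rminus_0_r in K.
  apply Rabs_def2 in K. destruct K as [_ K].
  assert (0 < z1 s / (s - c)) by lra.
  assert (0 < z1 s). { replace (z1 s) with (z1 s / (s - c) * (s - c)) by (field; lra). apply Rmult_lt_0_compat; lra. }
  specialize (Hc (c + e) ltac:(lra)).
  assert (0 < z1 s * (c + e - c)) by (apply Rmult_lt_0_compat; lra). lra.
Qed.

Section Pair.
Variables (n : nat) (R0 : R) (w w1 v v1 : R -> R).
Hypothesis HR0 : 0 <= R0.
Hypothesis Hw : wsol n R0 w w1.
Hypothesis Hv : wsol n R0 v v1.

(** For the complex solution [w + i v]: [N] is its squared modulus with derivative [N1], [S] the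
    squared modulus of its derivative, and [Q] the coefficient of the equation, positive in the
    barrier. *)
Let N (r : R) := w r ^ 2 + v r ^ 2.
Let N1 (r : R) := 2 * (w r * w1 r + v r * v1 r).
Let S (r : R) := w1 r ^ 2 + v1 r ^ 2.
Let Q (r : R) := nu n / r ^ 2 - 1.

Lemma N_derive r : R0 < r -> is_derive N r (N1 r).
Proof.
intros Hr. destruct (Hw r Hr) as [A1 A2]. destruct (Hv r Hr) as [B1 B2]. unfold N, N1.
apply (is_derive_ext (fun t => w t * w t + v t * v t)). intros; simpl; ring.
eapply is_derive_eq. apply is_derive_Rplus; apply is_derive_mult_R; eauto. req; ring.
Qed.

Lemma N1_derive r : R0 < r -> is_derive N1 r (2 * S r + 2 * Q r * N r).
Proof.
intros Hr. destruct (Hw r Hr) as [A1 A2]. destruct (Hv r Hr) as [B1 B2]. unfold N1, S, N, Q.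
eapply is_derive_eq. apply is_derive_Rscal. apply is_derive_Rplus; apply is_derive_mult_R; eauto. req; ring.
Qed.

Lemma S_derive r : R0 < r -> is_derive S r (Q r * N1 r).
Proof.
intros Hr. destruct (Hw r Hr) as [A1 A2]. destruct (Hv r Hr) as [B1 B2]. unfold N1, S, Q.
apply (is_derive_ext (fun t => w1 t * w1 t + v1 t * v1 t)). intros; simpl; ring.
eapply is_derive_eq. apply is_derive_Rplus; apply is_derive_mult_R; eauto. req; ring.
Qed.

Lemma N_nonneg r : 0 <= N r.
Proof. unfold N. generalize (pow2_ge_0 (w r)) (pow2_ge_0 (v r)); lra. Qed.
Lemma S_nonneg r : 0 <= S r.
Proof. unfold S. generalize (pow2_ge_0 (w1 r)) (pow2_ge_0 (v1 r)); lra. Qed.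

Lemma flux_le r : (w r * v1 r - v r * w1 r) ^ 2 <= N r * S r.
Proof.
unfold N, S. generalize (pow2_ge_0 (w r * w1 r + v r * v1 r)). intros.
replace ((w r ^ 2 + v r ^ 2) * (w1 r ^ 2 + v1 r ^ 2)) with
  ((w r * v1 r - v r * w1 r) ^ 2 + (w r * w1 r + v r * v1 r) ^ 2) by ring. lra.
Qed.

(* In the barrier region [Q >= 0] the amplitude is convex and the speed is monotone together with it, so a
   nonzero flux keeps the amplitude away from zero. *)
Lemma flux_lower P r s : R0 < r -> r <= s -> (forall t, r <= t <= s -> 0 <= Q t) ->
  (forall t, R0 < t -> w t * v1 t - v t * w1 t = P) -> P ^ 2 <= N r * S s.
Proof.
intros Hr Hs HQ HP.
assert (Mono : forall t u, r <= t -> t <= u -> u <= s -> N1 t <= N1 u).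
{ intros t u H1 H2 H3. apply (derive_nonneg_incr N1 (fun r => 2 * S r + 2 * Q r * N r)); auto.
  - intros x Hx. apply N1_derive; lra.
  - intros x Hx. generalize (S_nonneg x) (N_nonneg x) (HQ x ltac:(lra)). intros. nra. }
assert (K : forall t, r <= t <= s -> 0 <= N1 t -> P ^ 2 <= N t * S s).
{ intros t Ht H0. rewrite <- (HP t) by lra. eapply Rle_trans. apply flux_le.
  apply Rmult_le_compat_l. apply N_nonneg.
  apply (derive_nonneg_incr S (fun r => Q r * N1 r)); try lra.
  - intros x Hx. apply S_derive; lra.
  - intros x Hx. apply Rmult_le_pos. apply HQ; lra. eapply Rle_trans. apply H0. apply Mono; lra. }
destruct (Rle_dec 0 (N1 r)) as [L|L]. apply K; auto; lra.
assert (Dec : forall t, r <= t <= s -> N1 t <= 0 -> N t <= N r).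
{ intros t Ht H0. apply Ropp_le_cancel. apply (derive_nonneg_incr (fun x => - N x) (fun x => - N1 x)). lra.
  - intros x Hx. apply (is_derive_opp N). apply N_derive; lra.
  - intros x Hx. assert (N1 x <= N1 t) by (apply Mono; lra). lra. }
destruct (Rle_dec (N1 s) 0) as [L'|L'].
- rewrite <- (HP s) by lra. eapply Rle_trans. apply flux_le. apply Rmult_le_compat_r. apply S_nonneg. apply Dec; lra.
(* At the zero [c] of the monotone [N1] the amplitude is smallest: before [c] it decreases, which
   gives [N c <= N r], and after [c] the speed increases up to [s]. *)
- destruct (IVT_interv N1 r s) as [c [Hc Zc]]; try lra.
  + intros t Ht. apply continuity_pt_filterlim. eapply is_derive_cont. apply N1_derive; lra.
  + destruct Hs as [Hs|Hs]; auto. subst; lra.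
  + eapply Rle_trans. apply (K c); lra. apply Rmult_le_compat_r. apply S_nonneg. apply Dec; lra.
Qed.

(** For radii up to [n / 2] the equation gives [N'' >= 2 Q N >= n^2 N / r^2]. The comparison
    functions [r^(- (n - 1))] and [r^n] both have second derivative [n (n - 1) / r^2] times
    themselves, which is less, so they are supersolutions and the maximum principle applies to the
    difference. *)
Lemma barrier a b r : R0 < a -> a <= r <= b -> (1 <= n)%nat -> b <= INR n / 2 ->
  N r <= N a * (a / r) ^ (n - 1) + N b * (r / b) ^ n.
Proof.
intros Ha Hr Hn Hb.
assert (a0 : 0 < a) by lra.
assert (Hn' : 1 <= INR n) by (replace 1 with (INR 1) by reflexivity; apply le_INR; auto).
set (A := N a * a ^ (n - 1)). set (B := N b * (/ b) ^ n).
assert (HA : 0 <= A) by (apply Rmult_le_pos; [apply N_nonneg|apply pow_le; lra]).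
assert (HB : 0 <= B) by (apply Rmult_le_pos; [apply N_nonneg|apply pow_le; left; apply Rinv_0_lt_compat; lra]).
set (m := (n - 1)%nat) in *.
assert (Hm : INR n = INR m + 1). { unfold m. rewrite minus_INR by auto. simpl; ring. }
set (z := fun r => N r - (A * (/ r) ^ m + B * r ^ n)).
assert (Dq : forall (j : nat) x, 0 < x -> is_derive (fun x => x ^ j) x (INR j * x ^ j * / x)).
{ intros j x Hx. auto_derive; auto. destruct j. simpl; ring. cbn [Nat.pred].
  rewrite <- !tech_pow_Rmult. generalize (INR (Datatypes.S j)). intros. field. lra. }
assert (Hz : z r <= 0).
{ apply (max_principle z (fun r => N1 r - (A * (- INR m * (/ r) ^ (m + 1)) + B * (INR n * r ^ n * / r)))
   (fun r => (2 * S r + 2 * Q r * N r) - (A * (- INR m * (- INR (m + 1) * (/ r) ^ (m + 1 + 1))) + B * (INR n * ((INR n - 1) * r ^ n * (/ r) ^ 2)))) a b); auto.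
  - intros x Hx. apply (is_derive_minus N). apply N_derive; lra.
    apply is_derive_Rplus; apply is_derive_Rscal. apply pow_inv_derive; lra.
    apply Dq; lra.
  - intros x Hx. apply (is_derive_minus N1). apply N1_derive; lra.
    apply (is_derive_Rplus (fun r => A * (- INR m * (/ r) ^ (m + 1))) (fun r => B * (INR n * r ^ n * / r))).
    apply (is_derive_Rscal (fun r => - INR m * (/ r) ^ (m + 1))), (is_derive_Rscal (fun r => (/ r) ^ (m + 1))), pow_inv_derive; lra.
    apply (is_derive_Rscal (fun r => INR n * r ^ n * / r)).
    apply (is_derive_ext (fun r => INR n * (r ^ n * / r))). intros; simpl; ring.
    apply is_derive_Rscal. eapply is_derive_eq. apply is_derive_mult_R. apply Dq; lra.
    apply (is_derive_ext (fun r => (/ r) ^ 1)). intros; simpl; ring. apply pow_inv_derive; lra.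
    req. simpl. field. lra.
  - intros x Hx Zx. unfold z in Zx.
    assert (Hx0 : 0 < x) by lra.
    assert (I0 : 0 < / x) by (apply Rinv_0_lt_compat; lra).
    assert (QQ : INR n ^ 2 * (/ x) ^ 2 <= 2 * Q x).
    { unfold Q, nu. replace ((INR n ^ 2 - / 4) / x ^ 2) with ((INR n ^ 2 - / 4) * (/ x) ^ 2) by (field; lra).
      assert (1 <= INR n / 2 * / x). { replace 1 with (x * / x) by (field; lra). apply Rmult_le_compat_r; lra. }
      set (i := / x) in *. clearbody i. assert (J1 : 1 <= (INR n / 2 * i) ^ 2).
      { rewrite <- (pow1 2). apply pow_incr; lra. }
      replace ((INR n / 2 * i) ^ 2) with (INR n ^ 2 * i ^ 2 / 4) in J1 by field.
      assert (i ^ 2 <= INR n ^ 2 * i ^ 2).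
      { rewrite <- (Rmult_1_l (i ^ 2)) at 1. apply Rmult_le_compat_r. apply pow2_ge_0.
        rewrite <- (pow1 2). apply pow_incr; lra. }
      lra. }
    assert (Nz := N_nonneg x). assert (Sz := S_nonneg x).
    assert (X : INR n ^ 2 * (/ x) ^ 2 * (A * (/ x) ^ m + B * x ^ n) < 2 * Q x * N x).
    { apply Rlt_le_trans with (INR n ^ 2 * (/ x) ^ 2 * N x).
      apply Rmult_lt_compat_l; [|lra]. apply Rmult_lt_0_compat; apply pow_lt; lra.
      apply Rmult_le_compat_r; lra. }
    rewrite !pow_add, !plus_INR, pow_1. simpl (INR 1).
    assert (T1 : INR m * (INR m + 1) * ((/ x) ^ 2 * (A * (/ x) ^ m)) <= INR n ^ 2 * ((/ x) ^ 2 * (A * (/ x) ^ m))).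
    { apply Rmult_le_compat_r.
      apply Rmult_le_pos; [apply pow_le; lra|apply Rmult_le_pos; [exact HA|apply pow_le; lra]].
      generalize (pos_INR m). rewrite Hm. nra. }
    assert (T2 : INR n * (INR n - 1) * ((/ x) ^ 2 * (B * x ^ n)) <= INR n ^ 2 * ((/ x) ^ 2 * (B * x ^ n))).
    { apply Rmult_le_compat_r.
      apply Rmult_le_pos; [apply pow_le; lra|apply Rmult_le_pos; [exact HB|apply pow_le; lra]].
      nra. }
    lra.
  - unfold z, A. assert (a ^ m * (/ a) ^ m = 1). { rewrite <- Rpow_mult_distr, Rinv_r by lra. apply pow1. }
    assert (0 <= B * a ^ n) by (apply Rmult_le_pos; auto; apply pow_le; lra).
    rewrite Rmult_assoc, H. lra.
  - unfold z, B. assert ((/ b) ^ n * b ^ n = 1). { rewrite <- Rpow_mult_distr, Rinv_l by lra. apply pow1. }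
    assert (0 <= A * (/ b) ^ m) by (apply Rmult_le_pos; auto; apply pow_le; left; apply Rinv_0_lt_compat; lra).
    rewrite Rmult_assoc, H. lra. }
unfold z, A, B in Hz. unfold Rdiv. rewrite !Rpow_mult_distr. lra.
Qed.
End Pair.

Lemma exp_pow x n : exp x ^ n = exp (INR n * x).
Proof.
induction n as [|n IH]. simpl. now rewrite Rmult_0_l, exp_0.
rewrite S_INR. simpl. rewrite IH, <- exp_plus. f_equal; ring.
Qed.

Lemma exp_le_mult K x y : 0 <= K -> x <= y -> K * exp x <= K * exp y.
Proof. intros; apply Rmult_le_compat_l; auto using exp_mono. Qed.

Lemma exp_ge_1 x : 0 <= x -> 1 <= exp x.
Proof. intros; rewrite <- exp_0; now apply exp_mono. Qed.

Lemma exp_4_ge : 16 <= exp 4.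
Proof.
replace 4 with (INR 4 * 1) by (simpl; ring). rewrite <- exp_pow.
assert (H := exp_ineq1_le 1). assert (2 ^ 4 <= exp 1 ^ 4) by (apply pow_incr; lra). lra.
Qed.

Lemma pair_bound n Rm w w1 v v1 a b r B : 0 <= Rm -> Rm < r -> wsol n Rm w w1 -> wsol n Rm v v1 ->
  asy w w1 a b -> asy v v1 b (- a) -> mm n / r <= B ->
  (w r ^ 2 + v r ^ 2) + (w1 r ^ 2 + v1 r ^ 2) <= 2 * (a ^ 2 + b ^ 2) * exp B.
Proof.
intros HRm Hr Hw Hv Aw Av HB.
assert (K1 := asy_energy_bound n Rm w w1 a b r HRm Hw Aw Hr).
assert (K2 := asy_energy_bound n Rm v v1 b (- a) r HRm Hv Av Hr).
replace (b ^ 2 + (- a) ^ 2) with (a ^ 2 + b ^ 2) in K2 by ring.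
assert (0 <= a ^ 2 + b ^ 2) by (generalize (pow2_ge_0 a) (pow2_ge_0 b); lra).
assert (T := exp_le_mult (a ^ 2 + b ^ 2) _ _ H HB). lra.
Qed.

Lemma rad_bound R0 K : 0 < R0 -> 0 <= K -> exists C, 0 < C /\
  forall n Rm w w1 v v1 a b, 0 <= Rm < R0 -> wsol n Rm w w1 -> wsol n Rm v v1 ->
  asy w w1 a b -> asy v v1 b (- a) -> w R0 ^ 2 + v R0 ^ 2 <= K -> a ^ 2 + b ^ 2 <= K ->
  a ^ 2 + b ^ 2 <= C * exp (- (8 * INR n)) /\
  forall r, R0 * exp 10 <= r -> w r ^ 2 + v r ^ 2 <= C * exp (- (6 * INR n)).
Proof.
intros HR0 HK.
set (R1 := R0 * exp 10).
assert (HR1 : R0 < R1).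
{ unfold R1. rewrite <- (Rmult_1_r R0) at 1. apply Rmult_lt_compat_l; auto.
  rewrite <- exp_0. apply exp_increasing; lra. }
(* For [n >= N0] the ratio of [R1] to [n / 2] is at most [exp (-6)], and [n > 4]; smaller orders are
   treated by a crude constant. *)
destruct (INR_unbounded (2 * R1 * exp 6 + 4)) as [N0 HN0].
set (M := (INR N0 ^ 2 + 1) / R1).
assert (HM : 0 <= M).
{ apply Rmult_le_pos. generalize (pow2_ge_0 (INR N0)); lra. left; apply Rinv_0_lt_compat; lra. }
set (C := (2 * K + 1) * exp (8 * INR N0 + M) + 9 * K * exp 14 + 1).
assert (C1 : 0 <= 9 * K * exp 14) by (generalize (exp_pos 14); intros; apply Rmult_le_pos; lra).
assert (C2 : 0 <= (2 * K + 1) * exp (8 * INR N0 + M)) by (generalize (exp_pos (8 * INR N0 + M)); intros; apply Rmult_le_pos; lra).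
exists C. split. unfold C; lra.
intros n Rm w w1 v v1 a b HRm Hw Hv Aw Av HNK HPK.
set (P := a ^ 2 + b ^ 2) in *.
assert (HP : 0 <= P) by (unfold P; generalize (pow2_ge_0 a) (pow2_ge_0 b); lra).
assert (HX := pos_INR n). set (X := INR n) in *.
assert (PB : forall r B, Rm < r -> mm n / r <= B -> (w r ^ 2 + v r ^ 2) + (w1 r ^ 2 + v1 r ^ 2) <= 2 * P * exp B).
{ intros r B Hr HB. apply (pair_bound n Rm w w1 v v1 a b); auto. lra. }
assert (NN : forall r, 0 <= w r ^ 2 + v r ^ 2) by (intros r; generalize (pow2_ge_0 (w r)) (pow2_ge_0 (v r)); lra).
assert (SS : forall r, 0 <= w1 r ^ 2 + v1 r ^ 2) by (intros r; generalize (pow2_ge_0 (w1 r)) (pow2_ge_0 (v1 r)); lra).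
destruct (le_lt_dec N0 n) as [Hn|Hn].
- assert (HXN : 2 * R1 * exp 6 + 4 < X) by (apply Rlt_le_trans with (INR N0); auto; apply le_INR; auto).
  assert (E6 := exp_ge_1 6 ltac:(lra)).
  assert (X4 : 4 < X). { assert (0 < R1 * exp 6) by (apply Rmult_lt_0_compat; lra). lra. }
  assert (X2 : 2 * R1 < X). { assert (R1 * 1 <= R1 * exp 6) by (apply Rmult_le_compat_l; lra). lra. }
  (* The largest radius that [barrier] allows. From there on [mm n / r] is at most [2 n + 2], so
     comparing the energy with its limit costs only [exp (2 n + 2)]. *)
  set (R2 := X / 2).
  assert (HR2 : R1 < R2) by (unfold R2; lra).
  assert (Hmm : forall r, R2 <= r -> mm n / r <= 2 * X + 2).
  { intros r Hr. apply Rle_trans with (mm n / R2).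
    - apply Rmult_le_compat_l. generalize (mm_pos n); lra. apply Rinv_le_contravar; lra.
    - unfold mm, R2. fold X. replace ((X ^ 2 + 1) / (X / 2)) with (2 * X + 2 * / X) by (field; lra).
      assert (/ X <= 1). { rewrite <- Rinv_1. apply Rinv_le_contravar; lra. } lra. }
  assert (B2 := PB R2 (2 * X + 2) ltac:(lra) (Hmm R2 ltac:(lra))).
  set (E2 := exp (2 * X + 2)) in *.
  assert (E2p : 0 < E2) by apply exp_pos.
  assert (Hn1 : (1 <= n)%nat). { destruct n; [|lia]. unfold X in X4; simpl in X4; lra. }
  assert (Low : P <= 2 * E2 * (w R1 ^ 2 + v R1 ^ 2)).
  { destruct (Req_dec P 0) as [Z|NZ]. rewrite Z. apply Rmult_le_pos; auto; lra.
    assert (HP' : 0 < P) by (destruct HP; [auto|congruence]).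
    assert (L : P ^ 2 <= (w R1 ^ 2 + v R1 ^ 2) * (w1 R2 ^ 2 + v1 R2 ^ 2)).
    { apply (flux_lower n Rm w w1 v v1 Hw Hv P R1 R2); try lra.
      - intros t Ht. unfold nu. fold X.
        assert (1 <= (X ^ 2 - / 4) / t ^ 2); [|lra].
        assert (0 < t ^ 2) by (apply pow_lt; lra).
        apply Rmult_le_reg_r with (t ^ 2); auto. unfold Rdiv. rewrite Rmult_assoc, Rinv_l by lra.
        assert (t ^ 2 <= R2 ^ 2) by (apply pow_incr; lra). unfold R2 in H0. nra.
      - intros t Ht. apply (flux_value n Rm); auto. }
    assert (L2 : P * P <= (w R1 ^ 2 + v R1 ^ 2) * (2 * P * E2)).
    { replace (P * P) with (P ^ 2) by ring. eapply Rle_trans. apply L. apply Rmult_le_compat_l; auto.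
      specialize (NN R2). lra. }
    apply Rmult_le_reg_r with P; lra. }
  assert (Bar : forall r, R1 <= r <= R2 -> w r ^ 2 + v r ^ 2 <= K * exp (10 - 10 * X) + 2 * P * E2 * (r / R2) ^ n).
  { intros r Hr. eapply Rle_trans. apply (barrier n Rm w w1 v v1 ltac:(lra) Hw Hv R0 R2 r); auto; try lra.
    unfold R2, X; lra.
    assert (Q0 : 0 <= (r / R2) ^ n). { apply pow_le, Rmult_le_pos. lra. left; apply Rinv_0_lt_compat; lra. }
    apply Rplus_le_compat.
    - apply Rmult_le_compat; auto. apply pow_le, Rmult_le_pos. lra. left; apply Rinv_0_lt_compat; lra.
      replace (10 - 10 * X) with (INR (n - 1) * Ropp 10).
      2:{ rewrite minus_INR by auto. unfold X. simpl (INR 1). ring. }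
      rewrite <- exp_pow. apply pow_incr. split. apply Rmult_le_pos. lra. left; apply Rinv_0_lt_compat; lra.
      rewrite exp_Ropp. apply Rle_trans with (R0 / R1).
      apply Rmult_le_compat_l. lra. apply Rinv_le_contravar; lra.
      unfold R1. right. field. split. apply Rgt_not_eq, exp_pos. lra.
    - apply Rmult_le_compat_r; auto. specialize (SS R2). lra. }
  assert (B1 := Bar R1 ltac:(lra)).
  assert (Pw : (R1 / R2) ^ n <= exp (- (6 * X))).
  { replace (- (6 * X)) with (INR n * Ropp 6) by (unfold X; ring). rewrite <- exp_pow. apply pow_incr.
    split. apply Rmult_le_pos. lra. left; apply Rinv_0_lt_compat; lra.
    rewrite exp_Ropp. apply Rmult_le_reg_r with (exp 6 * R2). apply Rmult_lt_0_compat; lra.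
    unfold R2. field_simplify; lra. }
  (* The contribution fed from the outer end is itself bounded by the value at [R1]: the factor is
     [4 exp (4 - 2 n)], at most one half, so it is absorbed into the left side. *)
  assert (N1 : w R1 ^ 2 + v R1 ^ 2 <= 2 * (K * exp (10 - 10 * X))).
  { assert (T1 : 2 * P * E2 * (R1 / R2) ^ n <= 2 * (2 * E2 * (w R1 ^ 2 + v R1 ^ 2)) * E2 * exp (- (6 * X))).
    { apply Rmult_le_compat; auto. apply Rmult_le_pos; lra. apply pow_le, Rmult_le_pos. lra. left; apply Rinv_0_lt_compat; lra.
      apply Rmult_le_compat_r; lra. }
    replace (2 * (2 * E2 * (w R1 ^ 2 + v R1 ^ 2)) * E2 * exp (- (6 * X))) with
      (4 * exp (4 - 2 * X) * (w R1 ^ 2 + v R1 ^ 2)) in T1.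
    2:{ replace (4 - 2 * X) with ((2 * X + 2) + (2 * X + 2) + - (6 * X)) by ring. rewrite (exp_plus (2 * X + 2 + (2 * X + 2))), (exp_plus (2 * X + 2) (2 * X + 2)). fold E2. ring. }
    assert (T2 : exp (4 - 2 * X) <= / 16).
    { apply Rle_trans with (exp (Ropp 4)). apply exp_mono; lra. rewrite exp_Ropp. apply Rinv_le_contravar. lra. apply exp_4_ge. }
    assert (4 * exp (4 - 2 * X) * (w R1 ^ 2 + v R1 ^ 2) <= / 2 * (w R1 ^ 2 + v R1 ^ 2)) by (apply Rmult_le_compat_r; auto; lra).
    lra. }
  assert (PP : P <= 4 * K * exp (12 - 8 * X)).
  { eapply Rle_trans. apply Low. apply Rle_trans with (2 * E2 * (2 * (K * exp (10 - 10 * X)))).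
    apply Rmult_le_compat_l; lra. right. replace (12 - 8 * X) with ((2 * X + 2) + (10 - 10 * X)) by ring. rewrite exp_plus. fold E2. ring. }
  assert (PE : 2 * P * E2 <= 8 * K * exp (14 - 6 * X)).
  { apply Rle_trans with (2 * (4 * K * exp (12 - 8 * X)) * E2). apply Rmult_le_compat_r; lra.
    right. replace (14 - 6 * X) with ((2 * X + 2) + (12 - 8 * X)) by ring. rewrite exp_plus. fold E2. ring. }
  assert (CB : forall s, exp 14 * exp (- s) = exp (14 - s)) by (intros s; unfold Rminus; now rewrite exp_plus).
  assert (CC : forall s, 9 * K * exp (14 - s) <= C * exp (- s)).
  { intros s. rewrite <- CB. rewrite <- Rmult_assoc. apply Rmult_le_compat_r. left; apply exp_pos. unfold C; lra. }
  split.
  + eapply Rle_trans. apply PP. eapply Rle_trans. 2: apply CC.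
    apply Rle_trans with (4 * K * exp (14 - 8 * X)). apply exp_le_mult; lra. apply Rmult_le_compat_r. left; apply exp_pos. lra.
  + intros r Hr. eapply Rle_trans. 2: apply CC.
    destruct (Rle_dec r R2) as [L|L].
    * eapply Rle_trans. apply Bar; lra.
      assert ((r / R2) ^ n <= 1).
      { rewrite <- (pow1 n). apply pow_incr. split. apply Rmult_le_pos. lra. left; apply Rinv_0_lt_compat; lra.
        apply Rmult_le_reg_r with R2. lra. unfold Rdiv. rewrite Rmult_assoc, Rinv_l by lra. lra. }
      assert (2 * P * E2 * (r / R2) ^ n <= 2 * P * E2 * 1). apply Rmult_le_compat_l; auto. apply Rmult_le_pos; lra.
      assert (K * exp (10 - 10 * X) <= K * exp (14 - 6 * X)) by (apply exp_le_mult; lra). lra.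
    * assert (Q := PB r (2 * X + 2) ltac:(lra) (Hmm r ltac:(lra))). fold E2 in Q. specialize (SS r).
      assert (0 <= K * exp (14 - 6 * X)) by (apply Rmult_le_pos; auto; left; apply exp_pos). lra.
(* For the finitely many small orders the energy bound suffices; the term [exp (8 N0 + M)] in [C]
   compensates the exponentials demanded. *)
- assert (HXN : X <= INR N0) by (apply le_INR; lia).
  assert (CC : forall s, 0 <= s <= 8 * INR N0 -> (2 * K + 1) * exp M <= C * exp (- s)).
  { intros s Hs. apply Rle_trans with ((2 * K + 1) * exp (8 * INR N0 + M) * exp (- s)).
    rewrite Rmult_assoc, <- exp_plus. apply exp_le_mult; lra.
    apply Rmult_le_compat_r. left; apply exp_pos. unfold C; lra. }
  assert (EM := exp_ge_1 M HM).
  split.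
  + eapply Rle_trans. 2: apply CC; lra.
    assert ((2 * K + 1) * 1 <= (2 * K + 1) * exp M) by (apply Rmult_le_compat_l; lra). lra.
  + intros r Hr. eapply Rle_trans. 2: apply CC; lra.
    assert (Q := PB r M ltac:(lra)).
    assert (H : mm n / r <= M).
    { unfold mm, M. fold X. apply Rmult_le_compat. generalize (pow2_ge_0 X); lra. left; apply Rinv_0_lt_compat; lra.
      assert (X ^ 2 <= INR N0 ^ 2) by (apply pow_incr; lra). lra. apply Rinv_le_contravar; lra. }
    specialize (Q H). specialize (SS r).
    assert (2 * P * exp M <= (2 * K + 1) * exp M) by (apply Rmult_le_compat_r; lra). lra.
Qed.

(** * Asymptotic expansions *)

(* Coefficients of the asymptotic expansion [sum_j kk n j r^-j (-i)^j A exp (i r)] of the solutions,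
   with [A = a + i b]; [rot j (a, b)] is [(-i)^j A]. *)
Fixpoint kk (n j : nat) : R :=
  match j with
  | O => 1
  | S i => kk n i * (((INR i + / 2) ^ 2 - INR n ^ 2) / (2 * (INR i + 1)))
  end.

Fixpoint rot (j : nat) (p : R * R) : R * R :=
  match j with
  | O => p
  | S i => (snd (rot i p), - fst (rot i p))
  end.

Definition oscj (j : nat) (a b r : R) : R := osc (fst (rot j (a, b))) (snd (rot j (a, b))) r.

Definition expan (n : nat) (a b : R) (J : nat) (r : R) : R :=
  sum_n (fun j => kk n j * (/ r) ^ j * oscj j a b r) J.

Definition expan1 (n : nat) (a b : R) (J : nat) (r : R) : R :=
  sum_n (fun j => kk n j * (- INR j * (/ r) ^ (j + 1) * oscj j a b r - (/ r) ^ j * oscj (S j) a b r)) J.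

Lemma oscj_le j a b r : Rabs (oscj j a b r) <= Rabs a + Rabs b.
Proof.
unfold oscj. eapply Rle_trans. apply osc_le.
induction j as [|j IH]; simpl; [lra|]. rewrite Rabs_Ropp. lra.
Qed.

Lemma oscj_derive j a b r : is_derive (oscj j a b) r (- oscj (S j) a b r).
Proof. unfold oscj, osc. simpl. auto_derive; auto. ring. Qed.

Lemma oscj_SS j a b r : oscj (S (S j)) a b r = - oscj j a b r.
Proof. unfold oscj, osc. simpl. ring. Qed.

Lemma expan_derive n a b J r : 0 < r -> is_derive (expan n a b J) r (expan1 n a b J r).
Proof.
intros Hr.
assert (T : forall j, is_derive (fun r => kk n j * (/ r) ^ j * oscj j a b r) r
  (kk n j * (- INR j * (/ r) ^ (j + 1) * oscj j a b r - (/ r) ^ j * oscj (S j) a b r))).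
{ intros j. eapply is_derive_eq. apply is_derive_mult_R. apply is_derive_Rscal. apply pow_inv_derive; auto.
  apply oscj_derive. req; ring. }
unfold expan, expan1. induction J as [|J IH].
- rewrite sum_O. apply (is_derive_ext (fun r => kk n 0 * (/ r) ^ 0 * oscj 0 a b r)). intros; now rewrite sum_O. apply T.
- rewrite sum_n_S. apply (is_derive_ext (fun r => sum_n (fun j => kk n j * (/ r) ^ j * oscj j a b r) J + kk n (S J) * (/ r) ^ (S J) * oscj (S J) a b r)).
  intros; now rewrite sum_n_S. apply is_derive_Rplus; auto.
Qed.

(* The truncated expansion solves the equation up to a single term: the other terms telescope. *)
Lemma expan_derive2 n a b J r : 0 < r -> is_derive (expan1 n a b J) r
  ((nu n / r ^ 2 - 1) * expan n a b J r - 2 * (INR J + 1) * kk n (S J) * (/ r) ^ (J + 2) * oscj (S (S J)) a b r).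
Proof.
intros Hr.
assert (T : forall j, is_derive (fun r => kk n j * (- INR j * (/ r) ^ (j + 1) * oscj j a b r - (/ r) ^ j * oscj (S j) a b r)) r
  (kk n j * (INR j * (INR j + 1) * (/ r) ^ (j + 2) * oscj j a b r + 2 * INR j * (/ r) ^ (j + 1) * oscj (S j) a b r + (/ r) ^ j * oscj (S (S j)) a b r))).
{ intros j. eapply is_derive_eq. apply is_derive_Rscal.
  apply (is_derive_minus (fun r => - INR j * (/ r) ^ (j + 1) * oscj j a b r)).
  apply is_derive_mult_R. apply is_derive_Rscal. apply pow_inv_derive; auto. apply oscj_derive.
  apply is_derive_mult_R. apply pow_inv_derive; auto. apply oscj_derive.
  unfold minus, plus, opp; simpl (AbelianMonoid.plus _ _). req. rewrite plus_INR. simpl (INR 1).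
  replace (j + 1 + 1)%nat with (j + 2)%nat by lia.
  unfold minus, plus, opp; simpl. ring. }
unfold expan, expan1. induction J as [|J IH].
- rewrite sum_O. apply (is_derive_ext (fun r => kk n 0 * (- INR 0 * (/ r) ^ (0 + 1) * oscj 0 a b r - (/ r) ^ 0 * oscj 1 a b r))). intros; now rewrite sum_O.
  eapply is_derive_eq. apply T. rewrite !oscj_SS. unfold nu. req. simpl. field. lra.
- apply (is_derive_ext (fun r => sum_n (fun j => kk n j * (- INR j * (/ r) ^ (j + 1) * oscj j a b r - (/ r) ^ j * oscj (S j) a b r)) J
    + kk n (S J) * (- INR (S J) * (/ r) ^ (S J + 1) * oscj (S J) a b r - (/ r) ^ (S J) * oscj (S (S J)) a b r))).
  intros; now rewrite sum_n_S.
  eapply is_derive_eq. apply is_derive_Rplus. apply IH. apply T.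
  req. rewrite sum_n_S. rewrite !oscj_SS.
  replace (J + 2)%nat with (S J + 1)%nat by lia. rewrite !pow_add, S_INR.
  change (kk n (S (S J))) with (kk n (S J) * (((INR (S J) + / 2) ^ 2 - INR n ^ 2) / (2 * (INR (S J) + 1)))).
  rewrite S_INR. unfold nu.
  generalize (sum_n (fun j => kk n j * (/ r) ^ j * oscj j a b r) J) (kk n (S J)) (oscj J a b r) (oscj (S J) a b r) ((/ r) ^ S J).
  intros. assert (HJ := pos_INR J). simpl. field. split; lra.
Qed.

Lemma tends_pow_inv_osc j (f : R -> R) B : (forall r, Rabs (f r) <= B) -> tends (fun r => (/ r) ^ S j * f r) 0.
Proof.
intros HB. apply (tends_mult_bounded _ _ B 0); auto.
induction j as [|j IH].
- apply (tends_ext (fun r => / r) _ _ 0). intros; simpl; ring. apply tends_inv.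
- apply (tends_ext (fun r => / r * (/ r) ^ S j) _ _ 0). intros; simpl; ring.
  replace 0 with (0 * 0) by ring. apply tends_mult; auto. apply tends_inv.
Qed.

Lemma expan_tends n a b J : tends (fun r => expan n a b J r - osc a b r) 0.
Proof.
unfold expan. induction J as [|J IH].
- apply (tends_ext (fun _ => 0) _ _ 0). intros; rewrite sum_O; unfold oscj; simpl; ring. apply tends_const.
- apply (tends_ext (fun r => (sum_n (fun j => kk n j * (/ r) ^ j * oscj j a b r) J - osc a b r) + kk n (S J) * ((/ r) ^ (S J) * oscj (S J) a b r)) _ _ 0).
  intros; rewrite sum_n_S; ring.
  apply (tends_eq _ (0 + kk n (S J) * 0)); [|ring]. apply tends_plus; auto. apply tends_scal.
  apply (tends_pow_inv_osc J _ (Rabs a + Rabs b)). intros; apply oscj_le.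
Qed.

Lemma expan1_tends n a b J : tends (fun r => expan1 n a b J r - osc (- b) a r) 0.
Proof.
unfold expan1. induction J as [|J IH].
- apply (tends_ext (fun _ => 0) _ _ 0). intros; rewrite sum_O; unfold oscj, osc; simpl; ring. apply tends_const.
- apply (tends_ext (fun r => (sum_n (fun j => kk n j * (- INR j * (/ r) ^ (j + 1) * oscj j a b r - (/ r) ^ j * oscj (S j) a b r)) J - osc (- b) a r)
     + (- kk n (S J) * INR (S J) * ((/ r) ^ (S (S J)) * oscj (S J) a b r) + - kk n (S J) * ((/ r) ^ (S J) * oscj (S (S J)) a b r))) _ _ 0).
  intros; rewrite sum_n_S. replace (S J + 1)%nat with (S (S J)) by lia. ring.
  apply (tends_eq _ (0 + (- kk n (S J) * INR (S J) * 0 + - kk n (S J) * 0))); [|ring].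
  apply tends_plus; auto. apply tends_plus; apply tends_scal;
  [apply (tends_pow_inv_osc (S J) _ (Rabs a + Rabs b))|apply (tends_pow_inv_osc J _ (Rabs a + Rabs b))]; intros; apply oscj_le.
Qed.

(** The error solves the same equation with a source of order [r^(- J - 2)], and it tends to 0 with
    its derivative. An energy estimate integrated inwards from infinity bounds it. *)
Lemma expan_error n Rm w w1 a b J r : 0 <= Rm -> wsol n Rm w w1 -> asy w w1 a b -> Rm < r ->
  (w r - expan n a b J r) ^ 2 <=
  exp ((mm n + 1) / r) * ((2 * (INR J + 1) * Rabs (kk n (S J)) * (Rabs a + Rabs b)) ^ 2 * (/ r) ^ (2 * J + 1)).
Proof.
intros HRm Hw [A1 A2] Hr.
set (K := 2 * (INR J + 1) * Rabs (kk n (S J)) * (Rabs a + Rabs b)).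
(* The additional 1 pays for the source: [2 z1 rho] is at least [- z1^2 / t^2 - t^2 rho^2]. *)
set (m := mm n + 1).
set (z := fun r => w r - expan n a b J r). set (z1 := fun r => w1 r - expan1 n a b J r).
set (rho := fun r => 2 * (INR J + 1) * kk n (S J) * (/ r) ^ (J + 2) * oscj (S (S J)) a b r).
assert (Dz : forall t, Rm < t -> is_derive z t (z1 t)).
{ intros t Ht. apply (is_derive_minus w). apply (Hw t Ht). apply expan_derive; lra. }
assert (Dz1 : forall t, Rm < t -> is_derive z1 t ((nu n / t ^ 2 - 1) * z t + rho t)).
{ intros t Ht. eapply is_derive_eq. apply (is_derive_minus w1). apply (Hw t Ht). apply expan_derive2; lra.
  unfold minus, plus, opp; simpl (AbelianMonoid.plus _ _). unfold z, rho. unfold plus, opp; simpl. req. ring. }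
assert (HK : 0 <= K).
{ unfold K. repeat apply Rmult_le_pos; try apply Rabs_pos. lra. generalize (pos_INR J); lra.
  generalize (Rabs_pos a) (Rabs_pos b); lra. }
assert (Hrho : forall t, Rm < t -> t ^ 2 * rho t ^ 2 <= K ^ 2 * (/ t) ^ (2 * J + 2)).
{ intros t Ht. unfold rho.
  replace (t ^ 2 * (2 * (INR J + 1) * kk n (S J) * (/ t) ^ (J + 2) * oscj (S (S J)) a b t) ^ 2) with
    ((2 * (INR J + 1) * kk n (S J) * oscj (S (S J)) a b t) ^ 2 * (/ t) ^ (2 * J + 2)).
  2:{ rewrite !pow_add. replace (2 * J)%nat with (J + J)%nat by lia. rewrite pow_add. field. lra. }
  apply Rmult_le_compat_r. apply pow_le. left; apply Rinv_0_lt_compat; lra.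
  rewrite <- pow2_abs. apply pow_incr. split. apply Rabs_pos.
  unfold K. rewrite !Rabs_mult, (Rabs_pos_eq 2), (Rabs_pos_eq (INR J + 1)).
  apply Rmult_le_compat_l. repeat apply Rmult_le_pos; try apply Rabs_pos. lra. generalize (pos_INR J); lra. apply oscj_le.
  generalize (pos_INR J); lra. lra. }
(* The subtracted power contributes a derivative at least as large as the bound [Hrho] on the source
   term, so [F] is nondecreasing; its limit is 0, hence [F <= 0]. *)
set (F := fun t => (z t ^ 2 + z1 t ^ 2) * exp (- m / t) - K ^ 2 * (/ t) ^ (2 * J + 1)).
assert (HF : F r <= 0).
{ apply (tends_ge F 0 r).
  - apply (tends_eq _ (0 - K ^ 2 * 0)); [|ring]. apply tends_minus.
    + apply (tends_mult_bounded _ _ 1 0).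
      * intros t Ht. rewrite Rabs_pos_eq by (left; apply exp_pos). rewrite <- exp_0. apply exp_mono.
        unfold Rdiv. rewrite Ropp_mult_distr_l_reverse.
        assert (0 <= m * / t). apply Rmult_le_pos. unfold m; generalize (mm_pos n); lra. left; apply Rinv_0_lt_compat; lra. lra.
      * assert (Tz : tends z 0).
        { apply (tends_ext (fun r => (w r - osc a b r) - (expan n a b J r - osc a b r)) _ _ 0). intros; unfold z; ring.
          apply (tends_eq _ (0 - 0)); [|ring]. apply tends_minus; auto. apply expan_tends. }
        assert (Tz1 : tends z1 0).
        { apply (tends_ext (fun r => (w1 r - osc (- b) a r) - (expan1 n a b J r - osc (- b) a r)) _ _ 0). intros; unfold z1; ring.
          apply (tends_eq _ (0 - 0)); [|ring]. apply tends_minus; auto. apply expan1_tends. }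
        apply (tends_ext (fun r => z r * z r + z1 r * z1 r) _ _ 0). intros; ring.
        apply (tends_eq _ (0 * 0 + 0 * 0)); [|ring]. apply tends_plus; apply tends_mult; auto.
    + apply tends_scal. rewrite Nat.add_1_r. apply (tends_ext (fun r => (/ r) ^ S (2 * J) * 1) _ _ 0). intros; ring.
      apply (tends_pow_inv_osc _ (fun _ => 1) 1). intros; rewrite Rabs_R1; lra.
  - intros s Hs.
    apply (derive_nonneg_incr F (fun t => (2 * (nu n / t ^ 2) * (z t * z1 t) + 2 * z1 t * rho t + m / t ^ 2 * (z t ^ 2 + z1 t ^ 2)) * exp (- m / t)
       - K ^ 2 * (- INR (2 * J + 1) * (/ t) ^ (2 * J + 1 + 1)))); try lra.
    + intros t Ht. apply (is_derive_minus (fun t => (z t ^ 2 + z1 t ^ 2) * exp (- m / t))).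
      2: apply is_derive_Rscal, pow_inv_derive; lra.
      apply (is_derive_ext (fun t => (z t * z t + z1 t * z1 t) * exp (- m / t))). intros; f_equal; simpl; ring.
      specialize (Dz t ltac:(lra)). specialize (Dz1 t ltac:(lra)).
      eapply is_derive_eq. apply is_derive_mult_R. apply is_derive_Rplus; apply is_derive_mult_R; eauto.
      apply derive_exp_inv; lra. req. field. lra.
    + intros t Ht.
      assert (I0 : 0 < / t) by (apply Rinv_0_lt_compat; lra).
      assert (E1 := energy_derive_bound n t (z t) (z1 t) ltac:(lra)).
      assert (E2 := Hrho t ltac:(lra)).
      set (q := z t ^ 2 + z1 t ^ 2) in *.
      assert (Y : - (q / t ^ 2 + t ^ 2 * rho t ^ 2) <= 2 * z1 t * rho t).
      { assert (0 <= (z1 t / t + t * rho t) ^ 2) by apply pow2_ge_0.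
        replace ((z1 t / t + t * rho t) ^ 2) with (z1 t ^ 2 / t ^ 2 + 2 * z1 t * rho t + t ^ 2 * rho t ^ 2) in H by (field; lra).
        assert (0 <= z t ^ 2 / t ^ 2). apply Rmult_le_pos. apply pow2_ge_0. left; apply Rinv_0_lt_compat, pow_lt; lra.
        replace (q / t ^ 2) with (z t ^ 2 / t ^ 2 + z1 t ^ 2 / t ^ 2) by (unfold q; field; lra). lra. }
      assert (L : - (K ^ 2 * (/ t) ^ (2 * J + 2)) <= 2 * (nu n / t ^ 2) * (z t * z1 t) + 2 * z1 t * rho t + m / t ^ 2 * q).
      { generalize (Rabs_maj2 (2 * (nu n / t ^ 2) * (z t * z1 t))).
        replace (m / t ^ 2 * q) with (mm n / t ^ 2 * q + q / t ^ 2) by (unfold m; field; lra). lra. }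
      assert (X0 : 0 <= K ^ 2 * (/ t) ^ (2 * J + 2)) by (apply Rmult_le_pos; [apply pow2_ge_0|apply pow_le; lra]).
      assert (Ex : 0 < exp (- m / t) <= 1).
      { split. apply exp_pos. rewrite <- exp_0. apply exp_mono. unfold Rdiv. rewrite Ropp_mult_distr_l_reverse.
        assert (0 <= m * / t). apply Rmult_le_pos. unfold m; generalize (mm_pos n); lra. lra. lra. }
      replace (2 * J + 1 + 1)%nat with (2 * J + 2)%nat by lia.
      rewrite plus_INR. simpl (INR 1). assert (H2J := pos_INR (2 * J)).
      set (u := K ^ 2 * (/ t) ^ (2 * J + 2)) in *.
      replace (K ^ 2 * (- (INR (2 * J) + 1) * (/ t) ^ (2 * J + 2))) with (- ((INR (2 * J) + 1) * u)) by (unfold u; ring).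
      set (d := 2 * (nu n / t ^ 2) * (z t * z1 t) + 2 * z1 t * rho t + m / t ^ 2 * q) in *.
      assert (- u <= d * exp (- m / t)). { clearbody u d. nra. }
      assert (u <= (INR (2 * J) + 1) * u). { clearbody u. nra. } lra. }
unfold F in HF.
assert (Ep := exp_pos (m / r)).
assert (EE : exp (- m / r) * exp (m / r) = 1).
{ rewrite <- exp_plus. replace (- m / r + m / r) with 0 by (unfold Rdiv; ring). apply exp_0. }
fold z. change ((z r) ^ 2 <= exp (m / r) * (K ^ 2 * (/ r) ^ (2 * J + 1))).
apply Rle_trans with ((z r ^ 2 + z1 r ^ 2) * exp (- m / r) * exp (m / r)).
- rewrite Rmult_assoc, EE. generalize (pow2_ge_0 (z1 r)); lra.
- rewrite Rmult_comm. apply Rmult_le_compat_l; lra.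
Qed.

Lemma kk_bound J : exists B, 0 < B /\ forall j n, (j <= J)%nat -> Rabs (kk n j) <= B * mm n ^ J.
Proof.
induction J as [|J [B [HB IH]]].
- exists 1. split. lra. intros j n Hj. replace j with O by lia. simpl. rewrite Rabs_R1. lra.
- exists (B * (INR J + 1) ^ 2). assert (HJ := pos_INR J).
  assert (1 <= (INR J + 1) ^ 2) by (rewrite <- (pow1 2); apply pow_incr; lra).
  split. apply Rmult_lt_0_compat; lra.
  intros j n Hj. assert (M1 := mm_pos n).
  assert (Bm : 0 <= B * mm n ^ J) by (apply Rmult_le_pos; [lra|apply pow_le; lra]).
  assert (Q : 1 <= (INR J + 1) ^ 2 * mm n) by nra.
  replace (B * (INR J + 1) ^ 2 * mm n ^ S J) with (B * mm n ^ J * ((INR J + 1) ^ 2 * mm n)) by (simpl; ring).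
  destruct (le_lt_eq_dec _ _ Hj) as [L| ->].
  + eapply Rle_trans. apply IH; lia. rewrite <- (Rmult_1_r (B * mm n ^ J)) at 1. apply Rmult_le_compat_l; auto.
  + cbn [kk]. rewrite Rabs_mult. apply Rmult_le_compat; auto using Rabs_pos.
    unfold Rdiv. rewrite Rabs_mult, Rabs_inv, (Rabs_pos_eq (2 * (INR J + 1))) by lra.
    apply Rle_trans with (Rabs ((INR J + / 2) ^ 2 - INR n ^ 2) * 1).
    * apply Rmult_le_compat_l. apply Rabs_pos. rewrite <- Rinv_1. apply Rinv_le_contravar; lra.
    * rewrite Rmult_1_r. unfold mm. assert (X2 := pow2_ge_0 (INR n)). apply Rabs_le. split; nra.
Qed.

(** This follows from [(1 + x / q)^q <= exp x]; the exponent [q = 2 p + 1] is positive even for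
    [p = 0]. *)
Lemma mm_pow_exp p : exists B, 0 < B /\ forall n, mm n ^ p <= B * exp (INR n).
Proof.
set (q := (2 * p + 1)%nat). assert (Hq : 1 <= INR q).
{ replace 1 with (INR 1) by reflexivity. apply le_INR. unfold q; lia. }
exists (INR q ^ q). split. apply pow_lt; lra.
intros n. assert (HX := pos_INR n). set (X := INR n) in *.
apply Rle_trans with ((1 + X) ^ q).
- apply Rle_trans with ((1 + X) ^ (2 * p)).
  rewrite pow_mult. apply pow_incr. unfold mm; fold X. nra.
  apply Rle_pow. lra. unfold q; lia.
- apply Rle_trans with ((INR q * (1 + X / INR q)) ^ q).
  + apply pow_incr. split. lra. replace (INR q * (1 + X / INR q)) with (INR q + X) by (field; lra). lra.
  + rewrite Rpow_mult_distr. apply Rmult_le_compat_l. apply pow_le; lra.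
    replace X with (INR q * (X / INR q)) at 2 by (field; lra). rewrite <- exp_pow. apply pow_incr.
    assert (0 <= X / INR q) by (apply Rmult_le_pos; [lra|left; apply Rinv_0_lt_compat; lra]).
    split. lra. generalize (exp_ineq1_le (X / INR q)). lra.
Qed.

Lemma expan_le n a b J r Q : 1 <= r -> (forall j, (j <= J)%nat -> Rabs (kk n j) <= Q) ->
  Rabs (expan n a b J r) <= (INR J + 1) * (Q * (Rabs a + Rabs b)).
Proof.
intros Hr HQ.
assert (T : forall j, (j <= J)%nat -> Rabs (kk n j * (/ r) ^ j * oscj j a b r) <= Q * (Rabs a + Rabs b)).
{ intros j Hj. rewrite Rabs_mult. apply Rmult_le_compat; auto using Rabs_pos, oscj_le.
  rewrite Rabs_mult. apply Rle_trans with (Q * 1); [|lra].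
  apply Rmult_le_compat; auto using Rabs_pos.
  assert (0 < / r <= 1). { split. apply Rinv_0_lt_compat; lra. rewrite <- Rinv_1. apply Rinv_le_contravar; lra. }
  rewrite Rabs_pos_eq by (apply pow_le; lra). rewrite <- (pow1 j). apply pow_incr; lra. }
unfold expan. clear HQ. induction J as [|J IH].
- rewrite sum_O. simpl INR. eapply Rle_trans. apply T; lia. lra.
- rewrite sum_n_S, S_INR. eapply Rle_trans. apply Rabs_triang.
  assert (H1 := T (S J) (le_n _)). specialize (IH (fun j Hj => T j (Nat.le_trans _ _ _ Hj (Nat.le_succ_diag_r _)))).
  lra.
Qed.

Lemma le_of_sq x y : 0 <= y -> x ^ 2 <= y ^ 2 -> Rabs x <= y.
Proof. intros Hy H. apply Rabs_le. split; nra. Qed.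

(** Beyond [mm n + 1] the factor [exp ((mm n + 1) / r)] of [expan_error] is at most [exp 1]. Below
    that radius solution and expansion are bounded separately, and the missing powers of [1 / r] are
    bought with powers of [mm n]. In both cases the loss is polynomial in [n] and the decay of the
    amplitudes absorbs it, leaving a summable [exp (- n)]. *)
Lemma expan_uniform J C R1 : 1 <= R1 -> 0 <= C -> exists D, 0 <= D /\
  forall n Rm w w1 a b, 0 <= Rm < R1 -> wsol n Rm w w1 -> asy w w1 a b ->
  Rabs a <= C * exp (- (4 * INR n)) -> Rabs b <= C * exp (- (4 * INR n)) ->
  (forall r, R1 <= r -> Rabs (w r) <= C * exp (- (3 * INR n))) ->
  forall r, R1 <= r -> Rabs (w r - expan n a b J r) <= D * exp (- INR n) * ((/ r) ^ J * / sqrt r).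
Proof.
intros HR1 HC.
destruct (kk_bound (S J)) as [B [HB HBk]].
destruct (mm_pow_exp (S J)) as [B1 [HB1 HBm1]].
destruct (mm_pow_exp (S J + S J)) as [B2 [HB2 HBm2]].
set (D1 := 2 * (2 * (INR J + 1) * (B * B1) * (2 * C))).
set (D2 := 2 ^ S J * (C * B1 + (INR J + 1) * (2 * C) * (B * B2))).
assert (HJ := pos_INR J).
assert (HD1 : 0 <= D1). { unfold D1. repeat apply Rmult_le_pos; lra. }
assert (HD2 : 0 <= D2).
{ unfold D2. apply Rmult_le_pos. apply pow_le; lra. apply Rplus_le_le_0_compat; repeat apply Rmult_le_pos; lra. }
exists (D1 + D2). split. lra.
intros n Rm w w1 a b HRm Hw HA Ha Hb Hwb r Hr.
assert (HX := pos_INR n). set (X := INR n) in *.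
assert (M1 := mm_pos n).
assert (Mp : forall p, 1 <= mm n ^ p) by (intros p; apply pow_R1_Rle; lra).
assert (I0 : 0 < / r) by (apply Rinv_0_lt_compat; lra).
assert (Sr : 0 < sqrt r) by (apply sqrt_lt_R0; lra).
assert (Sr' : 0 < / sqrt r) by (apply Rinv_0_lt_compat; auto).
assert (Ab : Rabs a + Rabs b <= 2 * C * exp (- (4 * X))) by lra.
set (g := (/ r) ^ J * / sqrt r).
assert (Hg : 0 < g) by (apply Rmult_lt_0_compat; auto; apply pow_lt; auto).
assert (HkB : forall j, (j <= S J)%nat -> Rabs (kk n j) <= B * mm n ^ S J) by (intros; apply HBk; auto).
assert (EX : forall s, 0 < exp s) by apply exp_pos.
rewrite Rmult_plus_distr_r, Rmult_plus_distr_r.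
destruct (Rle_dec (mm n + 1) r) as [L|L].
- apply Rle_trans with (D1 * exp (- X) * g).
  2:{ assert (0 <= D2 * exp (- X) * g). apply Rmult_le_pos. apply Rmult_le_pos; auto. left; auto. left; auto. lra. }
  set (K := 2 * (INR J + 1) * Rabs (kk n (S J)) * (Rabs a + Rabs b)).
  assert (HK0 : 0 <= K).
  { unfold K. repeat apply Rmult_le_pos; try apply Rabs_pos; try lra. generalize (Rabs_pos a) (Rabs_pos b); lra. }
  assert (HK : 2 * K <= D1 * exp (- X)).
  { unfold K, D1. replace (- X) with (X + (X + - (4 * X)) + X) by ring.
    apply Rle_trans with (2 * (2 * (INR J + 1) * (B * (B1 * exp X)) * (2 * C * exp (- (4 * X))))).
    - apply Rmult_le_compat_l. lra. apply Rmult_le_compat; auto.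
      apply Rmult_le_pos. lra. apply Rabs_pos. generalize (Rabs_pos a) (Rabs_pos b); lra.
      apply Rmult_le_compat_l. lra. eapply Rle_trans. apply HkB; lia. apply Rmult_le_compat_l. lra. apply HBm1.
    - replace (2 * (2 * (INR J + 1) * (B * (B1 * exp X)) * (2 * C * exp (- (4 * X))))) with
        (2 * (2 * (INR J + 1) * (B * B1) * (2 * C)) * exp (X + - (4 * X))) by (rewrite exp_plus; ring).
      apply exp_le_mult; auto. lra. }
  apply Rle_trans with (2 * K * g). 2: apply Rmult_le_compat_r; auto; lra.
  apply le_of_sq. apply Rmult_le_pos; lra.
  eapply Rle_trans. apply (expan_error n Rm w w1 a b J r); auto. lra. lra. fold K.
  unfold g. replace ((2 * K * ((/ r) ^ J * / sqrt r)) ^ 2) with (4 * (K ^ 2 * (/ r) ^ (2 * J + 1))).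
  2:{ replace (2 * J + 1)%nat with (J + J + 1)%nat by lia. rewrite !pow_add.
      replace ((/ r) ^ 1) with ((/ sqrt r) * (/ sqrt r)). ring.
      rewrite <- Rinv_mult, sqrt_sqrt by lra. ring. }
  apply Rmult_le_compat_r. apply Rmult_le_pos. apply pow2_ge_0. apply pow_le; lra.
  apply Rle_trans with (exp 1). apply exp_mono. apply Rmult_le_reg_r with r. lra.
  unfold Rdiv. rewrite Rmult_assoc, Rinv_l by lra. lra. generalize exp_le_3; lra.
- apply Rle_trans with (D2 * exp (- X) * g).
  2:{ assert (0 <= D1 * exp (- X) * g). apply Rmult_le_pos. apply Rmult_le_pos; auto. left; auto. left; auto. lra. }
  (* Here [r < mm n + 1 <= 2 mm n], and [r >= 1] gives [sqrt r <= r], so each of the [J + 1] factors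
     is at least 1. *)
  assert (G1 : 1 <= (2 * mm n) ^ S J * g).
  { unfold g. rewrite <- tech_pow_Rmult.
    replace (2 * mm n * (2 * mm n) ^ J * ((/ r) ^ J * / sqrt r)) with ((2 * mm n * / sqrt r) * ((2 * mm n) * / r) ^ J)
      by (rewrite Rpow_mult_distr; ring).
    assert (T1 : 1 <= 2 * mm n * / r). { apply Rmult_le_reg_r with r. lra. rewrite Rmult_assoc, Rinv_l by lra. lra. }
    assert (T2 : 1 <= 2 * mm n * / sqrt r).
    { eapply Rle_trans. apply T1. apply Rmult_le_compat_l. lra. apply Rinv_le_contravar; auto.
      rewrite <- (sqrt_sqrt r) at 2 by lra. assert (1 <= sqrt r) by (rewrite <- sqrt_1; apply sqrt_le_1; lra). nra. }
    assert (T3 : 1 <= (2 * mm n * / r) ^ J) by (apply pow_R1_Rle; lra).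
    rewrite <- (Rmult_1_r 1) at 1. apply Rmult_le_compat; lra. }
  assert (W1 : Rabs (w r - expan n a b J r) <= C * exp (- (3 * X)) + (INR J + 1) * ((B * mm n ^ S J) * (2 * C * exp (- (4 * X))))).
  { unfold Rminus. eapply Rle_trans. apply Rabs_triang. rewrite Rabs_Ropp. apply Rplus_le_compat; auto.
    eapply Rle_trans. apply (expan_le n a b J r (B * mm n ^ S J)). lra. intros j Hj; apply HkB; lia.
    apply Rmult_le_compat_l. lra. apply Rmult_le_compat_l. apply Rmult_le_pos. lra. specialize (Mp (S J)); lra. auto. }
  set (Z := C * exp (- (3 * X)) + (INR J + 1) * ((B * mm n ^ S J) * (2 * C * exp (- (4 * X))))) in *.
  assert (Z0 : 0 <= Z). { eapply Rle_trans. apply Rabs_pos. apply W1. }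
  eapply Rle_trans. apply W1.
  apply Rle_trans with (Z * ((2 * mm n) ^ S J * g)). rewrite <- (Rmult_1_r Z) at 1. apply Rmult_le_compat_l; auto.
  rewrite <- Rmult_assoc. apply Rmult_le_compat_r. lra.
  rewrite Rpow_mult_distr. unfold Z, D2.
  replace ((C * exp (- (3 * X)) + (INR J + 1) * (B * mm n ^ S J * (2 * C * exp (- (4 * X))))) * (2 ^ S J * mm n ^ S J))
   with (2 ^ S J * (C * exp (- (3 * X)) * mm n ^ S J + (INR J + 1) * (2 * C) * (B * mm n ^ (S J + S J)) * exp (- (4 * X)))).
  2:{ rewrite pow_add. ring. }
  rewrite (Rmult_assoc (2 ^ S J)). apply Rmult_le_compat_l. apply pow_le; lra.
  rewrite (Rmult_plus_distr_r (C * B1)). apply Rplus_le_compat.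
  + apply Rle_trans with (C * exp (- (3 * X)) * (B1 * exp X)). apply Rmult_le_compat_l; auto. apply Rmult_le_pos; auto. left; auto.
    replace (C * exp (- (3 * X)) * (B1 * exp X)) with (C * B1 * exp (- (3 * X) + X)) by (rewrite exp_plus; ring).
    apply exp_le_mult. apply Rmult_le_pos; lra. lra.
  + apply Rle_trans with ((INR J + 1) * (2 * C) * (B * (B2 * exp X)) * exp (- (4 * X))).
    apply Rmult_le_compat_r. left; auto. apply Rmult_le_compat_l. apply Rmult_le_pos; lra. apply Rmult_le_compat_l. lra. apply HBm2.
    replace ((INR J + 1) * (2 * C) * (B * (B2 * exp X)) * exp (- (4 * X))) with ((INR J + 1) * (2 * C) * (B * B2) * exp (X + - (4 * X)))
      by (rewrite exp_plus; ring).
    apply exp_le_mult. repeat apply Rmult_le_pos; lra. lra.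
Qed.

(** * Summation of the expansions over the modes *)

Lemma ex_series_exp : ex_series (fun n => exp (- INR n)).
Proof.
apply (ex_series_ext (fun n => (exp (-1)) ^ n)).
- intros n. rewrite exp_pow. f_equal. ring.
- apply ex_series_geom. rewrite Rabs_pos_eq by (left; apply exp_pos). rewrite <- exp_0. apply exp_increasing. lra.
Qed.

Lemma ex_series_Rscal (u : nat -> R) c : ex_series u -> ex_series (fun n => c * u n).
Proof. exact (ex_series_scal (K := R_AbsRing) (V := R_NormedModule) c u). Qed.

Lemma is_series_Rscal (u : nat -> R) c l : is_series u l -> is_series (fun n => c * u n) (c * l).
Proof. exact (is_series_scal (K := R_AbsRing) (V := R_NormedModule) c u l). Qed.

Lemma is_series_Rplus (u v : nat -> R) l m : is_series u l -> is_series v m -> is_series (fun n => u n + v n) (l + m).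
Proof. exact (is_series_plus (K := R_AbsRing) (V := R_NormedModule) u v l m). Qed.

Lemma ex_series_dominated (u : nat -> R) C : (forall n, Rabs (u n) <= C * exp (- INR n)) -> ex_series u.
Proof.
intros H. apply (ex_series_le (K := R_AbsRing) (V := R_CompleteNormedModule) u (fun n => C * exp (- INR n))).
exact H. apply ex_series_Rscal, ex_series_exp.
Qed.

Lemma ex_series_moment (c : nat -> R) C j : 0 <= C ->
  (forall n, Rabs (c n) <= C * exp (- (4 * INR n))) -> ex_series (fun n => ew n * (c n * kk n j)).
Proof.
intros HC Hc. destruct (kk_bound j) as [B [HB HBk]]. destruct (mm_pow_exp j) as [B1 [HB1 HBm]].
apply (ex_series_dominated _ (C * (B * B1))). intros n. rewrite !Rabs_mult.
assert (HX := pos_INR n).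
apply Rle_trans with (1 * (C * exp (- (4 * INR n)) * (B * (B1 * exp (INR n))))).
- apply Rmult_le_compat; auto using Rabs_pos, ew_abs. apply Rmult_le_pos; apply Rabs_pos.
  apply Rmult_le_compat; auto using Rabs_pos. eapply Rle_trans. apply HBk; auto. apply Rmult_le_compat_l. lra. apply HBm.
- rewrite Rmult_1_l. replace (C * exp (- (4 * INR n)) * (B * (B1 * exp (INR n)))) with (C * (B * B1) * exp (- (4 * INR n) + INR n))
    by (rewrite exp_plus; ring).
  apply exp_le_mult. repeat apply Rmult_le_pos; lra. lra.
Qed.

Lemma is_series_le_exp (u : nat -> R) C l : 0 <= C -> (forall n, Rabs (u n) <= C * exp (- INR n)) -> is_series u l ->
  Rabs l <= C * Series (fun n => exp (- INR n)).
Proof.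
intros HC H Hl. apply is_series_unique in Hl. rewrite <- Hl.
assert (E := ex_series_exp).
assert (E2 : ex_series (fun n => C * exp (- INR n))) by (apply ex_series_Rscal; auto).
eapply Rle_trans. apply Series_Rabs.
- apply (ex_series_dominated _ C). intros n. rewrite Rabs_Rabsolu; auto.
- rewrite <- Series_scal_l. apply Series_le; auto. intros n. split; auto using Rabs_pos.
Qed.

Lemma Series_exp_nonneg : 0 <= Series (fun n => exp (- INR n)).
Proof.
eapply Rle_trans. apply Rabs_pos. rewrite <- (Rmult_1_l (Series _)).
apply (is_series_le_exp (fun n => exp (- INR n)) 1). lra.
intros n. rewrite Rabs_pos_eq. lra. left; apply exp_pos.
apply Series_correct, ex_series_exp.
Qed.

(** Summing the truncated expansions over the modes gives an expansion whose coefficients are the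
    moments of the amplitudes against [kk n j]. This works because [oscj] is linear in the
    amplitude. *)
Lemma expan_series (a b : nat -> R) C J r :
  0 <= C -> (forall n, Rabs (a n) <= C * exp (- (4 * INR n))) -> (forall n, Rabs (b n) <= C * exp (- (4 * INR n))) ->
  is_series (fun n => ew n * expan n (a n) (b n) J r)
   (sum_n (fun j => (/ r) ^ j * oscj j (Series (fun n => ew n * (a n * kk n j))) (Series (fun n => ew n * (b n * kk n j))) r) J).
Proof.
intros HC Ha Hb.
assert (T : forall j, is_series (fun n => ew n * (kk n j * (/ r) ^ j * oscj j (a n) (b n) r))
   ((/ r) ^ j * oscj j (Series (fun n => ew n * (a n * kk n j))) (Series (fun n => ew n * (b n * kk n j))) r)).
{ intros j.
  assert (Lin : exists p q, forall x y, oscj j x y r = p * x + q * y).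
  { induction j as [|j [p [q IH]]].
    - exists (cos r), (- sin r). intros; unfold oscj, osc; simpl; ring.
    - unfold oscj in *. assert (Lr : forall x y, (fst (rot (S j) (x, y)), snd (rot (S j) (x, y))) = (fst (rot j (y, - x)), snd (rot j (y, - x)))).
      { intros x y. clear. induction j as [|j IH]; simpl in *. auto. injection IH as E1 E2. now rewrite E1, E2. }
      exists (- q), p. intros x y. specialize (Lr x y). injection Lr as E1 E2.
      change (osc (fst (rot (S j) (x, y))) (snd (rot (S j) (x, y))) r = - q * x + p * y). simpl. rewrite E1, E2, IH. ring. }
  destruct Lin as [p [q Lin]]. rewrite Lin.
  eapply is_series_ext.
  2:{ apply is_series_Rscal. apply is_series_Rplus.
      apply is_series_Rscal. apply Series_correct, (ex_series_moment a C j HC Ha).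
      apply is_series_Rscal. apply Series_correct, (ex_series_moment b C j HC Hb). }
  intros n. rewrite Lin. req. ring. }
unfold expan. induction J as [|J IH].
- rewrite sum_O. eapply is_series_ext. 2: apply (T 0%nat). intros n. now rewrite sum_O.
- rewrite sum_n_S. eapply is_series_ext. 2: apply (is_series_Rplus _ _ _ _ IH (T (S J))).
  intros n. rewrite sum_n_S. req. ring.
Qed.

(** * Vanishing of the amplitudes from their moments *)

Section Moments.
Variables (A : nat -> R) (C : R).
Hypothesis HC : 0 <= C.
Hypothesis HA : forall n, Rabs (A n) <= C * exp (- (4 * INR n)).
Hypothesis HZ : forall j, Series (fun n => ew n * (A n * kk n j)) = 0.

Definition annihilated (f : nat -> R) : Prop := is_series (fun n => ew n * (A n * f n)) 0.

Lemma annihilated_lin f g h x y : annihilated f -> annihilated g -> (forall n, h n = x * f n + y * g n) -> annihilated h.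
Proof.
intros Hf Hg E. unfold annihilated in *.
replace 0 with (x * 0 + y * 0) by ring.
apply (is_series_ext (fun n => x * (ew n * (A n * f n)) + y * (ew n * (A n * g n)))).
intros n; rewrite E; req; ring.
apply is_series_Rplus; apply is_series_Rscal; auto.
Qed.

Lemma annihilated_kk j : annihilated (fun n => kk n j).
Proof.
unfold annihilated. rewrite <- (HZ j). apply Series_correct, (ex_series_moment A C j HC HA).
Qed.

(** A Lagrange interpolation factor in the variable [n^2]: it is 0 at [n = l] and, for [l] different
    from [m], 1 at [n = m]. *)
Definition node (m l n : nat) : R := (INR l ^ 2 - INR n ^ 2) / (INR l ^ 2 - INR m ^ 2).

(** The recursion of [kk] writes [n^2 kk n j] as a combination of [kk n j] and [kk n (j + 1)].
    Multiplication by any affine function of [n^2] therefore keeps all moments zero. *)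
Lemma annihilated_node m l f : (forall j, annihilated (fun n => f n * kk n j)) ->
  forall j, annihilated (fun n => f n * node m l n * kk n j).
Proof.
intros Hf j.
apply (annihilated_lin _ _ _ ((INR l ^ 2 - (INR j + / 2) ^ 2) / (INR l ^ 2 - INR m ^ 2))
  (2 * (INR j + 1) / (INR l ^ 2 - INR m ^ 2)) (Hf j) (Hf (S j))).
intros n. unfold node. cbn [kk]. assert (HJ := pos_INR j). unfold Rdiv at 1 2 3.
replace (2 * (INR j + 1) * / (INR l ^ 2 - INR m ^ 2) * (f n * (kk n j * (((INR j + / 2) ^ 2 - INR n ^ 2) / (2 * (INR j + 1))))))
 with (/ (INR l ^ 2 - INR m ^ 2) * (f n * kk n j) * ((INR j + / 2) ^ 2 - INR n ^ 2)).
ring. generalize (/ (INR l ^ 2 - INR m ^ 2)). intros. field. lra.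
Qed.

Fixpoint low_nodes (m l n : nat) : R := match l with O => 1 | S l' => low_nodes m l' n * node m l' n end.
Fixpoint high_nodes (m i n : nat) : R := match i with O => 1 | S i' => high_nodes m i' n * node m (m + S i') n end.

Lemma annihilated_nodes m i : annihilated (fun n => low_nodes m m n * high_nodes m i n).
Proof.
assert (L : forall l j, annihilated (fun n => low_nodes m l n * kk n j)).
{ induction l as [|l IH]; intros j.
  - apply (annihilated_lin _ _ _ 1 0 (annihilated_kk j) (annihilated_kk j)). intros; simpl; ring.
  - apply (annihilated_node m l (low_nodes m l) IH j). }
assert (H : forall j, annihilated (fun n => low_nodes m m n * high_nodes m i n * kk n j)).
{ induction i as [|i IH]; intros j.
  - apply (annihilated_lin _ _ _ 1 0 (L m j) (L m j)). intros; simpl; ring.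
  - assert (K := annihilated_node m (m + S i) _ IH j).
    apply (annihilated_lin _ _ _ 1 0 K K). intros; cbn [high_nodes]; ring. }
apply (annihilated_lin _ _ _ 1 0 (H O) (H O)). intros; simpl; ring.
Qed.

Lemma INR_sq_neq l m : l <> m -> INR l ^ 2 - INR m ^ 2 <> 0.
Proof.
intros H E. apply H. apply INR_eq. generalize (pos_INR l) (pos_INR m). intros. nra.
Qed.

Lemma node_same m l : l <> m -> node m l m = 1.
Proof. intros H. unfold node. field. now apply INR_sq_neq. Qed.

Lemma node_zero m l : node m l l = 0.
Proof. unfold node, Rdiv. ring. Qed.

Lemma low_same m l : (l <= m)%nat -> low_nodes m l m = 1.
Proof. induction l as [|l IH]; intros H; simpl; auto. rewrite IH, node_same by lia. ring. Qed.

Lemma high_same m i : high_nodes m i m = 1.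
Proof. induction i as [|i IH]; simpl; auto. rewrite IH, node_same by lia. ring. Qed.

Lemma low_zero m l n : (n < l)%nat -> low_nodes m l n = 0.
Proof.
induction l as [|l IH]; intros H; [lia|]. simpl.
destruct (Nat.eq_dec n l) as [->|N]. rewrite node_zero; ring. rewrite IH by lia. ring.
Qed.

Lemma high_zero m i n : (m < n <= m + i)%nat -> high_nodes m i n = 0.
Proof.
induction i as [|i IH]; intros H; [lia|]. cbn [high_nodes].
destruct (Nat.eq_dec n (m + S i)) as [->|N]. rewrite node_zero; ring. rewrite IH by lia. ring.
Qed.

(** The nodes lie below [m], so each denominator is a nonzero integer in disguise and at least 1 in
    absolute value. *)
Lemma low_bound m l n : (l <= m)%nat -> (m < n)%nat -> Rabs (low_nodes m l n) <= mm n ^ l.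
Proof.
intros Hl Hn. induction l as [|l IH]. simpl; rewrite Rabs_R1; lra.
simpl. rewrite Rabs_mult, Rmult_comm. apply Rmult_le_compat; auto using Rabs_pos. 2: apply IH; lia.
unfold node, mm, Rdiv. rewrite Rabs_mult, Rabs_inv.
assert (L1 : INR l + 1 <= INR m) by (rewrite <- S_INR; apply le_INR; lia).
assert (L2 : INR m < INR n) by (apply lt_INR; lia).
generalize (pos_INR l). intros L0.
rewrite (Rabs_left1 (INR l ^ 2 - INR n ^ 2)), (Rabs_left1 (INR l ^ 2 - INR m ^ 2)) by nra.
apply Rle_trans with (- (INR l ^ 2 - INR n ^ 2) * 1); [|nra].
apply Rmult_le_compat_l. nra. rewrite <- Rinv_1. apply Rinv_le_contravar; nra.
Qed.

Lemma pow_fact_exp x i : 0 <= x -> x ^ i / INR (fact i) <= exp x.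
Proof.
intros Hx.
assert (H : is_lim_seq (sum_n (fun k => / INR (fact k) * x ^ k)) (exp x)).
{ assert (K := is_exp_Reals x). unfold is_pseries in K.
  eapply is_series_ext in K. 2: intros k; unfold scal; simpl; unfold mult; simpl; apply Rmult_comm.
  apply (is_lim_seq_ext (sum_n (fun k => / INR (fact k) * pow_n x k))).
  intros k. apply sum_n_ext. intros q. now rewrite pow_n_pow. exact K. }
assert (P : forall k, 0 <= / INR (fact k) * x ^ k).
{ intros k. apply Rmult_le_pos. left. apply Rinv_0_lt_compat, INR_fact_lt_0. now apply pow_le. }
assert (L : Rbar_le (x ^ i / INR (fact i)) (exp x)).
{ apply (is_lim_seq_le_loc (fun _ => x ^ i / INR (fact i)) (sum_n (fun k => / INR (fact k) * x ^ k))); auto.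
  2: apply is_lim_seq_const.
  exists i. intros N HN. induction HN as [|N HN IH].
  - unfold Rdiv. rewrite Rmult_comm. destruct i. rewrite sum_O; lra. rewrite sum_n_S.
    assert (0 <= sum_n (fun k => / INR (fact k) * x ^ k) i); [|lra].
    clear -P. induction i as [|i IH]. rewrite sum_O; auto. rewrite sum_n_S. specialize (P (S i)). lra.
  - rewrite sum_n_S. specialize (P (S N)). lra. }
exact L.
Qed.

(** The denominator at the node [m + i + 1] is at least [(i + 1)^2] and the numerator at most [n^2],
    so the product is at most the square of [n^i / i!], a term of the exponential series. *)
Lemma high_bound m i n : (m + i < n)%nat -> Rabs (high_nodes m i n) <= exp (2 * INR n).
Proof.
intros Hn. assert (HX := pos_INR n).
apply Rle_trans with ((INR n ^ i / INR (fact i)) ^ 2).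
2:{ replace (exp (2 * INR n)) with (exp (INR n) ^ 2) by (rewrite exp_pow; f_equal; simpl; ring).
    apply pow_incr. split. 2: apply pow_fact_exp; auto.
    apply Rmult_le_pos. apply pow_le; auto. left. apply Rinv_0_lt_compat, INR_fact_lt_0. }
induction i as [|i IH]. simpl. rewrite Rabs_R1. lra.
cbn [high_nodes]. rewrite Rabs_mult.
replace ((INR n ^ S i / INR (fact (S i))) ^ 2) with ((INR n ^ i / INR (fact i)) ^ 2 * (INR n ^ 2 * / (INR i + 1) ^ 2)).
2:{ change (fact (S i)) with (S i * fact i)%nat. rewrite mult_INR, S_INR. simpl. field.
    split. apply INR_fact_neq_0. generalize (pos_INR i); lra. }
apply Rmult_le_compat; auto using Rabs_pos. apply IH; lia.
unfold node, Rdiv. rewrite Rabs_mult, Rabs_inv.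
assert (L2 : INR (m + S i) <= INR n) by (apply le_INR; lia). rewrite plus_INR, S_INR in *.
generalize (pos_INR m) (pos_INR i). intros M0 I0.
rewrite (Rabs_left1 ((INR m + (INR i + 1)) ^ 2 - INR n ^ 2)), (Rabs_pos_eq ((INR m + (INR i + 1)) ^ 2 - INR m ^ 2)) by nra.
apply Rmult_le_compat. nra. left; apply Rinv_0_lt_compat; nra. nra. apply Rinv_le_contravar; nra.
Qed.

Lemma sum_single (u : nat -> R) m N : (m <= N)%nat -> (forall n, (n <= N)%nat -> n <> m -> u n = 0) -> sum_f_R0 u N = u m.
Proof.
intros Hm H. induction N as [|N IH].
- replace m with O by lia. reflexivity.
- cbn [sum_f_R0]. destruct (Nat.eq_dec m (S N)) as [->|D].
  + assert (Z : sum_f_R0 u N = 0).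
    { clear IH Hm. assert (Z : forall k, (k <= N)%nat -> sum_f_R0 u k = 0).
      { induction k as [|k IHk]; intros Hk; simpl. apply H; lia. rewrite IHk, H by lia. ring. }
      apply Z; lia. }
    rewrite Z. ring.
  + rewrite IH, (H (S N)) by (auto; lia). ring.
Qed.

(* Interpolating at the squares [0, 1, ..., (m + i)^2] by a polynomial in [n^2] isolates [A m] up to a tail,
   which the decay of [A] makes small. *)
Lemma moments_zero m : A m = 0.
Proof.
destruct (mm_pow_exp m) as [B [HB HBm]].
set (T := Series (fun n => exp (- INR n))).
assert (Key : forall i, Rabs (ew m * A m) <= C * B * T * exp (- INR i)).
{ intros i.
  set (u := fun n => ew n * (A n * (low_nodes m m n * high_nodes m i n))).
  assert (Hu : is_series u 0) by apply annihilated_nodes.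
  assert (Eu : ex_series u) by (eexists; eauto).
  assert (Su := is_series_unique _ _ Hu).
  rewrite (Series_incr_n u (S (m + i))) in Su by (auto; lia). simpl Nat.pred in Su.
  rewrite (sum_single u m) in Su.
  2: lia.
  2:{ intros n Hn Hnm. unfold u. destruct (le_lt_dec n m). rewrite low_zero by lia. ring. rewrite high_zero by lia. ring. }
  assert (Um : u m = ew m * A m). { unfold u. rewrite low_same, high_same by auto. ring. }
  assert (Bd : forall n, (m + i < n)%nat -> Rabs (u n) <= C * B * exp (- INR n)).
  { intros n Hn. unfold u. rewrite !Rabs_mult.
    apply Rle_trans with (1 * (C * exp (- (4 * INR n)) * ((B * exp (INR n)) * exp (2 * INR n)))).
    - apply Rmult_le_compat; auto using Rabs_pos, ew_abs. repeat apply Rmult_le_pos; apply Rabs_pos.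
      apply Rmult_le_compat; auto using Rabs_pos. apply Rmult_le_pos; apply Rabs_pos.
      apply Rmult_le_compat; auto using Rabs_pos. eapply Rle_trans. apply low_bound; lia. apply HBm. apply high_bound; lia.
    - right. replace (- INR n) with (- (4 * INR n) + INR n + 2 * INR n) by ring. rewrite !exp_plus. ring. }
  assert (Tl : Rabs (Series (fun k => u (S (m + i) + k)%nat)) <= C * B * exp (- INR i) * T).
  { apply (is_series_le_exp (fun k => u (S (m + i) + k)%nat)).
    - repeat apply Rmult_le_pos; try lra. left; apply exp_pos.
    - intros k. eapply Rle_trans. apply Bd; lia. replace (C * B * exp (- INR i) * exp (- INR k)) with (C * (B * exp (- INR i + - INR k))) by (rewrite exp_plus; ring).
      rewrite (Rmult_assoc C).
      apply Rmult_le_compat_l; auto. apply exp_le_mult. lra.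
      rewrite !plus_INR, S_INR, plus_INR. generalize (pos_INR m); lra.
    - apply Series_correct. apply (ex_series_incr_n u (S (m + i))). auto. }
  rewrite <- Um. replace (u m) with (- Series (fun k => u (S (m + i) + k)%nat)) by lra. rewrite Rabs_Ropp. lra. }
assert (Z : Rabs (ew m * A m) <= 0).
(* The estimate holds for every number [i] of nodes above [m]; a large [i] makes its right side
   smaller than any positive value. *)
{ apply Rnot_lt_le. intros P.
  destruct (INR_unbounded (C * B * T / Rabs (ew m * A m))) as [i Hi].
  specialize (Key i).
  assert (E : exp (- INR i) * (1 + INR i) <= 1).
  { rewrite exp_Ropp. apply Rmult_le_reg_l with (exp (INR i)). apply exp_pos. rewrite <- Rmult_assoc, Rinv_r by (apply Rgt_not_eq, exp_pos).
    generalize (exp_ineq1_le (INR i)). lra. }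
  assert (HI := pos_INR i). set (c := Rabs (ew m * A m)) in *. set (D := C * B * T) in *.
  assert (c * (1 + INR i) <= D * (exp (- INR i) * (1 + INR i))).
  { rewrite <- Rmult_assoc. apply Rmult_le_compat_r; lra. }
  assert (0 <= D).
  { assert (0 < exp (- INR i)) by apply exp_pos. apply Rnot_lt_le. intros Q. assert (D * exp (- INR i) < 0) by nra. lra. }
  assert (D < c * INR i). { apply Rmult_lt_reg_l with (/ c). apply Rinv_0_lt_compat; auto. rewrite <- Rmult_assoc, Rinv_l by lra. unfold Rdiv in Hi. lra. }
  nra. }
assert (E0 : ew m * A m = 0). { generalize (Rabs_pos (ew m * A m)). intros. apply Rabs_eq_0. lra. }
apply Rmult_integral in E0. destruct E0 as [E0|E0]; auto. destruct m; simpl in E0; lra.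
Qed.
End Moments.

(** * Radiating solutions *)

Definition exterior_in (V : plane -> Prop) (c : plane) (Rm : R) : Prop :=
  forall r p, Rm < r -> V (fst c + r * cos p, snd c + r * sin p).

(* Sommerfeld's condition about [c] for [f + i h]. *)
Definition rad (c : plane) (f fx fy h hx hy : R -> R -> R) : Prop :=
  forall eps, 0 < eps -> exists M, forall r p, M < r ->
    let x := fst c + r * cos p in let y := snd c + r * sin p in
    sqrt r * Rabs (cos p * fx x y + sin p * fy x y + h x y) < eps /\
    sqrt r * Rabs (cos p * hx x y + sin p * hy x y - f x y) < eps.

Lemma angle_reduce p : exists q, - PI <= q <= PI /\ cos q = cos p /\ sin q = sin p.
Proof.
assert (B := acos_bound (cos p)). assert (E := cos_acos (cos p) (COS_bound p)).
set (q := acos (cos p)) in *.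
assert (S : sin q ^ 2 = sin p ^ 2).
{ generalize (sin2_cos2 q) (sin2_cos2 p). unfold Rsqr. rewrite E. intros. simpl. lra. }
destruct (Rle_dec 0 (sin p * sin q)) as [L|L].
- exists q. repeat split; try lra. symmetry. apply sqr_eq_sign; auto.
- exists (- q). rewrite cos_neg, sin_neg. repeat split; try lra. symmetry. apply sqr_eq_sign. rewrite <- S. ring. lra.
Qed.

Lemma circle_bound V c r g : (forall x y, V (x, y) -> cont2 g x y) ->
  (forall p, V (fst c + r * cos p, snd c + r * sin p)) ->
  exists B, 0 < B /\ forall p, Rabs (g (fst c + r * cos p) (snd c + r * sin p)) <= B.
Proof.
intros Hg HV.
destruct (continuous_bounded (fun p => g (fst c + r * cos p) (snd c + r * sin p)) (- PI) PI) as [B [HB HB']].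
{ intros p _. apply (cont2_comp g (fun p => fst c + r * cos p) (fun p => snd c + r * sin p)); cts. apply Hg, HV. }
exists B. split; auto. intros p. destruct (angle_reduce p) as [q [Hq [E1 E2]]]. rewrite <- E1, <- E2. now apply HB'.
Qed.

Lemma exterior_annulus V c Rm r : exterior_in V c Rm -> annulus_in V c Rm r.
Proof. intros H s p Hs. apply H; lra. Qed.

Lemma slice_cont V c Rm r p0 g : exterior_in V c Rm -> Rm < r -> (forall x y, V (x, y) -> cont2 g x y) ->
  forall p, continuous (fun p => g (px c p0 r p) (py c p0 r p)) p.
Proof.
intros HE Hr Hg p. apply (cont2_slice (fun s p => g (px c p0 s p) (py c p0 s p))).
apply (polar_cont0 V c Rm (r + 1) p0 (exterior_annulus V c Rm (r + 1) HE)); auto. lra.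
Qed.

Lemma RInt_cos_bound (f : R -> R) n B : (forall p, continuous f p) -> (forall p, Rabs (f p) <= B) ->
  Rabs (RInt (fun p => f p * cos (INR n * p)) (- PI) PI) <= 2 * PI * B.
Proof.
intros Hc Hf. assert (HP := PI_RGT_0).
replace (2 * PI * B) with ((PI - - PI) * B) by ring. apply RInt_abs_le. lra.
apply ex_RInt_cont. intros; cts; auto.
intros p _. rewrite Rabs_mult. rewrite <- (Rmult_1_r B). apply Rmult_le_compat; auto using Rabs_pos.
apply Rabs_le, COS_bound.
Qed.

(** The mode after multiplication by [sqrt r]; [scoef1] is its derivative by the product rule. *)
Definition scoef (g : R -> R -> R) (c : plane) (p0 : R) (n : nat) (r : R) : R := sqrt r * coef g c p0 n r.
Definition scoef1 (g gx gy : R -> R -> R) (c : plane) (p0 : R) (n : nat) (r : R) : R :=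
  sqrt r * coef1 gx gy c p0 n r + coef g c p0 n r / (2 * sqrt r).

Lemma helm_cont k V g gx gy : open V -> helm k V g gx gy ->
  (forall x y, V (x, y) -> cont2 g x y) /\ (forall x y, V (x, y) -> cont2 gx x y) /\ (forall x y, V (x, y) -> cont2 gy x y).
Proof.
intros HV [H _]. split; [|split]; intros x y Hxy. apply (C1on_cont V g gx gy); auto. apply H; auto. apply H; auto.
Qed.

Lemma wsol_coef V c Rm p0 n g gx gy : open V -> exterior_in V c Rm -> 0 <= Rm -> helm 1 V g gx gy ->
  wsol n Rm (scoef g c p0 n) (scoef1 g gx gy c p0 n).
Proof.
intros HV HE HR Hg r Hr.
assert (HA := exterior_annulus V c Rm (r + 1) HE).
assert (D1 := coef_derive V c Rm (r + 1) p0 HV HA g gx gy n r (proj1 Hg) ltac:(lra)).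
assert (D2 := coef_derive2 V c Rm (r + 1) p0 HV HA 1 g gx gy n r Hg ltac:(lra) ltac:(lra)).
unfold scoef, scoef1. set (A := coef g c p0 n) in *. set (A1 := coef1 gx gy c p0 n) in *.
assert (S0 : 0 < sqrt r) by (apply sqrt_lt_R0; lra).
assert (SS : sqrt r * sqrt r = r) by (apply sqrt_sqrt; lra).
assert (Ds : is_derive sqrt r (/ (2 * sqrt r))) by (auto_derive; [lra|field; lra]).
split.
- eapply is_derive_eq. apply is_derive_mult_R; eauto. req. field. lra.
- apply (is_derive_ext (fun r => sqrt r * A1 r + A r * / (2 * sqrt r))). intros; reflexivity.
  eapply is_derive_eq. apply is_derive_Rplus; apply is_derive_mult_R; eauto.
  assert (Di : is_derive (fun r => / (2 * sqrt r)) r (- (2 * (/ (2 * sqrt r))) / (2 * sqrt r) ^ 2)).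
  { auto_derive. repeat split; lra. field. lra. }
  exact Di. req. unfold nu. cbv beta. generalize (A r) (A1 r) (INR n). intros u u1 m. clear - S0 SS.
  set (s := sqrt r) in *. clearbody s. subst r. field. lra.
Qed.

(** The uniformity of the radiation condition in the direction lets it pass under the integral.
    Differentiating [sqrt r] leaves an extra [scoef / (2 r)], which tends to 0 because solutions of
    the mode equation are bounded. *)
Lemma outgoing_coef V c Rm p0 n f fx fy h hx hy : open V -> exterior_in V c Rm -> 0 <= Rm ->
  helm 1 V f fx fy -> helm 1 V h hx hy -> rad c f fx fy h hx hy ->
  outgoing (scoef f c p0 n) (scoef1 f fx fy c p0 n) (scoef h c p0 n) (scoef1 h hx hy c p0 n).
Proof.
intros HV HE HR Hf Hh HRad.
assert (Gen : forall g gx gy G s, helm 1 V g gx gy -> (forall x y, V (x, y) -> cont2 G x y) ->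
  (forall eps, 0 < eps -> exists M, forall r p, M < r ->
    sqrt r * Rabs (cos p * gx (fst c + r * cos p) (snd c + r * sin p) + sin p * gy (fst c + r * cos p) (snd c + r * sin p)
      + s * G (fst c + r * cos p) (snd c + r * sin p)) < eps) ->
  tends (fun r => scoef1 g gx gy c p0 n r + s * scoef G c p0 n r) 0).
{ intros g gx gy G s Hg HG Hlim.
  destruct (helm_cont _ _ _ _ _ HV Hg) as [C1 [C2 C3]].
  destruct (wsol_bounded n Rm _ _ HR (wsol_coef V c Rm p0 n g gx gy HV HE HR Hg)) as [B [HB HBd]].
  apply (tends_ext (fun r => sqrt r * (coef1 gx gy c p0 n r + s * coef G c p0 n r) + / 2 * (/ r * scoef g c p0 n r)) _ _ Rm).
  { intros r Hr. unfold scoef1, scoef.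
    assert (S0 : 0 < sqrt r) by (apply sqrt_lt_R0; lra).
    assert (SS : sqrt r * sqrt r = r) by (apply sqrt_sqrt; lra).
    generalize (coef1 gx gy c p0 n r) (coef G c p0 n r) (coef g c p0 n r). intros u1 u2 u3. clear - S0 SS.
    set (t := sqrt r) in *. clearbody t. subst r. field. lra. }
  apply (tends_eq _ (0 + / 2 * 0)); [|ring]. apply tends_plus.
  - intros e He.
    destruct (Hlim (e / (4 * PI))) as [M HM]. { apply Rdiv_lt_0_compat; auto. generalize PI_RGT_0; lra. }
    exists (Rmax M Rm). intros r Hr. assert (Rm < r) by (eapply Rle_lt_trans; [apply Rmax_r|eauto]).
    assert (M < r) by (eapply Rle_lt_trans; [apply Rmax_l|eauto]).
    rewrite Rminus_0_r.
    assert (SI : coef1 gx gy c p0 n r + s * coef G c p0 n r =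
      RInt (fun p => ((cos (p0 + p) * gx (px c p0 r p) (py c p0 r p) + sin (p0 + p) * gy (px c p0 r p) (py c p0 r p))
         + s * G (px c p0 r p) (py c p0 r p)) * cos (INR n * p)) (- PI) PI).
    { unfold coef, coef1.
      assert (K1 := slice_cont V c Rm r p0 gx HE H C2). assert (K2 := slice_cont V c Rm r p0 gy HE H C3).
      assert (K3 := slice_cont V c Rm r p0 G HE H HG).
      rewrite <- RInt_Rscal by (intros; cts; auto). rewrite <- RInt_Rplus by (intros; cts; auto).
      apply RInt_ext. intros; req; ring. }
    rewrite SI. rewrite <- RInt_Rscal.
    2:{ assert (K1 := slice_cont V c Rm r p0 gx HE H C2). assert (K2 := slice_cont V c Rm r p0 gy HE H C3).
        assert (K3 := slice_cont V c Rm r p0 G HE H HG). intros; cts; auto. }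
    rewrite (RInt_ext _ (fun p => (sqrt r * (cos (p0 + p) * gx (px c p0 r p) (py c p0 r p) + sin (p0 + p) * gy (px c p0 r p) (py c p0 r p)
         + s * G (px c p0 r p) (py c p0 r p))) * cos (INR n * p))) by (intros; req; ring).
    eapply Rle_lt_trans.
    { apply (RInt_cos_bound _ n (e / (4 * PI))).
      - assert (K1 := slice_cont V c Rm r p0 gx HE H C2). assert (K2 := slice_cont V c Rm r p0 gy HE H C3).
        assert (K3 := slice_cont V c Rm r p0 G HE H HG). intros; cts; auto.
      - intros p. rewrite Rabs_mult, (Rabs_pos_eq (sqrt r)) by apply sqrt_pos. left. apply HM; auto. }
    generalize PI_RGT_0; intros. replace (2 * PI * (e / (4 * PI))) with (e / 2) by (field; lra). lra.
  - apply tends_scal. apply (tends_mult_bounded _ _ B (Rm + 1)). intros r Hr. apply HBd; lra. apply tends_inv. }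
split.
- apply (tends_ext (fun r => scoef1 f fx fy c p0 n r + 1 * scoef h c p0 n r) _ _ 0). intros; ring.
  apply Gen; auto. apply (helm_cont 1 V h hx hy); auto. intros e He. destruct (HRad e He) as [M HM].
  exists M. intros r p Hr. rewrite Rmult_1_l. apply HM; auto.
- apply (tends_ext (fun r => scoef1 h hx hy c p0 n r + (-1) * scoef f c p0 n r) _ _ 0). intros; ring.
  apply Gen; auto. apply (helm_cont 1 V f fx fy); auto. intros e He. destruct (HRad e He) as [M HM].
  exists M. intros r p Hr.
  replace (-1 * f (fst c + r * cos p) (snd c + r * sin p)) with (- f (fst c + r * cos p) (snd c + r * sin p)) by ring. apply HM; auto.
Qed.

Lemma fun_choice {X Y : Type} (P : X -> Y -> Prop) : (forall x, exists y, P x y) -> exists f, forall x, P x (f x).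
Proof.
intros H. exists (fun x => proj1_sig (constructive_indefinite_description _ (H x))).
intros x. apply (proj2_sig (constructive_indefinite_description _ (H x))).
Qed.

(** The constants [C] and [R1] precede the direction [p0], and this is what makes later bounds
    uniform. On the circle of radius [Rm + 1] all modes have a common bound by the suprema of both
    parts and their gradients, and [rad_bound] turns it into exponential decay. *)
Lemma modes V c Rm f fx fy h hx hy : open V -> exterior_in V c Rm -> 0 <= Rm ->
  helm 1 V f fx fy -> helm 1 V h hx hy -> rad c f fx fy h hx hy ->
  exists C R1, 0 <= C /\ 1 <= R1 /\ Rm < R1 /\ forall p0, exists a b : nat -> R, forall n,
    asy (scoef f c p0 n) (scoef1 f fx fy c p0 n) (a n) (b n) /\
    asy (scoef h c p0 n) (scoef1 h hx hy c p0 n) (b n) (- a n) /\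
    Rabs (a n) <= C * exp (- (4 * INR n)) /\ Rabs (b n) <= C * exp (- (4 * INR n)) /\
    forall r, R1 <= r -> Rabs (scoef f c p0 n r) <= C * exp (- (3 * INR n)) /\
                         Rabs (scoef h c p0 n r) <= C * exp (- (3 * INR n)).
Proof.
intros HV HE HR Hf Hh HRad.
set (R0 := Rm + 1).
assert (Bd : forall g, (forall x y, V (x, y) -> cont2 g x y) ->
  exists B, 0 < B /\ forall p, Rabs (g (fst c + R0 * cos p) (snd c + R0 * sin p)) <= B).
{ intros g Hg. apply (circle_bound V c R0 g Hg). intros p. apply HE. unfold R0; lra. }
destruct (helm_cont _ _ _ _ _ HV Hf) as [F1 [F2 F3]]. destruct (helm_cont _ _ _ _ _ HV Hh) as [H1 [H2 H3]].
destruct (Bd f F1) as [b1 [P1 B1]]. destruct (Bd fx F2) as [b2 [P2 B2]]. destruct (Bd fy F3) as [b3 [P3 B3]].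
destruct (Bd h H1) as [b4 [P4 B4]]. destruct (Bd hx H2) as [b5 [P5 B5]]. destruct (Bd hy H3) as [b6 [P6 B6]].
set (B := b1 + b2 + b3 + b4 + b5 + b6).
set (s := sqrt R0). assert (Hs : 1 <= s). { unfold s. rewrite <- sqrt_1. apply sqrt_le_1; unfold R0; lra. }
assert (HP := PI_RGT_0).
(* A common bound at [R0] for [scoef] and for [scoef1], which has two terms. It is independent of
   the order and of the direction. *)
set (Q := s * (2 * PI * B) + s * (2 * PI * B)).
assert (HB : 0 < B) by (unfold B; lra).
assert (PB : 0 < 2 * PI * B) by (apply Rmult_lt_0_compat; lra).
assert (HQ : 0 <= s * (2 * PI * B)) by (apply Rmult_le_pos; lra).
assert (Cf : forall g, (forall x y, V (x, y) -> cont2 g x y) -> (forall p, Rabs (g (fst c + R0 * cos p) (snd c + R0 * sin p)) <= B) ->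
   forall p0 n, Rabs (scoef g c p0 n R0) <= Q /\ Rabs (coef g c p0 n R0) <= 2 * PI * B).
{ intros g Hg Hb p0 n.
  assert (Rabs (coef g c p0 n R0) <= 2 * PI * B).
  { apply RInt_cos_bound. apply (slice_cont V c Rm); auto. unfold R0; lra. intros p. apply (Hb (p0 + p)). }
  split; auto. unfold scoef. fold s. rewrite Rabs_mult, (Rabs_pos_eq s) by lra.
  apply Rle_trans with (s * (2 * PI * B)). apply Rmult_le_compat_l; lra. unfold Q; lra. }
assert (Cf1 : forall g gx gy, (forall x y, V (x, y) -> cont2 gx x y) -> (forall x y, V (x, y) -> cont2 gy x y) ->
   (forall x y, V (x, y) -> cont2 g x y) -> (forall p, Rabs (g (fst c + R0 * cos p) (snd c + R0 * sin p)) <= B) ->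
   (forall p, Rabs (gx (fst c + R0 * cos p) (snd c + R0 * sin p)) + Rabs (gy (fst c + R0 * cos p) (snd c + R0 * sin p)) <= B) ->
   forall p0 n, Rabs (scoef1 g gx gy c p0 n R0) <= Q).
{ intros g gx gy Cx Cy Cg Hb Hbxy p0 n. unfold scoef1, Q. fold s.
  eapply Rle_trans. apply Rabs_triang. apply Rplus_le_compat.
  - rewrite Rabs_mult, (Rabs_pos_eq s) by lra. apply Rmult_le_compat_l. lra.
    apply RInt_cos_bound.
    + assert (K1 := slice_cont V c Rm R0 p0 gx HE ltac:(unfold R0; lra) Cx). assert (K2 := slice_cont V c Rm R0 p0 gy HE ltac:(unfold R0; lra) Cy).
      intros; cts; auto.
    + intros p. eapply Rle_trans. apply Rabs_triang. rewrite !Rabs_mult.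
      eapply Rle_trans. 2: apply (Hbxy (p0 + p)).
      assert (Rabs (cos (p0 + p)) <= 1) by (apply Rabs_le, COS_bound). assert (Rabs (sin (p0 + p)) <= 1) by (apply Rabs_le, SIN_bound).
      unfold px, py. apply Rplus_le_compat.
      rewrite <- (Rmult_1_l (Rabs (gx _ _))) at 2. apply Rmult_le_compat_r; auto using Rabs_pos.
      rewrite <- (Rmult_1_l (Rabs (gy _ _))) at 2. apply Rmult_le_compat_r; auto using Rabs_pos.
  - unfold Rdiv. rewrite Rabs_mult, Rabs_inv, (Rabs_pos_eq (2 * s)) by lra.
    assert (/ (2 * s) <= 1). { rewrite <- Rinv_1. apply Rinv_le_contravar; lra. }
    assert (0 < / (2 * s)) by (apply Rinv_0_lt_compat; lra).
    destruct (Cf g Cg Hb p0 n) as [_ K].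
    apply Rle_trans with (2 * PI * B * 1). apply Rmult_le_compat; auto using Rabs_pos. lra.
    rewrite Rmult_1_r. rewrite <- (Rmult_1_l (2 * PI * B)) at 1. apply Rmult_le_compat_r; lra. }
assert (Q0 : 0 <= Q) by (unfold Q; lra).
destruct (rad_bound R0 (2 * Q ^ 2) ltac:(unfold R0; lra) ltac:(generalize (pow2_ge_0 Q); lra)) as [C [HC HCb]].
set (C' := sqrt C).
assert (HC' : C' * C' = C) by (apply sqrt_sqrt; lra). assert (HC0 : 0 <= C') by apply sqrt_pos.
exists C', (R0 * exp 10).
assert (R01 : 1 <= R0) by (unfold R0; lra).
assert (E10 : 1 < exp 10) by (rewrite <- exp_0; apply exp_increasing; lra).
assert (R10 : R0 < R0 * exp 10). { rewrite <- (Rmult_1_r R0) at 1. apply Rmult_lt_compat_l; lra. }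
split; auto. split. lra. split. unfold R0 in *; lra.
intros p0.
assert (EX : forall n, exists ab : R * R,
    asy (scoef f c p0 n) (scoef1 f fx fy c p0 n) (fst ab) (snd ab) /\
    asy (scoef h c p0 n) (scoef1 h hx hy c p0 n) (snd ab) (- fst ab) /\
    Rabs (fst ab) <= C' * exp (- (4 * INR n)) /\ Rabs (snd ab) <= C' * exp (- (4 * INR n)) /\
    forall r, R0 * exp 10 <= r -> Rabs (scoef f c p0 n r) <= C' * exp (- (3 * INR n)) /\
                         Rabs (scoef h c p0 n r) <= C' * exp (- (3 * INR n))).
{ intros n.
  assert (Wf := wsol_coef V c Rm p0 n f fx fy HV HE HR Hf). assert (Wh := wsol_coef V c Rm p0 n h hx hy HV HE HR Hh).
  assert (Og := outgoing_coef V c Rm p0 n f fx fy h hx hy HV HE HR Hf Hh HRad).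
  destruct (asy_exists n Rm _ _ HR Wf) as [a [b Af]]. assert (Ah := outgoing_asy _ _ _ _ a b Og Af).
  exists (a, b). simpl fst; simpl snd. split; auto. split; auto.
  assert (X1 : Rabs (scoef f c p0 n R0) <= Q). { apply Cf; auto. intros p; eapply Rle_trans; [apply B1|unfold B; lra]. }
  assert (X2 : Rabs (scoef h c p0 n R0) <= Q). { apply Cf; auto. intros p; eapply Rle_trans; [apply B4|unfold B; lra]. }
  assert (Y1 : Rabs (scoef1 f fx fy c p0 n R0) <= Q).
  { apply Cf1; auto. intros p; eapply Rle_trans; [apply B1|unfold B; lra]. intros p. specialize (B2 p). specialize (B3 p). unfold B; lra. }
  assert (Y2 : Rabs (scoef1 h hx hy c p0 n R0) <= Q).
  { apply Cf1; auto. intros p; eapply Rle_trans; [apply B4|unfold B; lra]. intros p. specialize (B5 p). specialize (B6 p). unfold B; lra. }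
  assert (Sq : forall x, Rabs x <= Q -> x ^ 2 <= Q ^ 2).
  { intros x Hx. rewrite <- (pow2_abs x). apply pow_incr. split; auto using Rabs_pos. }
  assert (Fl := flux_value n Rm _ _ _ _ a b R0 Wf Wh Af Ah ltac:(unfold R0; lra)).
  assert (Fb : a ^ 2 + b ^ 2 <= 2 * Q ^ 2).
  { rewrite <- Fl. assert (S1 := Sq _ X1). assert (S2 := Sq _ X2). assert (S3 := Sq _ Y1). assert (S4 := Sq _ Y2).
    set (A1 := scoef f c p0 n R0) in *. set (A2 := scoef h c p0 n R0) in *.
    set (A3 := scoef1 f fx fy c p0 n R0) in *. set (A4 := scoef1 h hx hy c p0 n R0) in *.
    generalize (pow2_ge_0 (A1 - A4)) (pow2_ge_0 (A2 + A3)). lra. }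
  destruct (HCb n Rm _ _ _ _ a b ltac:(unfold R0; lra) Wf Wh Af Ah) as [G1 G2].
  { assert (S1 := Sq _ X1). assert (S2 := Sq _ X2). lra. }
  { exact Fb. }
  (* [rad_bound] speaks of squares; taking roots halves the rates 8 and 6. *)
  assert (E4 : exp (- (8 * INR n)) = exp (- (4 * INR n)) ^ 2) by (simpl; rewrite Rmult_1_r, <- exp_plus; f_equal; ring).
  assert (E3 : exp (- (6 * INR n)) = exp (- (3 * INR n)) ^ 2) by (simpl; rewrite Rmult_1_r, <- exp_plus; f_equal; ring).
  assert (EP : forall t, 0 <= C' * exp t) by (intros t; apply Rmult_le_pos; auto; left; apply exp_pos).
  rewrite E4, <- HC' in G1.
  split; [|split].
  - apply le_of_sq; auto. rewrite Rpow_mult_distr. generalize (pow2_ge_0 b). lra.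
  - apply le_of_sq; auto. rewrite Rpow_mult_distr. generalize (pow2_ge_0 a). lra.
  - intros r Hr. specialize (G2 r Hr). rewrite E3, <- HC' in G2.
    generalize (pow2_ge_0 (scoef f c p0 n r)) (pow2_ge_0 (scoef h c p0 n r)). intros.
    split; (apply le_of_sq; [apply EP|]; rewrite Rpow_mult_distr; lra). }
destruct (fun_choice _ EX) as [ab Hab].
exists (fun n => fst (ab n)), (fun n => snd (ab n)). exact Hab.
Qed.

Lemma ray_series V c Rm p0 r g gx gy : open V -> exterior_in V c Rm -> Rm < r -> helm 1 V g gx gy ->
  is_series (fun n => ew n * scoef g c p0 n r) (PI * (sqrt r * g (fst c + r * cos p0) (snd c + r * sin p0))).
Proof.
intros HV HE Hr Hg.
assert (S := fourier_polar V g gx gy c Rm (r + 1) p0 r HV (proj1 Hg) (exterior_annulus V c Rm (r + 1) HE) ltac:(lra)).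
unfold px, py in S. rewrite Rplus_0_r in S.
apply (is_series_Rscal _ (sqrt r)) in S. unfold scoef.
replace (PI * (sqrt r * g (fst c + r * cos p0) (snd c + r * sin p0))) with (sqrt r * (PI * g (fst c + r * cos p0) (snd c + r * sin p0))) by ring.
eapply is_series_ext. 2: apply S. intros n. req. ring.
Qed.

(** The decay of order [1 / sqrt r] is not part of the radiation condition. It comes from adding up
    the exponentially small modes, each bounded after multiplication by [sqrt r]. *)
Lemma rad_sup_bound V c Rm f fx fy h hx hy : open V -> exterior_in V c Rm -> 0 <= Rm ->
  helm 1 V f fx fy -> helm 1 V h hx hy -> rad c f fx fy h hx hy ->
  exists B R1, 0 <= B /\ 1 <= R1 /\ Rm < R1 /\ forall p r, R1 <= r ->
    sqrt r * Rabs (f (fst c + r * cos p) (snd c + r * sin p)) <= B /\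
    sqrt r * Rabs (h (fst c + r * cos p) (snd c + r * sin p)) <= B.
Proof.
intros HV HE HR Hf Hh HRad.
destruct (modes V c Rm f fx fy h hx hy HV HE HR Hf Hh HRad) as [C [R1 [HC [HR1 [HRm HM]]]]].
exists (C * Series (fun n => exp (- INR n))), R1.
split. apply Rmult_le_pos; auto using Series_exp_nonneg. split; auto. split; auto.
intros p r Hr. destruct (HM p) as [a [b Hab]].
assert (HP : 1 < PI) by (generalize PI2_1; lra).
assert (Gen : forall g gx gy, helm 1 V g gx gy -> (forall n, Rabs (scoef g c p n r) <= C * exp (- (3 * INR n))) ->
  sqrt r * Rabs (g (fst c + r * cos p) (snd c + r * sin p)) <= C * Series (fun n => exp (- INR n))).
{ intros g gx gy Hg Hb.
  assert (S := ray_series V c Rm p r g gx gy HV HE ltac:(lra) Hg).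
  apply (is_series_le_exp _ C) in S; auto.
  - rewrite Rabs_mult, Rabs_mult in S. rewrite (Rabs_pos_eq PI), (Rabs_pos_eq (sqrt r)) in S by (try apply sqrt_pos; lra).
    eapply Rle_trans. 2: apply S. rewrite <- (Rmult_1_l (sqrt r * _)) at 1. apply Rmult_le_compat_r. 2: lra.
    apply Rmult_le_pos. apply sqrt_pos. apply Rabs_pos.
  - intros n. rewrite Rabs_mult. rewrite <- (Rmult_1_l (C * _)). apply Rmult_le_compat; auto using Rabs_pos, ew_abs.
    eapply Rle_trans. apply Hb. apply exp_le_mult; auto. generalize (pos_INR n); lra. }
split.
- apply (Gen f fx fy); auto. intros n. destruct (Hab n) as [_ [_ [_ [_ K]]]]. apply K; auto.
- apply (Gen h hx hy); auto. intros n. destruct (Hab n) as [_ [_ [_ [_ K]]]]. apply K; auto.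
Qed.

(** * Leading behaviour along a ray *)

Lemma rot_comm j x y : rot j (y, - x) = (snd (rot j (x, y)), - fst (rot j (x, y))).
Proof. induction j as [|j IH]; simpl; auto. now rewrite IH. Qed.

Lemma rot_zero j p : rot j p = (0, 0) -> p = (0, 0).
Proof.
revert p. induction j as [|j IH]; intros p; simpl; auto.
intros E. apply IH. destruct (rot j p) as [u v]. simpl in E. injection E as E1 E2. f_equal; lra.
Qed.

Lemma oscj_zero j r : oscj j 0 0 r = 0.
Proof.
unfold oscj. assert (H : rot j (0, 0) = (0, 0)). { induction j as [|j IH]; simpl; auto. rewrite IH. simpl. f_equal; ring. }
rewrite H. unfold osc; simpl; ring.
Qed.

Lemma sum_n_zero (u : nat -> R) N : (forall j, (j <= N)%nat -> u j = 0) -> sum_n u N = 0.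
Proof.
induction N as [|N IH]; intros H. rewrite sum_O; auto.
rewrite sum_n_S, IH, H; auto. req; ring.
Qed.

Lemma osc_scal k x y r : osc (k * x) (k * y) r = k * osc x y r.
Proof. unfold osc; ring. Qed.

(** If some moment is nonzero, the first such index [J] gives the leading power, with the error of
    [expan_uniform] summed over the modes. If all moments vanish, so do all amplitudes, and with
    them all modes about the ray. *)
Lemma ray_dichotomy V c Rm f fx fy h hx hy p : open V -> exterior_in V c Rm -> 0 <= Rm ->
  helm 1 V f fx fy -> helm 1 V h hx hy -> rad c f fx fy h hx hy ->
  (forall r, Rm < r -> f (fst c + r * cos p) (snd c + r * sin p) = 0 /\ h (fst c + r * cos p) (snd c + r * sin p) = 0) \/
  exists J x y D R1, (x, y) <> (0, 0) /\ 1 <= R1 /\ Rm < R1 /\ forall r, R1 <= r ->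
    Rabs (r ^ J * (sqrt r * f (fst c + r * cos p) (snd c + r * sin p)) - osc x y r) <= D * / sqrt r /\
    Rabs (r ^ J * (sqrt r * h (fst c + r * cos p) (snd c + r * sin p)) - osc y (- x) r) <= D * / sqrt r.
Proof.
intros HV HE HR Hf Hh HRad.
destruct (modes V c Rm f fx fy h hx hy HV HE HR Hf Hh HRad) as [C [R1 [HC [HR1 [HRm HM]]]]].
destruct (HM p) as [a [b Hab]].
assert (Ha : forall n, Rabs (a n) <= C * exp (- (4 * INR n))) by (intros n; exact (proj1 (proj2 (proj2 (Hab n))))).
assert (Hb : forall n, Rabs (b n) <= C * exp (- (4 * INR n))) by (intros n; exact (proj1 (proj2 (proj2 (proj2 (Hab n)))))).
assert (Ha' : forall n, Rabs (- a n) <= C * exp (- (4 * INR n))) by (intros n; rewrite Rabs_Ropp; auto).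
set (Sa := fun j => Series (fun n => ew n * (a n * kk n j))). set (Sb := fun j => Series (fun n => ew n * (b n * kk n j))).
assert (HP : 1 < PI) by (generalize PI2_1; lra).
destruct (classic (exists j, (Sa j, Sb j) <> (0, 0))) as [[j0 Hj0]|N].
- right.
  destruct (dec_inh_nat_subset_has_unique_least_element (fun j => (Sa j, Sb j) <> (0, 0))) as [J [[HJ HJm] _]].
  { intros n. apply classic. } { exists j0; auto. }
  assert (HZ : forall j, (j < J)%nat -> Sa j = 0 /\ Sb j = 0).
  { intros j Hj. apply NNPP. intros Q. assert (J <= j)%nat; [|lia]. apply HJm. intros E. injection E; auto. }
  destruct (expan_uniform J C R1 HR1 HC) as [D [HD HDe]].
  set (T := Series (fun n => exp (- INR n))).
  set (q := rot J (Sa J, Sb J)).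
  (* The amplitude is the first nonzero moment turned by [(- i)^J]; the factor [/ PI] undoes the
     normalisation of the Fourier series. *)
  exists J, (/ PI * fst q), (/ PI * snd q), (D * T), R1.
  split. { intros E. apply HJ. apply (rot_zero J). fold q. injection E as E1 E2. destruct q as [u v]. simpl in *.
    apply Rmult_integral in E1. apply Rmult_integral in E2. assert (/ PI <> 0) by (apply Rinv_neq_0_compat; lra).
    f_equal; tauto. }
  split; auto. split; auto. intros r Hr.
  assert (Sr : 0 < sqrt r) by (apply sqrt_lt_R0; lra).
  assert (I0 : 0 < / r) by (apply Rinv_0_lt_compat; lra).
  assert (Gen : forall g gx gy (al be : nat -> R) A0 B0, helm 1 V g gx gy ->
    (forall n, asy (scoef g c p n) (scoef1 g gx gy c p n) (al n) (be n)) ->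
    (forall n, Rabs (al n) <= C * exp (- (4 * INR n))) -> (forall n, Rabs (be n) <= C * exp (- (4 * INR n))) ->
    (forall n r, R1 <= r -> Rabs (scoef g c p n r) <= C * exp (- (3 * INR n))) ->
    (forall j, (j < J)%nat -> Series (fun n => ew n * (al n * kk n j)) = 0 /\ Series (fun n => ew n * (be n * kk n j)) = 0) ->
    rot J (Series (fun n => ew n * (al n * kk n J)), Series (fun n => ew n * (be n * kk n J))) = (A0, B0) ->
    Rabs (r ^ J * (sqrt r * g (fst c + r * cos p) (snd c + r * sin p)) - osc (/ PI * A0) (/ PI * B0) r) <= D * T * / sqrt r).
  { intros g gx gy al be A0 B0 Hg As Hal Hbe Hw Hz Hrot.
    assert (S1 := ray_series V c Rm p r g gx gy HV HE ltac:(lra) Hg).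
    assert (S2 := expan_series al be C J r HC Hal Hbe).
    assert (S3 := is_series_Rplus _ _ _ _ S1 (is_series_Rscal _ (-1) _ S2)).
    assert (V2 : sum_n (fun j => (/ r) ^ j * oscj j (Series (fun n => ew n * (al n * kk n j))) (Series (fun n => ew n * (be n * kk n j))) r) J
      = (/ r) ^ J * osc A0 B0 r).
    { assert (Z : oscj J (Series (fun n => ew n * (al n * kk n J))) (Series (fun n => ew n * (be n * kk n J))) r = osc A0 B0 r).
      { unfold oscj. now rewrite Hrot. }
      assert (Zj : forall j, (j < J)%nat -> (/ r) ^ j * oscj j (Series (fun n => ew n * (al n * kk n j))) (Series (fun n => ew n * (be n * kk n j))) r = 0).
      { intros j Hj. destruct (Hz j Hj) as [-> ->]. rewrite oscj_zero. ring. }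
      clear -Z Zj. destruct J as [|J]. rewrite sum_O, Z; auto. rewrite sum_n_S, Z, sum_n_zero. req; ring. intros j Hj. apply Zj. lia. }
    rewrite V2 in S3.
    apply (is_series_le_exp _ (D * ((/ r) ^ J * / sqrt r))) in S3.
    - fold T in S3.
      replace (r ^ J * (sqrt r * g (fst c + r * cos p) (snd c + r * sin p)) - osc (/ PI * A0) (/ PI * B0) r) with
        (/ PI * r ^ J * (PI * (sqrt r * g (fst c + r * cos p) (snd c + r * sin p)) + -1 * ((/ r) ^ J * osc A0 B0 r))).
      2:{ assert (E : r ^ J * (/ r) ^ J = 1) by (rewrite <- Rpow_mult_distr, Rinv_r by lra; apply pow1).
          rewrite osc_scal.
          transitivity (/ PI * PI * (r ^ J * (sqrt r * g (fst c + r * cos p) (snd c + r * sin p))) - / PI * ((r ^ J * (/ r) ^ J) * osc A0 B0 r)). ring.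
          rewrite E, Rinv_l by lra. ring. }
      rewrite Rabs_mult. rewrite (Rabs_pos_eq (/ PI * r ^ J)).
      2:{ apply Rmult_le_pos. left; apply Rinv_0_lt_compat; lra. apply pow_le; lra. }
      assert (IP : / PI <= 1). { rewrite <- Rinv_1. apply Rinv_le_contravar; lra. }
      assert (IP0 : 0 < / PI) by (apply Rinv_0_lt_compat; lra).
      eapply Rle_trans. apply Rmult_le_compat_l. apply Rmult_le_pos. lra. apply pow_le; lra. apply S3.
      assert (E : r ^ J * (/ r) ^ J = 1) by (rewrite <- Rpow_mult_distr, Rinv_r by lra; apply pow1).
      replace (/ PI * r ^ J * (D * ((/ r) ^ J * / sqrt r) * T)) with (/ PI * (r ^ J * (/ r) ^ J) * (D * T * / sqrt r)) by ring.
      rewrite E, Rmult_1_r. rewrite <- (Rmult_1_l (D * T * / sqrt r)) at 2. apply Rmult_le_compat_r; auto.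
      apply Rmult_le_pos. 2: left; apply Rinv_0_lt_compat; auto. apply Rmult_le_pos; auto.
      apply Series_exp_nonneg.
    - apply Rmult_le_pos; auto. apply Rmult_le_pos. apply pow_le; lra. left; apply Rinv_0_lt_compat; auto.
    - intros n. replace (ew n * scoef g c p n r + -1 * (ew n * expan n (al n) (be n) J r)) with (ew n * (scoef g c p n r - expan n (al n) (be n) J r)) by ring.
      rewrite Rabs_mult. rewrite <- (Rmult_1_l (D * _ * _)). apply Rmult_le_compat; auto using Rabs_pos, ew_abs.
      replace (D * ((/ r) ^ J * / sqrt r) * exp (- INR n)) with (D * exp (- INR n) * ((/ r) ^ J * / sqrt r)) by ring.
      apply (HDe n Rm _ (scoef1 g gx gy c p n)); auto. apply (wsol_coef V); auto. }
  split.
  + apply (Gen f fx fy a b); auto.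
    * intros n. exact (proj1 (Hab n)).
    * intros n s Hs. exact (proj1 (proj2 (proj2 (proj2 (proj2 (Hab n)))) s Hs)).
    * exact (surjective_pairing q).
  (* The imaginary part has amplitudes [(b, - a)], that is [- i (a + i b)], and this factor commutes
     with [rot]. *)
  + replace (- (/ PI * fst q)) with (/ PI * - fst q) by ring.
    assert (Sn : forall j, Series (fun n => ew n * (- a n * kk n j)) = - Sa j).
    { intros j. unfold Sa. rewrite <- Series_opp. apply Series_ext. intros n; ring. }
    apply (Gen h hx hy b (fun n => - a n)); auto.
    * intros n. exact (proj1 (proj2 (Hab n))).
    * intros n s Hs. exact (proj2 (proj2 (proj2 (proj2 (proj2 (Hab n)))) s Hs)).
    * intros j Hj. rewrite Sn. destruct (HZ j Hj) as [-> Zb]. split. exact Zb. ring.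
    * rewrite Sn. apply rot_comm.
- left.
  assert (HZ : forall j, Sa j = 0 /\ Sb j = 0).
  { intros j. apply NNPP. intros Q. apply N. exists j. intros E. injection E; auto. }
  assert (Za : forall n, a n = 0). { intros n. apply (moments_zero a C); auto. intros j; apply HZ. }
  assert (Zb : forall n, b n = 0). { intros n. apply (moments_zero b C); auto. intros j; apply HZ. }
  intros r Hr.
  assert (Sr : 0 < sqrt r) by (apply sqrt_lt_R0; lra).
  assert (Gen : forall g gx gy, helm 1 V g gx gy -> (forall n, asy (scoef g c p n) (scoef1 g gx gy c p n) 0 0) ->
    g (fst c + r * cos p) (snd c + r * sin p) = 0).
  { intros g gx gy Hg As.
    assert (S := ray_series V c Rm p r g gx gy HV HE ltac:(lra) Hg).
    apply is_series_zero in S.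
    - apply Rmult_integral in S. destruct S as [S|S]; [lra|]. apply Rmult_integral in S. destruct S; lra.
    - intros n. rewrite (asy_zero n Rm (scoef g c p n) (scoef1 g gx gy c p n) r HR); auto. ring. apply (wsol_coef V); auto. }
  split.
  + apply (Gen f fx fy); auto. intros n. destruct (Hab n) as [K _]. now rewrite Za, Zb in K.
  + apply (Gen h hx hy); auto. intros n. destruct (Hab n) as [_ [K _]]. rewrite Za, Zb, Ropp_0 in K. auto.
Qed.

(** * Translation of the radiation condition, entire solutions *)

(** At radius 0 the gradient is constant under the integral, and the factor [cos p] selects its
    component in the direction [p0]. *)
Lemma first_mode_at_zero gx gy c p0 :
  coef1 gx gy c p0 1 0 = PI * (cos p0 * gx (fst c) (snd c) + sin p0 * gy (fst c) (snd c)).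
Proof.
unfold coef1. set (X := gx (fst c) (snd c)). set (Y := gy (fst c) (snd c)).
apply is_RInt_unique.
set (P := cos p0 * X + sin p0 * Y). set (Q := cos p0 * Y - sin p0 * X).
apply (is_RInt_FTC (fun p => P * (p / 2 + sin p * cos p / 2) + Q * (sin p * sin p / 2))).
- intros p _. unfold px, py. rewrite !Rmult_0_l, !Rplus_0_r. fold X Y.
  eapply is_derive_eq.
  { apply is_derive_Rplus; apply is_derive_Rscal; auto_derive; auto. }
  simpl (INR 1). rewrite !Rmult_1_l, cos_plus, sin_plus. unfold P, Q.
  assert (S2 : sin p * sin p = 1 - cos p * cos p) by (generalize (sin2_cos2 p); unfold Rsqr; lra).
  req. field_simplify.
  assert (S3 : sin p ^ 2 = 1 - cos p ^ 2) by (simpl; lra). rewrite ?S3. field.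
- intros p _. unfold px, py. apply (continuous_ext (fun p => (cos (p0 + p) * X + sin (p0 + p) * Y) * cos (INR 1 * p))).
  intros t. rewrite !Rmult_0_l, !Rplus_0_r. reflexivity. cts.
- rewrite sin_neg, cos_neg, sin_PI. field.
Qed.

(* For the first mode [a] about [c], [P = t^2 a' - t a = t^3 (a / t)'] has derivative [- t^2 a], so that
   [a / t] cannot vary much between [t = 0], where it is the gradient up to a factor, and [t = 1]. *)
Lemma gradient_bound V g gx gy c B p0 : open V -> helm 1 V g gx gy -> annulus_in V c (-2) 2 ->
  (forall r p, 0 <= r <= 1 -> Rabs (g (fst c + r * cos p) (snd c + r * sin p)) <= B) ->
  Rabs (cos p0 * gx (fst c) (snd c) + sin p0 * gy (fst c) (snd c)) <= 4 * B.
Proof.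
intros HV Hg HA HB.
assert (HP := PI_RGT_0).
destruct (helm_cont _ _ _ _ _ HV Hg) as [C1 [C2 C3]].
set (a := coef g c p0 1). set (a1 := coef1 gx gy c p0 1).
(* Polar coordinates also make sense for negative radii, so the mode is differentiable at the centre
   itself. *)
assert (Da : forall t, -2 < t < 2 -> is_derive a t (a1 t)).
{ intros t Ht. apply (coef_derive V c (-2) 2); auto. apply Hg. }
assert (Db : forall t, 0 < t < 2 -> is_derive a1 t (- a1 t / t - (1 ^ 2 - INR 1 ^ 2 / t ^ 2) * a t)).
{ intros t Ht. apply (coef_derive2 V c (-2) 2); auto; lra. }
assert (Db0 : exists l, is_derive a1 0 l).
{ destruct Hg as [_ [gxx [gxy [gyx [gyy [Hx [Hy _]]]]]]]. eexists.
  apply (coef1_derive V c (-2) 2 p0 HV HA gx gy gxx gxy gyx gyy 1 0 Hx Hy). lra. }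
set (m := 2 * PI * B).
assert (Ma : forall t, 0 <= t <= 1 -> Rabs (a t) <= m).
{ intros t Ht. unfold a, coef, m. apply RInt_cos_bound.
  - intros p. apply (cont2_slice (fun s p => g (px c p0 s p) (py c p0 s p))).
    apply (polar_cont0 V c (-2) 2 p0 HA); auto. lra.
  - intros p. apply HB; auto. }
assert (m0 : 0 <= m) by (eapply Rle_trans; [apply Rabs_pos|apply (Ma 0); lra]).
assert (A0 : a 0 = 0).
{ unfold a, coef. rewrite (RInt_ext _ (fun p => g (fst c) (snd c) * cos p)).
  rewrite RInt_Rscal by (intros; cts).
  assert (E : RInt cos (- PI) PI = 0).
  { apply is_RInt_unique. apply (is_RInt_FTC sin). intros; apply is_derive_sin. intros; cts. rewrite sin_neg, sin_PI; ring. }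
  rewrite E. ring. intros p _. unfold px, py. rewrite !Rmult_0_l, !Rplus_0_r. simpl (INR 1). now rewrite Rmult_1_l. }
set (P := fun t => t * t * a1 t - t * a t).
assert (DP : forall t, 0 <= t <= 1 -> is_derive P t (- (t * t * a t))).
{ intros t Ht.
  assert (E : exists l, is_derive a1 t l /\ 2 * t * a1 t + t * t * l - a t - t * a1 t = - (t * t * a t)).
  { destruct (Req_dec t 0) as [->|N].
    - destruct Db0 as [l Hl]. exists l. split; auto. rewrite A0. ring.
    - eexists. split. apply Db. lra. simpl (INR 1). field. auto. }
  destruct E as [l [Hl El]]. unfold P. eapply is_derive_eq.
  apply (is_derive_minus (fun t => t * t * a1 t) (fun t => t * a t)).
  - apply is_derive_mult_R. apply is_derive_mult_R; apply is_derive_id. exact Hl.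
  - apply is_derive_mult_R. apply is_derive_id. apply Da. lra.
  - unfold minus, plus, opp, one; simpl. rewrite <- El. req. ring. }
assert (BP : forall t, 0 < t <= 1 -> Rabs (P t) <= m * (t * t) * t).
{ intros t Ht. replace (P t) with (P t - P 0) by (unfold P; ring).
  replace t with (Rabs (t - 0)) at 4 by (rewrite Rminus_0_r, Rabs_pos_eq; lra).
  apply (mvt_bound P (fun t => - (t * t * a t)) 0 t).
  - rewrite Rmin_left, Rmax_right by lra. intros; apply DP; lra.
  - rewrite Rmin_left, Rmax_right by lra. intros s Hs. rewrite Rabs_Ropp, Rabs_mult, Rmult_comm.
    rewrite (Rabs_pos_eq (s * s)) by nra. apply Rmult_le_compat; auto using Rabs_pos. nra. apply Ma; lra. nra. }
assert (Bb : forall s, 0 < s <= 1 -> Rabs (a s) <= 2 * m * s).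
{ intros s Hs.
  assert (K : Rabs (a 1 / 1 - a s / s) <= m * Rabs (1 - s)).
  { apply (mvt_bound (fun t => a t / t) (fun t => P t / (t * t * t)) s 1).
    - rewrite Rmin_left, Rmax_right by lra. intros t Ht.
      apply (is_derive_ext (fun t => a t * / t)). intros; reflexivity.
      assert (Di : is_derive (fun t => / t) t (- / (t * t))). { auto_derive. lra. field. lra. }
      eapply is_derive_eq. apply is_derive_mult_R. apply Da; lra. exact Di. req. unfold P. field. lra.
    - rewrite Rmin_left, Rmax_right by lra. intros t Ht. unfold Rdiv. rewrite Rabs_mult, Rabs_inv.
      assert (T3 : 0 < t * t * t) by (repeat apply Rmult_lt_0_compat; lra).
      rewrite (Rabs_pos_eq (t * t * t)) by lra. apply Rmult_le_reg_r with (t * t * t); auto.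
      rewrite Rmult_assoc, Rinv_l, Rmult_1_r by lra. specialize (BP t ltac:(lra)). lra. }
  rewrite (Rabs_pos_eq (1 - s)) in K by lra.
  assert (K2 : Rabs (a s / s) <= 2 * m).
  { replace (a s / s) with (a 1 - (a 1 / 1 - a s / s)) by (unfold Rdiv; rewrite Rinv_1; ring).
    unfold Rminus. eapply Rle_trans. apply Rabs_triang. rewrite Rabs_Ropp.
    assert (M1 := Ma 1 ltac:(lra)). assert (m * (1 - s) <= m * 1) by (apply Rmult_le_compat_l; lra). unfold Rminus in *. lra. }
  replace (a s) with (a s / s * s) by (field; lra). rewrite Rabs_mult, (Rabs_pos_eq s) by lra.
  apply Rmult_le_compat_r; lra. }
(* Since [a 0 = 0], the derivative at 0 is the limit of [a s / s], which has just been bounded. *)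
assert (G : Rabs (a1 0) <= 2 * m).
{ apply Rnot_lt_le. intros L.
  assert (D0 := Da 0 ltac:(lra)). apply is_derive_Reals in D0.
  destruct (D0 (Rabs (a1 0) - 2 * m) ltac:(lra)) as [d Hd]. assert (d0 := cond_pos d).
  set (s := Rmin (d / 2) 1). assert (Hs : 0 < s <= 1 /\ s < d).
  { unfold s. split; [split; [apply Rmin_glb_lt; lra|apply Rmin_r]|]. eapply Rle_lt_trans; [apply Rmin_l|lra]. }
  specialize (Hd s ltac:(lra) ltac:(rewrite Rabs_pos_eq; lra)). rewrite Rplus_0_l, A0, Rminus_0_r in Hd.
  specialize (Bb s ltac:(lra)).
  assert (K : Rabs (a s / s) <= 2 * m).
  { unfold Rdiv. rewrite Rabs_mult, Rabs_inv, (Rabs_pos_eq s) by lra. apply Rmult_le_reg_r with s. lra.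
    rewrite Rmult_assoc, Rinv_l by lra. lra. }
  rewrite Rabs_minus_sym in Hd.
  assert (T := Rabs_triang (a1 0 - a s / s) (a s / s)). replace (a1 0 - a s / s + a s / s) with (a1 0) in T by ring. lra. }
unfold a1 in G. rewrite first_mode_at_zero, Rabs_mult, (Rabs_pos_eq PI) in G by lra.
apply Rmult_le_reg_l with PI; auto. unfold m in G. lra.
Qed.

(* [(u, v)] joins the two centres. *)
Lemma polar_compare r p rho q u v D : 0 <= r -> 0 <= rho -> Rabs u + Rabs v <= D ->
  rho * cos q = u + r * cos p -> rho * sin q = v + r * sin p -> r - D <= rho <= r + D /\
  r * Rabs (cos p - cos q) <= 2 * D /\ r * Rabs (sin p - sin q) <= 2 * D.
Proof.
intros Hr Hrho HD E1 E2.
assert (K : forall t, Rabs (u * cos t + v * sin t) <= D).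
{ intros t. eapply Rle_trans. apply Rabs_triang. rewrite !Rabs_mult.
  assert (Rabs (cos t) <= 1) by (apply Rabs_le, COS_bound). assert (Rabs (sin t) <= 1) by (apply Rabs_le, SIN_bound).
  generalize (Rabs_pos u) (Rabs_pos v). nra. }
assert (N : forall t, cos t * cos t + sin t * sin t = 1) by (intros t; generalize (sin2_cos2 t); unfold Rsqr; lra).
assert (CB := COS_bound (q - p)). rewrite cos_minus in CB.
assert (F1 : rho * (cos q * cos p + sin q * sin p) = (u * cos p + v * sin p) + r).
{ transitivity ((rho * cos q) * cos p + (rho * sin q) * sin p). ring. rewrite E1, E2.
  transitivity (u * cos p + v * sin p + r * (cos p * cos p + sin p * sin p)). ring. rewrite N; ring. }
assert (F2 : rho = (u * cos q + v * sin q) + r * (cos q * cos p + sin q * sin p)).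
{ transitivity (rho * (cos q * cos q + sin q * sin q)). rewrite N; ring.
  transitivity ((rho * cos q) * cos q + (rho * sin q) * sin q). ring. rewrite E1, E2. ring. }
assert (K1 := K p). assert (K2 := K q). apply Rabs_le_between in K1. apply Rabs_le_between in K2.
assert (R1 : r - D <= rho) by nra. assert (R2 : rho <= r + D) by nra.
split; [split; auto|].
assert (AB : Rabs (rho - r) <= D) by (apply Rabs_le; lra).
assert (Hu : Rabs u + Rabs (rho - r) <= 2 * D) by (generalize (Rabs_pos v); lra).
assert (Hv : Rabs v + Rabs (rho - r) <= 2 * D) by (generalize (Rabs_pos u); lra).
assert (CQ : Rabs (cos q) <= 1) by (apply Rabs_le, COS_bound). assert (SQ : Rabs (sin q) <= 1) by (apply Rabs_le, SIN_bound).
split; rewrite <- (Rabs_pos_eq r) at 1 by auto; rewrite <- Rabs_mult.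
- replace (r * (cos p - cos q)) with ((rho - r) * cos q + - u) by lra.
  eapply Rle_trans. apply Rabs_triang. rewrite Rabs_Ropp, Rabs_mult. generalize (Rabs_pos (rho - r)). nra.
- replace (r * (sin p - sin q)) with ((rho - r) * sin q + - v) by lra.
  eapply Rle_trans. apply Rabs_triang. rewrite Rabs_Ropp, Rabs_mult. generalize (Rabs_pos (rho - r)). nra.
Qed.

(** Moving the centre turns the radial direction by an angle of order [1 / r]. The gradient is of
    order [1 / sqrt r], by [rad_sup_bound] and the interior gradient estimate, so after
    multiplication by [sqrt r] the change is still of order [1 / r]. *)
Lemma rad_translate V c Rm c' f fx fy h hx hy : open V -> exterior_in V c Rm -> 0 <= Rm ->
  helm 1 V f fx fy -> helm 1 V h hx hy -> rad c f fx fy h hx hy -> rad c' f fx fy h hx hy.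
Proof.
intros HV HE HR Hf Hh HRad eps Heps.
destruct (rad_sup_bound V c Rm f fx fy h hx hy HV HE HR Hf Hh HRad) as [B [R1 [HB [HR1 [HRm Hsup]]]]].
set (u := fst c' - fst c). set (v := snd c' - snd c). set (D := Rabs u + Rabs v).
assert (HD : 0 <= D) by (unfold D; generalize (Rabs_pos u) (Rabs_pos v); lra).
destruct (HRad (eps / 4) ltac:(lra)) as [M HM].
(* The summands [2] and [4 D] keep the disc of radius 2 about the point beyond [R1] and the old
   radius above [r / 4]; [64 D B / eps] makes the error [32 D B / r] smaller than [eps / 2]. *)
exists (Rmax (Rabs M + D) (R1 + 2 + 4 * D + 64 * D * B / eps + 4)).
intros r p Hr x y.
assert (Hr1 : Rabs M + D < r) by (eapply Rle_lt_trans; [apply Rmax_l|eauto]).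
assert (Hr2 : R1 + 2 + 4 * D + 64 * D * B / eps + 4 < r) by (eapply Rle_lt_trans; [apply Rmax_r|eauto]).
assert (HDB : 0 <= 64 * D * B / eps).
{ apply Rmult_le_pos. repeat apply Rmult_le_pos; lra. left; apply Rinv_0_lt_compat; lra. }
destruct (polar_exists (u + r * cos p) (v + r * sin p)) as [q [E1 E2]].
set (rho := sqrt ((u + r * cos p) ^ 2 + (v + r * sin p) ^ 2)) in *.
destruct (polar_compare r p rho q u v D ltac:(lra) (sqrt_pos _) ltac:(unfold D; lra) ltac:(lra) ltac:(lra)) as [[L1 L2] [L3 L4]].
assert (Ex : x = fst c + rho * cos q) by (unfold x; rewrite <- E1; unfold u; ring).
assert (Ey : y = snd c + rho * sin q) by (unfold y; rewrite <- E2; unfold v; ring).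
assert (Sr : 0 < sqrt r) by (apply sqrt_lt_R0; lra).
assert (Srr : sqrt r * sqrt r = r) by (apply sqrt_sqrt; lra).
assert (S4 : forall t, r / 4 <= t -> sqrt r <= 2 * sqrt t).
{ intros t Ht. replace (2 * sqrt t) with (sqrt (4 * t)). apply sqrt_le_1; lra.
  rewrite sqrt_mult by lra. replace 4 with (2 * 2) by ring. rewrite sqrt_square; lra. }
assert (Near : forall s t, 0 <= s -> exists rho' q', rho - s <= rho' /\ x + s * cos t = fst c + rho' * cos q' /\ y + s * sin t = snd c + rho' * sin q').
{ intros s t Hs. destruct (polar_exists (rho * cos q + s * cos t) (rho * sin q + s * sin t)) as [q' [E1' E2']].
  set (rho' := sqrt ((rho * cos q + s * cos t) ^ 2 + (rho * sin q + s * sin t) ^ 2)) in *.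
  exists rho', q'. split; [|split; [rewrite Ex; lra|rewrite Ey; lra]].
  assert (Q : rho = rho' * (cos q' * cos q + sin q' * sin q) - s * (cos t * cos q + sin t * sin q)).
  { transitivity ((rho' * cos q' - s * cos t) * cos q + (rho' * sin q' - s * sin t) * sin q); [|ring].
    rewrite <- E1', <- E2'. generalize (sin2_cos2 q). unfold Rsqr. intros T.
    transitivity (rho * (sin q * sin q + cos q * cos q)). rewrite T; ring. ring. }
  assert (B1 := COS_bound (q' - q)). assert (B2 := COS_bound (t - q)). rewrite cos_minus in B1, B2.
  assert (0 <= rho') by apply sqrt_pos. nra. }
assert (Ann : annulus_in V (x, y) (-2) 2).
{ intros s t Hs. simpl.
  assert (G : forall s t, 0 <= s < 2 -> V (x + s * cos t, y + s * sin t)).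
  { intros s' t' Hs'. destruct (Near s' t' ltac:(lra)) as [rho' [q' [G1 [G2 G3]]]]. rewrite G2, G3. apply HE. lra. }
  destruct (Rle_dec 0 s). apply G; lra.
  replace (s * cos t) with (- s * cos (t + PI)) by (rewrite neg_cos; ring).
  replace (s * sin t) with (- s * sin (t + PI)) by (rewrite neg_sin; ring). apply G; lra. }
assert (Gb : forall g gx gy, helm 1 V g gx gy -> (forall p r, R1 <= r -> sqrt r * Rabs (g (fst c + r * cos p) (snd c + r * sin p)) <= B) ->
  sqrt r * Rabs (gx x y) <= 8 * B /\ sqrt r * Rabs (gy x y) <= 8 * B).
{ intros g gx gy Hg Hs.
  assert (Z : forall s t, 0 <= s <= 1 -> Rabs (g (x + s * cos t) (y + s * sin t)) <= 2 * B / sqrt r).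
  { intros s t Hst. destruct (Near s t ltac:(lra)) as [rho' [q' [G1 [G2 G3]]]]. rewrite G2, G3.
    specialize (Hs q' rho' ltac:(lra)). specialize (S4 rho' ltac:(lra)).
    apply Rmult_le_reg_r with (sqrt r); auto. unfold Rdiv. rewrite (Rmult_assoc (2 * B)), Rinv_l by lra.
    set (G := Rabs (g _ _)) in *. assert (0 <= G) by apply Rabs_pos. nra. }
  assert (X := gradient_bound V g gx gy (x, y) (2 * B / sqrt r) 0 HV Hg Ann Z).
  assert (Y := gradient_bound V g gx gy (x, y) (2 * B / sqrt r) (PI / 2) HV Hg Ann Z).
  simpl in X, Y. rewrite cos_0, sin_0, Rmult_1_l, Rmult_0_l, Rplus_0_r in X. rewrite cos_PI2, sin_PI2, Rmult_1_l, Rmult_0_l, Rplus_0_l in Y.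
  assert (E8 : sqrt r * (4 * (2 * B / sqrt r)) = 8 * B) by (field; lra).
  rewrite <- E8. split; apply Rmult_le_compat_l; lra. }
assert (Fin : forall g gx gy s, helm 1 V g gx gy -> (forall p r, R1 <= r -> sqrt r * Rabs (g (fst c + r * cos p) (snd c + r * sin p)) <= B) ->
  sqrt rho * Rabs (cos q * gx x y + sin q * gy x y + s) < eps / 4 ->
  sqrt r * Rabs (cos p * gx x y + sin p * gy x y + s) < eps).
{ intros g gx gy s Hg Hs Hl. destruct (Gb g gx gy Hg Hs) as [G1 G2].
  set (X := gx x y) in *. set (Y := gy x y) in *.
  replace (cos p * X + sin p * Y + s) with ((cos q * X + sin q * Y + s) + ((cos p - cos q) * X + (sin p - sin q) * Y)) by ring.
  assert (T1 : sqrt r * Rabs (cos q * X + sin q * Y + s) < eps / 2).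
  { specialize (S4 rho ltac:(lra)). set (G := Rabs _) in *. assert (0 <= G) by apply Rabs_pos. nra. }
  assert (T2 : sqrt r * Rabs ((cos p - cos q) * X + (sin p - sin q) * Y) <= 32 * D * B / r).
  { apply Rmult_le_reg_r with r. lra. replace (32 * D * B / r * r) with (2 * D * (8 * B) + 2 * D * (8 * B)) by (field; lra).
    apply Rle_trans with ((r * Rabs (cos p - cos q)) * (sqrt r * Rabs X) + (r * Rabs (sin p - sin q)) * (sqrt r * Rabs Y)).
    - replace (r * Rabs (cos p - cos q) * (sqrt r * Rabs X) + r * Rabs (sin p - sin q) * (sqrt r * Rabs Y)) with
        (sqrt r * r * (Rabs (cos p - cos q) * Rabs X + Rabs (sin p - sin q) * Rabs Y)) by ring.
      replace (sqrt r * Rabs ((cos p - cos q) * X + (sin p - sin q) * Y) * r) with (sqrt r * r * Rabs ((cos p - cos q) * X + (sin p - sin q) * Y)) by ring.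
      apply Rmult_le_compat_l. apply Rmult_le_pos; lra. rewrite <- !Rabs_mult. apply Rabs_triang.
    - apply Rplus_le_compat; apply Rmult_le_compat; auto; apply Rmult_le_pos; try apply Rabs_pos; lra. }
  assert (T3 : 32 * D * B / r < eps / 2).
  { apply Rmult_lt_reg_r with r. lra. replace (32 * D * B / r * r) with (32 * D * B) by (field; lra).
    assert (Q : 64 * D * B / eps < r) by lra. apply Rmult_lt_compat_r with (r := eps) in Q; auto.
    replace (64 * D * B / eps * eps) with (64 * D * B) in Q by (field; lra). lra. }
  eapply Rle_lt_trans. apply Rmult_le_compat_l. lra. apply Rabs_triang. lra. }
assert (Mrho : M < rho) by (generalize (Rle_abs M); lra).
destruct (HM rho q Mrho) as [N1 N2]. cbv zeta in N1, N2. rewrite <- Ex, <- Ey in N1, N2.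
split.
- apply (Fin f); auto. intros; apply Hsup; auto.
- apply (Fin h hx hy (- f x y)); auto. intros; apply Hsup; auto.
Qed.

(** The flux of each mode is the same at all radii. Near the centre it equals [r] times a bounded
    expression, so it is 0; then the amplitude is 0 and the mode vanishes. *)
Lemma entire_zero f fx fy h hx hy c : helm 1 (fun _ => True) f fx fy -> helm 1 (fun _ => True) h hx hy ->
  rad c f fx fy h hx hy -> forall r p, 0 < r ->
  f (fst c + r * cos p) (snd c + r * sin p) = 0 /\ h (fst c + r * cos p) (snd c + r * sin p) = 0.
Proof.
intros Hf Hh HRad r p Hr.
set (V := fun _ : plane => True) in *.
assert (HV : open V) by (apply open_true).
assert (HE : exterior_in V c 0) by (intros s t Hs; exact I).
assert (HA : annulus_in V c (-2) 2) by (intros s t Hs; exact I).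
assert (Zero : forall n, scoef f c p n r = 0 /\ scoef h c p n r = 0).
{ intros n.
  assert (Wf := wsol_coef V c 0 p n f fx fy HV HE (Rle_refl 0) Hf). assert (Wh := wsol_coef V c 0 p n h hx hy HV HE (Rle_refl 0) Hh).
  assert (Og := outgoing_coef V c 0 p n f fx fy h hx hy HV HE (Rle_refl 0) Hf Hh HRad).
  destruct (asy_exists n 0 _ _ (Rle_refl 0) Wf) as [a [b Af]]. assert (Ah := outgoing_asy _ _ _ _ a b Og Af).
  set (A1 := coef f c p n). set (A2 := coef1 fx fy c p n). set (B1 := coef h c p n). set (B2 := coef1 hx hy c p n).
  assert (Ct : forall t, 0 <= t <= 1 -> continuous (fun t => A1 t * B2 t - B1 t * A2 t) t).
  { intros t Ht.
    destruct Hf as [Hf1 [gxx [gxy [gyx [gyy [Hx [Hy _]]]]]]]. destruct Hh as [Hh1 [kxx [kxy [kyx [kyy [Kx [Ky _]]]]]]].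
    assert (C1 : continuous A1 t) by (eapply is_derive_cont; apply (coef_derive V c (-2) 2 p HV HA f fx fy n t Hf1); lra).
    assert (C2 : continuous B1 t) by (eapply is_derive_cont; apply (coef_derive V c (-2) 2 p HV HA h hx hy n t Hh1); lra).
    assert (C3 : continuous A2 t) by (eapply is_derive_cont; apply (coef1_derive V c (-2) 2 p HV HA fx fy _ _ _ _ n t Hx Hy); lra).
    assert (C4 : continuous B2 t) by (eapply is_derive_cont; apply (coef1_derive V c (-2) 2 p HV HA hx hy _ _ _ _ n t Kx Ky); lra).
    cts; auto. }
  destruct (continuous_bounded _ 0 1 Ct) as [K [HK HKb]].
  assert (Fl : forall t, 0 < t <= 1 -> a ^ 2 + b ^ 2 <= t * K).
  { intros t Ht. assert (F := flux_value n 0 _ _ _ _ a b t Wf Wh Af Ah ltac:(lra)). rewrite <- F.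
    unfold scoef, scoef1. fold A1 A2 B1 B2.
    assert (S0 : 0 < sqrt t) by (apply sqrt_lt_R0; lra). assert (SS : sqrt t * sqrt t = t) by (apply sqrt_sqrt; lra).
    replace (sqrt t * A1 t * (sqrt t * B2 t + B1 t / (2 * sqrt t)) - sqrt t * B1 t * (sqrt t * A2 t + A1 t / (2 * sqrt t)))
      with ((sqrt t * sqrt t) * (A1 t * B2 t - B1 t * A2 t)) by (field; lra).
    rewrite SS. apply Rmult_le_compat_l. lra. eapply Rle_trans. apply Rle_abs. apply HKb; lra. }
  assert (Z : a ^ 2 + b ^ 2 = 0).
  { assert (P0 : 0 <= a ^ 2 + b ^ 2) by (generalize (pow2_ge_0 a) (pow2_ge_0 b); lra).
    apply Rle_antisym; auto. apply Rnot_lt_le. intros L. set (P := a ^ 2 + b ^ 2) in *.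
    set (t := Rmin 1 (P / (2 * K))).
    assert (Ht : 0 < t <= 1). { unfold t. split. apply Rmin_glb_lt. lra. apply Rdiv_lt_0_compat; lra. apply Rmin_l. }
    specialize (Fl t Ht). assert (t * K <= P / (2 * K) * K). { apply Rmult_le_compat_r. lra. apply Rmin_r. }
    replace (P / (2 * K) * K) with (P / 2) in H by (field; lra). lra. }
  apply sq_sum_zero in Z. destruct Z as [-> ->]. rewrite Ropp_0 in Ah.
  split.
  - apply (asy_zero n 0 _ (scoef1 f fx fy c p n) r (Rle_refl 0) Wf Af Hr).
  - apply (asy_zero n 0 _ (scoef1 h hx hy c p n) r (Rle_refl 0) Wh Ah Hr). }
assert (Sr : 0 < sqrt r) by (apply sqrt_lt_R0; lra). assert (HP := PI_RGT_0).
assert (Gen : forall g gx gy, helm 1 V g gx gy -> (forall n, scoef g c p n r = 0) -> g (fst c + r * cos p) (snd c + r * sin p) = 0).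
{ intros g gx gy Hg Hz. assert (S := ray_series V c 0 p r g gx gy HV HE Hr Hg).
  apply is_series_zero in S. 2: intros n; rewrite Hz; ring.
  apply Rmult_integral in S. destruct S as [S|S]; [lra|]. apply Rmult_integral in S. destruct S; lra. }
split. exact (Gen f fx fy Hf (fun n => proj1 (Zero n))). exact (Gen h hx hy Hh (fun n => proj2 (Zero n))).
Qed.

(** * Uniqueness in a half-plane *)

Lemma C1on_lin V f fx fy h hx hy al be : C1on V f fx fy -> C1on V h hx hy ->
  C1on V (fun x y => al * f x y + be * h x y) (fun x y => al * fx x y + be * hx x y) (fun x y => al * fy x y + be * hy x y).
Proof.
intros Hf Hh x y Hxy. destruct (Hf x y Hxy) as [F1 [F2 [F3 F4]]]. destruct (Hh x y Hxy) as [H1 [H2 [H3 H4]]].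
split; [|split; [|split]].
- apply is_derive_Rplus; apply is_derive_Rscal; auto.
- apply is_derive_Rplus; apply is_derive_Rscal; auto.
- unfold cont2 in *. cts; auto.
- unfold cont2 in *. cts; auto.
Qed.

Lemma helm_lin k V f fx fy h hx hy al be : helm k V f fx fy -> helm k V h hx hy ->
  helm k V (fun x y => al * f x y + be * h x y) (fun x y => al * fx x y + be * hx x y) (fun x y => al * fy x y + be * hy x y).
Proof.
intros [Hf [fxx [fxy [fyx [fyy [Fx [Fy FE]]]]]]] [Hh [hxx [hxy [hyx [hyy [Hx [Hy HE]]]]]]].
split. apply C1on_lin; auto.
exists (fun x y => al * fxx x y + be * hxx x y), (fun x y => al * fxy x y + be * hxy x y),
  (fun x y => al * fyx x y + be * hyx x y), (fun x y => al * fyy x y + be * hyy x y).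
split. apply C1on_lin; auto. split. apply C1on_lin; auto.
intros x y Hxy. specialize (FE x y Hxy). specialize (HE x y Hxy).
transitivity (al * (fxx x y + fyy x y + k ^ 2 * f x y) + be * (hxx x y + hyy x y + k ^ 2 * h x y)). ring.
rewrite FE, HE. ring.
Qed.

Lemma helm_sub k V W f fx fy : (forall x, W x -> V x) -> helm k V f fx fy -> helm k W f fx fy.
Proof.
intros HW [H [fxx [fxy [fyx [fyy [Fx [Fy FE]]]]]]].
split. intros x y Hxy; auto. exists fxx, fxy, fyx, fyy.
split; [|split]; intros x y Hxy; auto.
Qed.

Lemma rad_lin c f fx fy h hx hy f' fx' fy' h' hx' hy' al be : rad c f fx fy h hx hy -> rad c f' fx' fy' h' hx' hy' ->
  rad c (fun x y => al * f x y + be * f' x y) (fun x y => al * fx x y + be * fx' x y) (fun x y => al * fy x y + be * fy' x y)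
        (fun x y => al * h x y + be * h' x y) (fun x y => al * hx x y + be * hx' x y) (fun x y => al * hy x y + be * hy' x y).
Proof.
intros H1 H2 e He.
set (K := Rabs al + Rabs be + 1). assert (A0 := Rabs_pos al). assert (B0 := Rabs_pos be).
assert (HK : 0 < e / K) by (apply Rdiv_lt_0_compat; unfold K; lra).
destruct (H1 (e / K) HK) as [M1 K1]. destruct (H2 (e / K) HK) as [M2 K2].
exists (Rmax M1 M2). intros r p Hr x y.
destruct (K1 r p) as [P1 P2]. eapply Rle_lt_trans; [apply Rmax_l|eauto].
destruct (K2 r p) as [Q1 Q2]. eapply Rle_lt_trans; [apply Rmax_r|eauto].
fold x y in P1, P2, Q1, Q2. cbv zeta in P1, P2, Q1, Q2. fold x y in P1, P2, Q1, Q2.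
assert (Gen : forall s t, sqrt r * Rabs s < e / K -> sqrt r * Rabs t < e / K -> sqrt r * Rabs (al * s + be * t) < e).
{ intros s t Hs Ht. assert (S0 := sqrt_pos r).
  apply Rle_lt_trans with (Rabs al * (sqrt r * Rabs s) + Rabs be * (sqrt r * Rabs t)).
  - replace (Rabs al * (sqrt r * Rabs s) + Rabs be * (sqrt r * Rabs t)) with (sqrt r * (Rabs (al * s) + Rabs (be * t))) by (rewrite !Rabs_mult; ring).
    apply Rmult_le_compat_l; auto. apply Rabs_triang.
  - apply Rle_lt_trans with (Rabs al * (e / K) + Rabs be * (e / K)). apply Rplus_le_compat; apply Rmult_le_compat_l; lra.
    replace e with (K * (e / K)) at 3 by (field; unfold K; lra). unfold K at 3. lra. }
split.
- specialize (Gen _ _ P1 Q1). eapply Rle_lt_trans. 2: apply Gen. right. f_equal. f_equal. ring.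
- specialize (Gen _ _ P2 Q2). eapply Rle_lt_trans. 2: apply Gen. right. f_equal. f_equal. ring.
Qed.

(** * Similarities of the plane *)

Section Affine.
Variables (p q a b c d : R).

Definition pull (g : R -> R -> R) (X Y : R) : R := g (p + a * X + b * Y) (q + c * X + d * Y).
Definition pull_set (V : plane -> Prop) (z : plane) : Prop :=
  V (p + a * fst z + b * snd z, q + c * fst z + d * snd z).

Lemma pull_cont V g : (forall x y, V (x, y) -> cont2 g x y) -> forall x y, pull_set V (x, y) -> cont2 (pull g) x y.
Proof.
intros Hg x y Hxy. unfold cont2, pull.
apply (cont2_comp g (fun z : plane => p + a * fst z + b * snd z) (fun z : plane => q + c * fst z + d * snd z) (x, y)).
- apply Hg. exact Hxy.
- cts.
- cts.
Qed.

Lemma pull_open V : open V -> open (pull_set V).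
Proof.
intros HV [x y] Hxy.
assert (C : continuous (fun z : plane => (p + a * fst z + b * snd z, q + c * fst z + d * snd z) : plane) (x, y)).
{ apply continuous_pair; cts. }
apply (C V). apply HV. exact Hxy.
Qed.

Lemma pull_C1 V g gx gy : open V -> C1on V g gx gy ->
  C1on (pull_set V) (pull g) (fun x y => a * pull gx x y + c * pull gy x y) (fun x y => b * pull gx x y + d * pull gy x y).
Proof.
intros HV Hg x y Hxy.
assert (K1 := pull_cont V gx (fun x y h => proj1 (proj2 (proj2 (Hg x y h)))) x y Hxy).
assert (K2 := pull_cont V gy (fun x y h => proj2 (proj2 (proj2 (Hg x y h)))) x y Hxy).
split; [|split; [|split]].
- apply (C1on_chain V g gx gy (fun s => p + a * s + b * y) (fun s => q + c * s + d * y)); auto; auto_derive; auto; ring.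
- apply (C1on_chain V g gx gy (fun s => p + a * x + b * s) (fun s => q + c * x + d * s)); auto; auto_derive; auto; ring.
- unfold cont2 in *. cts; auto.
- unfold cont2 in *. cts; auto.
Qed.

(** The three conditions say that the linear part is [lam] times an orthogonal matrix; such a map
    multiplies the Laplacian by [lam^2]. *)
Lemma pull_helm k lam V g gx gy : open V -> a ^ 2 + b ^ 2 = lam ^ 2 -> c ^ 2 + d ^ 2 = lam ^ 2 -> a * c + b * d = 0 ->
  helm k V g gx gy ->
  helm (lam * k) (pull_set V) (pull g) (fun x y => a * pull gx x y + c * pull gy x y) (fun x y => b * pull gx x y + d * pull gy x y).
Proof.
intros HV E1 E2 E3 [H [gxx [gxy [gyx [gyy [Hx [Hy HE]]]]]]].
split. apply pull_C1; auto.
assert (Px := pull_C1 V gx gxx gxy HV Hx). assert (Py := pull_C1 V gy gyx gyy HV Hy).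
eexists _, _, _, _. split; [|split].
- apply (C1on_lin _ _ _ _ _ _ _ a c Px Py).
- apply (C1on_lin _ _ _ _ _ _ _ b d Px Py).
- intros x y Hxy. specialize (HE _ _ Hxy). unfold pull. simpl in HE.
  set (X := p + a * x + b * y) in *. set (Y := q + c * x + d * y) in *.
  transitivity ((a ^ 2 + b ^ 2) * gxx X Y + (a * c + b * d) * (gxy X Y + gyx X Y) + (c ^ 2 + d ^ 2) * gyy X Y + lam ^ 2 * (k ^ 2 * g X Y)). ring.
  rewrite E1, E2, E3. transitivity (lam ^ 2 * (gxx X Y + gyy X Y + k * (k * 1) * g X Y)). ring. rewrite HE. ring.
Qed.
End Affine.

(** By periodicity a nonzero value would recur at arbitrarily large arguments. *)
Lemma osc_tends_zero x y be c0 : 0 < be -> tends (fun r => osc x y (be * r - c0)) 0 -> x = 0 /\ y = 0.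
Proof.
intros Hbe H. assert (HP := PI_RGT_0).
assert (Gen : forall t, osc x y t = 0).
{ intros t. apply NNPP. intros N. assert (P := Rabs_pos_lt _ N).
  destruct (H _ P) as [M HM].
  destruct (INR_unbounded (Rabs (be * M - c0 - t))) as [n Hn].
  set (r := (t + 2 * INR n * PI + c0) / be).
  assert (E : be * r - c0 = t + 2 * INR n * PI) by (unfold r; field; lra).
  assert (Hr : M < r).
  { apply Rmult_lt_reg_l with be; auto. assert (be * M - c0 - t < INR n) by (generalize (Rle_abs (be * M - c0 - t)); lra).
    assert (INR n <= 2 * INR n * PI). { generalize PI2_1 (pos_INR n). nra. } lra. }
  specialize (HM r Hr). rewrite E in HM. unfold osc in *. rewrite cos_period, sin_period, Rminus_0_r in HM. lra. }
split.
- specialize (Gen 0). unfold osc in Gen. rewrite cos_0, sin_0 in Gen. lra.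
- specialize (Gen (PI / 2)). unfold osc in Gen. rewrite cos_PI2, sin_PI2 in Gen. lra.
Qed.

Lemma convex_gt X0 u v t : X0 < u -> X0 < v -> 0 <= t <= 1 -> X0 < u + t * (v - u).
Proof.
intros Hu Hv Ht. destruct (Rle_dec u v).
- assert (0 <= t * (v - u)) by (apply Rmult_le_pos; lra). lra.
- assert (0 <= (1 - t) * (u - v)) by (apply Rmult_le_pos; lra). lra.
Qed.

(** Zeros on a half-line say nothing by themselves about the rest of the axis. But beyond [X0] they
    force [g] to be odd in [y], so that [g (x, y) + g (x, - y)] vanishes on an open set; this sum is
    a solution near the entire axis, and on the axis it is [2 g]. *)
Lemma helm_zero_on_axis k V g gx gy X0 : open V -> helm k V g gx gy ->
  (forall x, V (x, 0)) -> (forall x y, X0 < x -> V (x, y)) -> (forall x, X0 < x -> g x 0 = 0) ->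
  forall x, g x 0 = 0.
Proof.
intros HV Hg Hax HX H0 x.
set (W := fun z : plane => X0 < fst z).
assert (HW : open W).
{ intros [u v] Hu. apply (continuous_fst (U := R_UniformSpace) (V := R_UniformSpace) u v (fun t => X0 < t)). apply (open_gt X0); auto. }
(* Beyond [X0] the solution is odd in [y], by uniqueness of the continuation from [y > 0]. *)
assert (Odd : helm k W (odd_ext g) (odd_ext gx) (even_ext gy)).
{ apply (odd_helm V W HW); auto. }
assert (WV : forall z, W z -> V z) by (intros [u v] Hu; apply HX; auto).
assert (D1 := helm_lin k W _ _ _ _ _ _ 1 (-1) (helm_sub k V W g gx gy WV Hg) Odd).
assert (CW : connected_set W).
{ apply convex_connected. unfold W. intros [u1 v1] [u2 v2] t H1 H2 Ht. simpl in *. now apply convex_gt. }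
assert (Z1 : forall z, W z -> zero_near (fun x y => 1 * g x y + -1 * odd_ext g x y) z).
{ apply (unique_continuation k W _ _ _ W (X0 + 1, 1) HW D1 CW); auto.
  - unfold W; simpl; lra.
  - apply locally_plane. exists 1. split. lra. intros s t Hs Ht. simpl. apply Rabs_def2 in Ht.
    unfold odd_ext. destruct (Rle_dec 0 (1 + t)); lra. }
assert (Z1' : forall u v, X0 < u -> g u v + g u (- v) = 0).
{ assert (Q : forall u v, X0 < u -> v < 0 -> g u v + g u (- v) = 0).
  { intros u v Hu Hv. assert (L := locally_singleton _ _ (Z1 (u, v) Hu)). simpl in L. unfold odd_ext in L.
    destruct (Rle_dec 0 v); lra. }
  intros u v Hu. destruct (Rtotal_order v 0) as [L|[->|L]].
  - apply Q; auto.
  - rewrite Ropp_0, H0; auto. ring.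
  - specialize (Q u (- v) Hu ltac:(lra)). rewrite Ropp_involutive in Q. lra. }
assert (RS : forall u v, pull_set 0 0 1 0 0 (-1) V (u, v) <-> V (u, - v)).
{ intros u v. unfold pull_set; simpl. replace (0 + 1 * u + 0 * v) with u by ring.
  replace (0 + 0 * u + -1 * v) with (- v) by ring. tauto. }
assert (RP : forall u v, pull 0 0 1 0 0 (-1) g u v = g u (- v)) by (intros; unfold pull; f_equal; ring).
(* The symmetric part of [V], on which the reflected solution is available too. It contains the
   axis, along which the continuation runs. *)
set (V2 := fun z : plane => V z /\ pull_set 0 0 1 0 0 (-1) V z).
assert (HV2 : open V2) by (apply open_and; auto using pull_open).
assert (Rf := pull_helm 0 0 1 0 0 (-1) k 1 V g gx gy HV ltac:(ring) ltac:(ring) ltac:(ring) Hg).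
rewrite Rmult_1_l in Rf.
assert (Sm := helm_lin k V2 _ _ _ _ _ _ 1 1 (helm_sub k V V2 _ _ _ (fun z h => proj1 h) Hg)
   (helm_sub k _ V2 _ _ _ (fun z h => proj2 h) Rf)).
set (A := fun z : plane => snd z = 0).
assert (CA : connected_set A).
{ apply convex_connected. unfold A. intros [u1 v1] [u2 v2] t H1 H2 Ht. simpl in *. subst. ring. }
assert (Z2 := unique_continuation k V2 _ _ _ A (X0 + 1, 0) HV2 Sm CA).
assert (L : zero_near (fun x y => 1 * g x y + 1 * pull 0 0 1 0 0 (-1) g x y) (x, 0)).
{ apply Z2; try reflexivity.
  - intros [u v] Hu. unfold A in Hu. simpl in Hu. subst v. split. apply Hax. apply RS. rewrite Ropp_0. apply Hax.
  - apply locally_plane. exists 1. split. lra. intros s t Hs Ht. simpl. rewrite RP. apply Rabs_def2 in Hs.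
    assert (Q := Z1' (X0 + 1 + s) (0 + t) ltac:(lra)). lra. }
apply locally_singleton in L. simpl in L. rewrite RP, Ropp_0 in L. lra.
Qed.

(** About a point of the axis the reflection only changes the sign of the angle, and the radiation
    condition is uniform in the angle. *)
Lemma rad_odd f fx fy h hx hy : rad (0, 0) f fx fy h hx hy ->
  rad (0, 0) (odd_ext f) (odd_ext fx) (even_ext fy) (odd_ext h) (odd_ext hx) (even_ext hy).
Proof.
intros H e He. destruct (H e He) as [M HM]. exists (Rmax M 0). intros r p Hr. simpl.
assert (M < r) by (eapply Rle_lt_trans; [apply Rmax_l|eauto]).
assert (0 < r) by (eapply Rle_lt_trans; [apply Rmax_r|eauto]).
rewrite !Rplus_0_l.
destruct (HM r p H0) as [P1 P2]. destruct (HM r (- p) H0) as [Q1 Q2].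
cbn [fst snd] in P1, P2, Q1, Q2. rewrite ?Rplus_0_l, ?cos_neg, ?sin_neg in *.
unfold odd_ext, even_ext. destruct (Rle_dec 0 (r * sin p)) as [L|L].
- rewrite (Rabs_pos_eq (r * sin p)); auto.
- rewrite (Rabs_left (r * sin p)) by lra.
  replace (r * - sin p) with (- (r * sin p)) in * by ring.
  rewrite <- Rabs_Ropp in Q1, Q2. split.
  + eapply Rle_lt_trans. 2: apply Q1. right. f_equal. f_equal. ring.
  + eapply Rle_lt_trans. 2: apply Q2. right. f_equal. f_equal. ring.
Qed.

(* If the solution does not vanish on the ray, its leading term has wave number 1 there, and the equation
   makes the beat with the wave number [al] tend to zero. *)
Lemma ray_zero V Rm f fx fy h hx hy s t c0 al : open V -> exterior_in V (0, 0) Rm -> 0 <= Rm ->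
  helm 1 V f fx fy -> helm 1 V h hx hy -> rad (0, 0) f fx fy h hx hy -> al < 1 ->
  tends s 0 -> tends t 0 ->
  (forall x, 0 < x -> cos (c0 + al * x) * f x 0 + sin (c0 + al * x) * h x 0 = f x 0 * s x + h x 0 * t x) ->
  forall x, Rm < x -> f x 0 = 0 /\ h x 0 = 0.
Proof.
intros HV HE HR Hf Hh HRad Hal Hs Ht Hc x Hx.
assert (Ec : forall r, fst ((0, 0) : plane) + r * cos 0 = r) by (intros; simpl; rewrite cos_0; ring).
assert (Es : forall r, snd ((0, 0) : plane) + r * sin 0 = 0) by (intros; simpl; rewrite sin_0; ring).
destruct (ray_dichotomy V (0, 0) Rm f fx fy h hx hy 0 HV HE HR Hf Hh HRad) as [Z|[J [a [b [D [R1 [N [HR1 [HRm HB]]]]]]]]].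
- specialize (Z x Hx). now rewrite Ec, Es in Z.
- exfalso. apply N.
  (* Multiplication by [r^J sqrt r] makes the leading term a pure oscillation; the intensity
     equation is linear in [f] and [h] with small coefficients [s] and [t], hence keeps its form. *)
  set (F := fun r => r ^ J * (sqrt r * f r 0)). set (G := fun r => r ^ J * (sqrt r * h r 0)).
  assert (HB' : forall r, R1 <= r -> Rabs (F r - osc a b r) <= D * / sqrt r /\ Rabs (G r - osc b (- a) r) <= D * / sqrt r).
  { intros r Hr. specialize (HB r Hr). now rewrite Ec, Es in HB. }
  assert (Tsq : tends (fun r => D * / sqrt r) 0).
  { apply (tends_eq _ (D * 0)); [|ring]. apply tends_scal. intros e He. exists ((/ e) ^ 2). intros r Hr.
    assert (I : 0 < / e) by (apply Rinv_0_lt_compat; auto).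
    assert (Q : / e < sqrt r).
    { rewrite <- (sqrt_pow2 (/ e)) by lra. apply sqrt_lt_1; try lra. apply pow2_ge_0. generalize (pow2_ge_0 (/ e)); lra. }
    rewrite Rminus_0_r, Rabs_pos_eq by (left; apply Rinv_0_lt_compat; lra).
    rewrite <- (Rinv_inv e). apply Rinv_lt_contravar; auto. apply Rmult_lt_0_compat; lra. }
  assert (TF : tends (fun r => F r - osc a b r) 0).
  { apply (tends_dominated _ _ Tsq). exists R1. intros r Hr. apply HB'; lra. }
  assert (TG : tends (fun r => G r - osc b (- a) r) 0).
  { apply (tends_dominated _ _ Tsq). exists R1. intros r Hr. apply HB'; lra. }
  destruct (tends_bounded _ _ TF) as [M1 K1]. destruct (tends_bounded _ _ TG) as [M2 K2].
  set (B := Rabs a + Rabs b + 1).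
  assert (BF : forall r, Rmax M1 M2 < r -> Rabs (F r) <= B).
  { intros r Hr. specialize (K1 r ltac:(eapply Rle_lt_trans; [apply Rmax_l|eauto])). rewrite Rabs_R0 in K1.
    replace (F r) with (osc a b r + (F r - osc a b r)) by ring. eapply Rle_trans. apply Rabs_triang. generalize (osc_le a b r). unfold B; lra. }
  assert (BG : forall r, Rmax M1 M2 < r -> Rabs (G r) <= B).
  { intros r Hr. specialize (K2 r ltac:(eapply Rle_lt_trans; [apply Rmax_r|eauto])). rewrite Rabs_R0 in K2.
    replace (G r) with (osc b (- a) r + (G r - osc b (- a) r)) by ring. eapply Rle_trans. apply Rabs_triang.
    generalize (osc_le b (- a) r). rewrite Rabs_Ropp. unfold B; lra. }
  assert (T1 : tends (fun r => cos (c0 + al * r) * F r + sin (c0 + al * r) * G r) 0).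
  { apply (tends_ext (fun r => s r * F r + t r * G r) _ _ 0).
    - intros r Hr. unfold F, G. specialize (Hc r Hr).
      transitivity (r ^ J * sqrt r * (f r 0 * s r + h r 0 * t r)). ring. rewrite <- Hc. ring.
    - apply (tends_eq _ (0 + 0)); [|ring]. apply tends_plus; eapply tends_mult_bounded; eauto. }
  (* The product with the conjugate plane wave oscillates with the difference [1 - al] of the wave
     numbers; this is where [al < 1] enters. *)
  assert (T2 : tends (fun r => osc a b ((1 - al) * r - c0)) 0).
  { apply (tends_ext (fun r => (cos (c0 + al * r) * F r + sin (c0 + al * r) * G r) -
       ((F r - osc a b r) * cos (c0 + al * r) + (G r - osc b (- a) r) * sin (c0 + al * r))) _ _ 0).
    - intros r _. transitivity (osc a b r * cos (c0 + al * r) + osc b (- a) r * sin (c0 + al * r)). ring.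
      replace ((1 - al) * r - c0) with (r - (c0 + al * r)) by ring. unfold osc. rewrite cos_minus, sin_minus. ring.
    - apply (tends_eq _ (0 - (0 + 0))); [|ring]. apply tends_minus; auto.
      apply tends_plus; apply (tends_mult_bounded _ _ 1 0); auto; intros; apply Rabs_le. apply COS_bound. apply SIN_bound. }
  destruct (osc_tends_zero a b (1 - al) c0 ltac:(lra) T2) as [-> ->]. reflexivity.
Qed.

Lemma rad_tends_zero V Rm f fx fy h hx hy : open V -> exterior_in V (0, 0) Rm -> 0 <= Rm ->
  helm 1 V f fx fy -> helm 1 V h hx hy -> rad (0, 0) f fx fy h hx hy ->
  tends (fun x => f x 0) 0 /\ tends (fun x => h x 0) 0.
Proof.
intros HV HE HR Hf Hh HRad.
destruct (rad_sup_bound V (0, 0) Rm f fx fy h hx hy HV HE HR Hf Hh HRad) as [B [R1 [HB [HR1 [HRm Hs]]]]].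
assert (Gen : forall g : R -> R -> R, (forall r, R1 <= r -> sqrt r * Rabs (g r 0) <= B) -> tends (fun x => g x 0) 0).
{ intros g Hg e He. exists (Rmax R1 ((B / e) ^ 2 + 1)). intros r Hr.
  assert (L1 : R1 < r) by (eapply Rle_lt_trans; [apply Rmax_l|eauto]).
  assert (L2 : (B / e) ^ 2 + 1 < r) by (eapply Rle_lt_trans; [apply Rmax_r|eauto]).
  specialize (Hg r ltac:(lra)). rewrite Rminus_0_r.
  assert (P : 0 <= B / e) by (apply Rmult_le_pos; auto; left; apply Rinv_0_lt_compat; auto).
  assert (Q : B / e < sqrt r).
  { rewrite <- (sqrt_pow2 (B / e)) by auto. apply sqrt_lt_1; try lra. apply pow2_ge_0. }
  apply Rmult_lt_compat_r with (r := e) in Q; auto. replace (B / e * e) with B in Q by (field; lra).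
  assert (Sr : 0 < sqrt r) by (apply sqrt_lt_R0; lra). apply Rmult_lt_reg_l with (sqrt r); lra. }
split; apply Gen; intros r Hr; destruct (Hs 0 r Hr) as [P1 P2]; simpl in P1, P2;
rewrite cos_0, sin_0, Rmult_0_r, Rmult_1_r, !Rplus_0_l in P1, P2; auto.
Qed.

(** The uniqueness argument in rescaled coordinates. The radiation condition is given about the
    image [c] of the original origin and is first moved to a point of the axis: only then is the
    half-axis a ray, and only then is the condition stable under reflection. *)
Lemma half_plane_uniqueness V c Rm f1 f1x f1y h1 h1x h1y f2 f2x f2y h2 h2x h2y c0 al :
  open V -> (forall x y, 0 <= y -> V (x, y)) -> exterior_in V c Rm -> 0 <= Rm ->
  helm 1 V f1 f1x f1y -> helm 1 V h1 h1x h1y -> rad c f1 f1x f1y h1 h1x h1y ->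
  helm 1 V f2 f2x f2y -> helm 1 V h2 h2x h2y -> rad c f2 f2x f2y h2 h2x h2y -> al < 1 ->
  (forall x, (cos (c0 + al * x) + f1 x 0) ^ 2 + (sin (c0 + al * x) + h1 x 0) ^ 2 =
             (cos (c0 + al * x) + f2 x 0) ^ 2 + (sin (c0 + al * x) + h2 x 0) ^ 2) ->
  forall x y, 0 < y -> f1 x y = f2 x y /\ h1 x y = h2 x y.
Proof.
intros HV HU HE HR F1 H1 R1 F2 H2 R2 Hal Hint.
assert (R1' := rad_translate V c Rm (0, 0) _ _ _ _ _ _ HV HE HR F1 H1 R1).
assert (R2' := rad_translate V c Rm (0, 0) _ _ _ _ _ _ HV HE HR F2 H2 R2).
set (R0 := Rm + (Rabs (fst c) + Rabs (snd c))).
assert (HR0 : 0 <= R0) by (unfold R0; generalize (Rabs_pos (fst c)) (Rabs_pos (snd c)); lra).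
assert (Far : forall a b, R0 < sqrt (a ^ 2 + b ^ 2) -> V (a, b)).
{ intros a b Hab. destruct (polar_exists a b) as [q [E1 E2]].
  destruct (polar_exists (a - fst c) (b - snd c)) as [p [E3 E4]].
  set (rho := sqrt ((a - fst c) ^ 2 + (b - snd c) ^ 2)) in *. set (r := sqrt (a ^ 2 + b ^ 2)) in *.
  destruct (polar_compare r q rho p (- fst c) (- snd c) (Rabs (fst c) + Rabs (snd c)) (sqrt_pos _) (sqrt_pos _)) as [[L _] _].
  rewrite !Rabs_Ropp; lra. lra. lra.
  replace (a, b) with (fst c + rho * cos p, snd c + rho * sin p) by (f_equal; lra). apply HE. unfold R0 in Hab; lra. }
assert (HE0 : exterior_in V (0, 0) R0).
{ intros r p Hr. simpl. apply Far.
  replace ((0 + r * cos p) ^ 2 + (0 + r * sin p) ^ 2) with (r ^ 2 * (Rsqr (sin p) + Rsqr (cos p))) by (unfold Rsqr; ring).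
  rewrite sin2_cos2, Rmult_1_r, sqrt_pow2; lra. }
assert (DF := helm_lin 1 V _ _ _ _ _ _ 1 (-1) F1 F2). assert (DH := helm_lin 1 V _ _ _ _ _ _ 1 (-1) H1 H2).
assert (DR := rad_lin _ _ _ _ _ _ _ _ _ _ _ _ _ 1 (-1) R1' R2').
set (f := fun x y => 1 * f1 x y + -1 * f2 x y) in *. set (fx := fun x y => 1 * f1x x y + -1 * f2x x y) in *. set (fy := fun x y => 1 * f1y x y + -1 * f2y x y) in *.
set (h := fun x y => 1 * h1 x y + -1 * h2 x y) in *. set (hx := fun x y => 1 * h1x x y + -1 * h2x x y) in *. set (hy := fun x y => 1 * h1y x y + -1 * h2y x y) in *.
destruct (rad_tends_zero V R0 _ _ _ _ _ _ HV HE0 HR0 F1 H1 R1') as [T1 T2].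
destruct (rad_tends_zero V R0 _ _ _ _ _ _ HV HE0 HR0 F2 H2 R2') as [T3 T4].
assert (Ray : forall x, R0 < x -> f x 0 = 0 /\ h x 0 = 0).
(* The difference of the two squared moduli factors through [f = f1 - f2] and [h = h1 - h2]. What
   multiplies them besides the plane wave are half sums of the two solutions, which tend to 0. *)
{ apply (ray_zero V R0 f fx fy h hx hy (fun x => - / 2 * (f1 x 0 + f2 x 0)) (fun x => - / 2 * (h1 x 0 + h2 x 0)) c0 al); auto.
  - apply (tends_eq _ (- / 2 * (0 + 0))); [|ring]. apply tends_scal, tends_plus; auto.
  - apply (tends_eq _ (- / 2 * (0 + 0))); [|ring]. apply tends_scal, tends_plus; auto.
  - intros x _. specialize (Hint x). unfold f, h. lra. }
assert (FarX : forall x y, R0 < x -> V (x, y)).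
{ intros x y Hx. apply Far. apply Rlt_le_trans with x; auto. rewrite <- (sqrt_pow2 x) at 1 by lra. apply sqrt_le_1.
  apply pow2_ge_0. generalize (pow2_ge_0 x) (pow2_ge_0 y); lra. generalize (pow2_ge_0 y); lra. }
assert (Zf : forall x, f x 0 = 0).
{ apply (helm_zero_on_axis 1 V f fx fy R0 HV DF); auto. intros; apply HU; lra. intros x Hx; apply Ray; auto. }
assert (Zh : forall x, h x 0 = 0).
{ apply (helm_zero_on_axis 1 V h hx hy R0 HV DH); auto. intros; apply HU; lra. intros x Hx; apply Ray; auto. }
(* The odd extension only uses values on the closed upper half-plane, which lies in [V]; hence it is
   defined and a solution on the whole plane. *)
assert (OF := odd_helm V (fun _ => True) open_true (fun x y _ => HU x (Rabs y) (Rabs_pos y)) 1 f fx fy DF (fun a _ => Zf a)).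
assert (OH := odd_helm V (fun _ => True) open_true (fun x y _ => HU x (Rabs y) (Rabs_pos y)) 1 h hx hy DH (fun a _ => Zh a)).
assert (OR := rad_odd _ _ _ _ _ _ DR).
intros x y Hy.
destruct (polar_exists x y) as [p [E1 E2]].
assert (Hr : 0 < sqrt (x ^ 2 + y ^ 2)). { apply sqrt_lt_R0. assert (0 < y ^ 2) by (apply pow_lt; auto). generalize (pow2_ge_0 x); lra. }
destruct (entire_zero _ _ _ _ _ _ (0, 0) OF OH OR (sqrt (x ^ 2 + y ^ 2)) p Hr) as [Q1 Q2].
simpl fst in Q1, Q2. simpl snd in Q1, Q2. rewrite !Rplus_0_l in Q1, Q2. rewrite <- E1, <- E2 in Q1, Q2.
unfold odd_ext in Q1, Q2. destruct (Rle_dec 0 y); [|lra]. unfold f in Q1. unfold h in Q2. lra.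
Qed.

(** * Geometry of the exterior region *)

Lemma nonvanishing_sign (G : R -> R) a b s : a <= s <= b -> (forall t, continuous G t) ->
  (forall t, a <= t <= b -> G t <> 0) -> 0 < G a * G s.
Proof.
intros Hs HG HN.
assert (Na := HN a ltac:(lra)). assert (Ns := HN s ltac:(lra)).
destruct (Req_dec a s) as [<-|Nas]. { nra. }
apply Rnot_le_lt. intros L.
assert (L' : G a * G s < 0). { destruct L as [L|L]; auto. apply Rmult_integral in L. tauto. }
destruct (Rlt_dec (G a) 0) as [A0|A0].
- destruct (IVT_interv G a s) as [z [Hz Ez]]; try nra.
  intros t Ht. apply continuity_pt_filterlim, HG.
  apply (HN z); auto; lra.
- destruct (IVT_interv (fun t => - G t) a s) as [z [Hz Ez]]; try nra.
  intros t Ht. apply continuity_pt_filterlim. apply continuous_Ropp, HG.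
  apply (HN z); lra.
Qed.

Lemma piece_linear gamma a b (al be ce : R) : regular_arc gamma a b ->
  exists G : R -> R, (forall t, continuous G t) /\ forall s, a <= s <= b -> al * fst (gamma s) + be * snd (gamma s) + ce = G s.
Proof.
intros [g1 [g2 [Hd He]]]. exists (fun s => al * g1 s + be * g2 s + ce). split.
- intros t. destruct (Hd t) as [[l1 D1] [_ [[l2 D2] _]]].
  assert (continuous g1 t) by (eapply is_derive_cont; eauto). assert (continuous g2 t) by (eapply is_derive_cont; eauto).
  cts; auto.
- intros s Hs. destruct (He s Hs) as [-> _]. reflexivity.
Qed.

Section Curve.
Variables (gamma : R -> plane) (n : nat) (t : nat -> R).
Hypothesis Hpieces : forall i : nat, (i < n)%nat -> t i < t (i + 1)%nat /\ regular_arc gamma (t i) (t (i + 1)%nat).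

Lemma knots_incr i : (i <= n)%nat -> t O <= t i.
Proof.
induction i as [|i IH]; intros Hi. lra. destruct (Hpieces i Hi) as [H _]. rewrite Nat.add_1_r in H.
specialize (IH ltac:(lia)). lra.
Qed.

(** The curve is known to be continuous only arc by arc. The sign of the affine form is constant on
    each arc, and it passes to the next arc through the common knot [t i]. *)
Lemma curve_sign al be ce :
  (forall s, t O <= s <= t n -> al * fst (gamma s) + be * snd (gamma s) + ce <> 0) ->
  forall s, t O <= s <= t n -> 0 < (al * fst (gamma (t O)) + be * snd (gamma (t O)) + ce) * (al * fst (gamma s) + be * snd (gamma s) + ce).
Proof.
set (F := fun s => al * fst (gamma s) + be * snd (gamma s) + ce). intros HN.
assert (K : forall i, (i <= n)%nat -> (forall s, t O <= s <= t i -> F s <> 0) -> forall s, t O <= s <= t i -> 0 < F (t O) * F s).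
{ induction i as [|i IH]; intros Hi HNi s Hs.
  - replace s with (t O) by lra. assert (F (t O) <> 0) by (apply HNi; lra). nra.
  - destruct (Hpieces i Hi) as [H1 H2]. rewrite Nat.add_1_r in H1, H2.
    assert (Kn := knots_incr i ltac:(lia)).
    assert (IH' := IH ltac:(lia) (fun s h => HNi s ltac:(lra))).
    destruct (Rle_dec s (t i)) as [L|L]. apply IH'; lra.
    destruct (piece_linear gamma _ _ al be ce H2) as [G [HG EG]].
    assert (P := nonvanishing_sign G (t i) (t (S i)) s ltac:(lra) HG).
    assert (P' : 0 < G (t i) * G s).
    { apply P. intros u Hu. rewrite <- EG by auto. apply HNi; lra. }
    rewrite <- !EG in P' by lra. specialize (IH' (t i) ltac:(lra)). fold (F (t i)) in P'. fold (F s) in P'.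
    apply Rnot_le_lt. intros Q.
    assert (0 < (F (t O) * F (t i)) * (F (t i) * F s)) by (apply Rmult_lt_0_compat; auto).
    assert (0 < F (t i) * F (t i)) by (assert (F (t i) <> 0) by (apply HNi; lra); nra).
    replace (F (t O) * F (t i) * (F (t i) * F s)) with (F (t i) * F (t i) * (F (t O) * F s)) in H by ring. nra. }
apply (K n); auto.
Qed.

Lemma curve_bounded al be : exists B, forall s, t O <= s <= t n -> Rabs (al * fst (gamma s) + be * snd (gamma s)) <= B.
Proof.
assert (K : forall i, (i <= n)%nat -> exists B, forall s, t O <= s <= t i -> Rabs (al * fst (gamma s) + be * snd (gamma s)) <= B).
{ induction i as [|i IH]; intros Hi.
  - exists (Rabs (al * fst (gamma (t O)) + be * snd (gamma (t O)))). intros s Hs. replace s with (t O) by lra. lra.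
  - destruct (IH ltac:(lia)) as [B HB]. destruct (Hpieces i Hi) as [H1 H2]. rewrite Nat.add_1_r in H1, H2.
    destruct (piece_linear gamma _ _ al be 0 H2) as [G [HG EG]].
    destruct (continuous_bounded G (t i) (t (S i)) (fun x _ => HG x)) as [B' [_ HB']].
    exists (Rmax B B'). intros s Hs. destruct (Rle_dec s (t i)).
    + eapply Rle_trans. apply HB; lra. apply Rmax_l.
    + specialize (EG s ltac:(lra)). rewrite Rplus_0_r in EG. rewrite EG. eapply Rle_trans. apply HB'; lra. apply Rmax_r. }
apply (K n); auto.
Qed.
End Curve.

Lemma enorm_ge (x : plane) a b : a ^ 2 + b ^ 2 = 1 -> Rabs (a * fst x + b * snd x) <= enorm x.
Proof.
intros E. unfold enorm, dot. apply le_of_sq. apply sqrt_pos.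
assert (0 <= fst x * fst x + snd x * snd x) by nra.
replace (sqrt (fst x * fst x + snd x * snd x) ^ 2) with (fst x * fst x + snd x * snd x) by (simpl; rewrite Rmult_1_r, sqrt_sqrt; auto).
assert (0 <= (a * snd x - b * fst x) ^ 2) by apply pow2_ge_0.
replace (fst x * fst x + snd x * snd x) with ((a ^ 2 + b ^ 2) * (fst x * fst x + snd x * snd x)) by (rewrite E; ring). lra.
Qed.

Lemma enorm_le (x : plane) : enorm x <= Rabs (fst x) + Rabs (snd x).
Proof.
unfold enorm, dot. assert (A := Rabs_pos (fst x)). assert (B := Rabs_pos (snd x)).
rewrite <- (sqrt_pow2 (Rabs (fst x) + Rabs (snd x))) by lra. apply sqrt_le_1; try nra.
assert (E1 := pow2_abs (fst x)). assert (E2 := pow2_abs (snd x)). simpl in *. nra.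
Qed.

(** A closed half-plane that misses [S] is convex, and moving along its inner normal reaches
    arbitrarily distant points. *)
Lemma half_plane_outside (S : plane -> Prop) a b e z : a ^ 2 + b ^ 2 = 1 ->
  (forall x, S x -> a * fst x + b * snd x + e < 0) -> 0 <= a * fst z + b * snd z + e -> outside S z.
Proof.
intros E HS Hz M.
set (H := fun x : plane => 0 <= a * fst x + b * snd x + e).
set (tau := Rabs (a * fst z + b * snd z) + Rabs M + 1).
assert (T0 : 0 < tau) by (unfold tau; generalize (Rabs_pos (a * fst z + b * snd z)) (Rabs_pos M); lra).
set (y := (fst z + tau * a, snd z + tau * b) : plane).
assert (Ey : a * fst y + b * snd y = a * fst z + b * snd z + tau).
{ unfold y; simpl. transitivity (a * fst z + b * snd z + tau * (a ^ 2 + b ^ 2)). ring. rewrite E; ring. }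
exists y. split.
- eapply Rlt_le_trans. 2: apply (enorm_ge y a b E). rewrite Ey. eapply Rlt_le_trans. 2: apply Rle_abs.
  unfold tau. generalize (Rle_abs M) (Rabs_maj2 (a * fst z + b * snd z)). lra.
- exists H. split; [|split; [|split]].
  + apply convex_connected. unfold H. intros p q t Hp Hq Ht. simpl.
    replace (a * (fst p + t * (fst q - fst p)) + b * (snd p + t * (snd q - snd p)) + e) with
      ((1 - t) * (a * fst p + b * snd p + e) + t * (a * fst q + b * snd q + e)) by ring.
    apply Rplus_le_le_0_compat; apply Rmult_le_pos; lra.
  + intros x Hx Sx. specialize (HS x Sx). unfold H in Hx. lra.
  + exact Hz.
  + unfold H. rewrite Ey. lra.
Qed.

Lemma enorm_scal s (z : plane) : 0 <= s -> enorm (s * fst z, s * snd z) = s * enorm z.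
Proof.
intros Hs. unfold enorm, dot. simpl.
replace (s * fst z * (s * fst z) + s * snd z * (s * snd z)) with (s ^ 2 * (fst z * fst z + snd z * snd z)) by ring.
rewrite sqrt_mult by nra. now rewrite sqrt_pow2.
Qed.

(** The radial half-line that starts at [z] and leads away from the origin avoids [S]. *)
Lemma far_outside (S : plane -> Prop) R z : 0 <= R -> (forall x, S x -> enorm x <= R) -> R < enorm z -> outside S z.
Proof.
intros HR HS Hz M.
set (H := fun x : plane => exists s, 1 <= s /\ x = (s * fst z, s * snd z)).
set (s0 := 1 + Rabs M / enorm z).
assert (Hs0 : 1 <= s0).
{ unfold s0. assert (0 <= Rabs M / enorm z). apply Rmult_le_pos. apply Rabs_pos. left; apply Rinv_0_lt_compat; lra. lra. }
exists (s0 * fst z, s0 * snd z). split.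
- rewrite enorm_scal by lra. unfold s0. rewrite Rmult_plus_distr_r. replace (Rabs M / enorm z * enorm z) with (Rabs M) by (field; lra).
  generalize (Rle_abs M). lra.
- exists H. split; [|split; [|split]].
  + apply convex_connected. unfold H. intros p q t [s1 [H1 ->]] [s2 [H2 ->]] Ht. simpl.
    exists (s1 + t * (s2 - s1)). split. 2: f_equal; ring.
    replace (s1 + t * (s2 - s1)) with ((1 - t) * s1 + t * s2) by ring.
    assert ((1 - t) * 1 <= (1 - t) * s1) by (apply Rmult_le_compat_l; lra). assert (t * 1 <= t * s2) by (apply Rmult_le_compat_l; lra). lra.
  + intros x [s [H1 ->]] Sx. specialize (HS _ Sx). rewrite enorm_scal in HS by lra.
    assert (1 * enorm z <= s * enorm z) by (apply Rmult_le_compat_r; lra). lra.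
  + exists 1. split. lra. destruct z; simpl; f_equal; ring.
  + exists s0. auto.
Qed.

Lemma outside_not (S : plane -> Prop) x : outside S x -> ~ S x.
Proof. intros H. destruct (H 0) as [y [_ [B [_ [HB [Bx _]]]]]]. exact (HB x Bx). Qed.

(** The line does not meet the curve, so the whole curve lies strictly on one side of it; [sg]
    selects the other side, whose closed half-plane belongs to the region. Beyond a radius that
    bounds the curve everything belongs to the region. *)
Lemma exterior_geometry U (x0 : plane) t1 t2 : exterior_region U -> t1 ^ 2 + t2 ^ 2 = 1 ->
  (forall s, U (fst x0 + s * t1, snd x0 + s * t2)) ->
  exists sg R, (sg = 1 \/ sg = -1) /\ 0 <= R /\ (forall z, R < enorm z -> U z) /\
   forall z, 0 <= sg * (- t2 * (fst z - fst x0) + t1 * (snd z - snd x0)) -> U z.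
Proof.
intros [_ _ [S [[gamma [n [t [Hn [Hp [Hc HS]]]]]] HU]]] E HL.
set (e := t2 * fst x0 - t1 * snd x0).
assert (HN : forall s, t O <= s <= t n -> - t2 * fst (gamma s) + t1 * snd (gamma s) + e <> 0).
{ intros s Hs Z.
  assert (Sx : S (gamma s)) by (apply HS; exists s; auto).
  apply (outside_not S (gamma s)); auto. apply HU.
  set (w := t1 * (fst (gamma s) - fst x0) + t2 * (snd (gamma s) - snd x0)).
  replace (gamma s) with (fst x0 + w * t1, snd x0 + w * t2); [apply HL|].
  destruct (gamma s) as [u v]. unfold e, w in *. cbn [fst snd] in *. f_equal.
  - transitivity (fst x0 + (u - fst x0) * (t1 ^ 2 + t2 ^ 2)
      + t2 * (- t2 * u + t1 * v + (t2 * fst x0 - t1 * snd x0))). ring. rewrite Z, E. ring.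
  - transitivity (snd x0 + (v - snd x0) * (t1 ^ 2 + t2 ^ 2)
      - t1 * (- t2 * u + t1 * v + (t2 * fst x0 - t1 * snd x0))). ring. rewrite Z, E. ring. }
assert (Sg := curve_sign gamma n t Hp (- t2) t1 e HN).
assert (T0 := knots_incr gamma n t Hp n (le_n n)).
destruct (curve_bounded gamma n t Hp 1 0) as [B1 HB1]. destruct (curve_bounded gamma n t Hp 0 1) as [B2 HB2].
set (F0 := - t2 * fst (gamma (t O)) + t1 * snd (gamma (t O)) + e) in *.
assert (NF : F0 <> 0) by (apply HN; lra).
(* [F0] has the sign of the side that contains the curve; the opposite sign is taken. *)
exists (if Rlt_dec F0 0 then 1 else -1), (Rabs B1 + Rabs B2).
split. destruct (Rlt_dec F0 0); auto.
split. generalize (Rabs_pos B1) (Rabs_pos B2); lra.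
split.
- intros z Hz. apply HU. apply (far_outside S (Rabs B1 + Rabs B2)); auto.
  generalize (Rabs_pos B1) (Rabs_pos B2); lra.
  intros x Sx. apply HS in Sx. destruct Sx as [s [Hs ->]]. eapply Rle_trans. apply enorm_le.
  specialize (HB1 s Hs). specialize (HB2 s Hs). rewrite Rmult_1_l, Rmult_0_l, Rplus_0_r in HB1. rewrite Rmult_1_l, Rmult_0_l, Rplus_0_l in HB2.
  generalize (Rle_abs B1) (Rle_abs B2); lra.
- intros z Hz. apply HU. destruct (Rlt_dec F0 0) as [L|L].
  + apply (half_plane_outside S (- t2) t1 e). rewrite <- E; ring.
    * intros x Sx. apply HS in Sx. destruct Sx as [s [Hs ->]]. specialize (Sg s Hs). nra.
    * unfold e. lra.
  + apply (half_plane_outside S t2 (- t1) (- e)). rewrite <- E; ring.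
    * intros x Sx. apply HS in Sx. destruct Sx as [s [Hs ->]]. specialize (Sg s Hs). nra.
    * unfold e. lra.
Qed.

(** * Real and imaginary parts of a radiation solution *)

Definition re_part (f : plane -> C) (x y : R) : R := Re (f (x, y)).
Definition im_part (f : plane -> C) (x y : R) : R := Im (f (x, y)).

Lemma cont2_parts (f : plane -> C) x y : continuous f (x, y) -> cont2 (re_part f) x y /\ cont2 (im_part f) x y.
Proof.
intros H. unfold cont2, re_part, im_part.
assert (H' : continuous (fun z : plane => f (fst z, snd z)) (x, y)).
{ apply (continuous_ext f). now intros []. exact H. }
split.
- apply (continuous_comp (fun z : plane => f (fst z, snd z)) (fun w : R * R => fst w)); auto.
  destruct (f (x, y)). apply continuous_fst.
- apply (continuous_comp (fun z : plane => f (fst z, snd z)) (fun w : R * R => snd w)); auto.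
  destruct (f (x, y)). apply continuous_snd.
Qed.

Lemma class_C1_parts U f : class_C 1 U f ->
  C1on U (re_part f) (re_part (d1 f)) (re_part (d2 f)) /\ C1on U (im_part f) (im_part (d1 f)) (im_part (d2 f)).
Proof.
intros [_ [HD [[H1 _] [H2 _]]]].
split; intros x y Hxy; destruct (HD _ Hxy) as [[E1 E2] [E3 E4]];
destruct (cont2_parts _ _ _ (H1 _ Hxy)); destruct (cont2_parts _ _ _ (H2 _ Hxy)).
- split; [|split; [|split]]; auto. apply Derive_correct. exact E1. apply Derive_correct. exact E3.
- split; [|split; [|split]]; auto. apply Derive_correct. exact E2. apply Derive_correct. exact E4.
Qed.

Lemma class_C_weaken U f : class_C 2 U f -> class_C 1 U f.
Proof.
intros [H0 [HD [[H1 _] [H2 _]]]]. simpl. auto.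
Qed.

Lemma radiation_helm kappa U psi : radiation_solution kappa U psi ->
  helm kappa U (re_part psi) (re_part (d1 psi)) (re_part (d2 psi)) /\
  helm kappa U (im_part psi) (im_part (d1 psi)) (im_part (d2 psi)).
Proof.
intros [H2 HH _]. destruct (class_C1_parts U psi (class_C_weaken _ _ H2)) as [A1 A2].
destruct H2 as [_ [_ [H21 H22]]].
destruct (class_C1_parts U _ H21) as [B1 B2]. destruct (class_C1_parts U _ H22) as [B3 B4].
split; split; auto.
- exists (re_part (d1 (d1 psi))), (re_part (d2 (d1 psi))), (re_part (d1 (d2 psi))), (re_part (d2 (d2 psi))).
  split; auto. split; auto. intros x y Hxy. specialize (HH _ Hxy). apply (f_equal fst) in HH.
  unfold re_part, Re. unfold laplacian in HH. simpl in HH. rewrite <- HH. simpl. ring.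
- exists (im_part (d1 (d1 psi))), (im_part (d2 (d1 psi))), (im_part (d1 (d2 psi))), (im_part (d2 (d2 psi))).
  split; auto. split; auto. intros x y Hxy. specialize (HH _ Hxy). apply (f_equal snd) in HH.
  unfold im_part, Im. unfold laplacian in HH. simpl in HH. rewrite <- HH. simpl. ring.
Qed.

Lemma radial_derive_parts U psi w1 w2 rho : open U -> class_C 1 U psi -> w1 ^ 2 + w2 ^ 2 = 1 -> 0 < rho ->
  U (rho * w1, rho * w2) ->
  enorm (rho * w1, rho * w2) = rho /\
  radial_derive psi (rho * w1, rho * w2) =
    (w1 * re_part (d1 psi) (rho * w1) (rho * w2) + w2 * re_part (d2 psi) (rho * w1) (rho * w2),
     w1 * im_part (d1 psi) (rho * w1) (rho * w2) + w2 * im_part (d2 psi) (rho * w1) (rho * w2)).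
Proof.
intros HU HC E Hr HUx. destruct (class_C1_parts U psi HC) as [C1 C2].
assert (En : enorm (rho * w1, rho * w2) = rho).
{ unfold enorm, dot. simpl. replace (rho * w1 * (rho * w1) + rho * w2 * (rho * w2)) with (rho ^ 2 * (w1 ^ 2 + w2 ^ 2)) by ring.
  rewrite E, Rmult_1_r. apply sqrt_pow2; lra. }
split; auto. unfold radial_derive. rewrite En. unfold cDerive.
assert (Gen : forall g gx gy, C1on U g gx gy ->
  is_derive (fun s => g (fst (pscal (s / rho) (rho * w1, rho * w2))) (snd (pscal (s / rho) (rho * w1, rho * w2)))) rho
   (w1 * gx (rho * w1) (rho * w2) + w2 * gy (rho * w1) (rho * w2))).
{ intros g gx gy Hg. apply (is_derive_ext (fun s => g (s * w1) (s * w2))).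
  { intros s. unfold pscal; simpl. f_equal; field; lra. }
  apply (C1on_chain U g gx gy (fun s => s * w1) (fun s => s * w2)); auto; auto_derive; auto; ring. }
f_equal; apply is_derive_unique.
- apply (Gen _ _ _ C1).
- apply (Gen _ _ _ C2).
Qed.

(** * Rescaled coordinates adapted to the line *)

Section Normalisation.
Variables (x0 : plane) (t1 t2 sg kappa : R).
Hypothesis Ht : t1 ^ 2 + t2 ^ 2 = 1.
Hypothesis Hsg : sg = 1 \/ sg = -1.
Hypothesis Hk : 0 < kappa.

(* Rescaled orthonormal coordinates in which the line is the axis [Y = 0] and the wave number is 1. *)
Definition nf (g : R -> R -> R) : R -> R -> R :=
  pull (fst x0) (snd x0) (t1 / kappa) (- sg * t2 / kappa) (t2 / kappa) (sg * t1 / kappa) g.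
Definition nx (gx gy : R -> R -> R) : R -> R -> R := fun x y => t1 / kappa * nf gx x y + t2 / kappa * nf gy x y.
Definition ny (gx gy : R -> R -> R) : R -> R -> R := fun x y => (- sg * t2 / kappa) * nf gx x y + (sg * t1 / kappa) * nf gy x y.
Definition nV (U : plane -> Prop) : plane -> Prop :=
  pull_set (fst x0) (snd x0) (t1 / kappa) (- sg * t2 / kappa) (t2 / kappa) (sg * t1 / kappa) U.
(** The original origin in the new coordinates: the centre about which the radiation condition is
    known. *)
Definition norigin : plane :=
  (- kappa * (t1 * fst x0 + t2 * snd x0), - kappa * sg * (- t2 * fst x0 + t1 * snd x0)).

Lemma sg_sq : sg * sg = 1.
Proof. destruct Hsg as [-> | ->]; ring. Qed.

Lemma nf_helm U g gx gy : open U -> helm kappa U g gx gy -> helm 1 (nV U) (nf g) (nx gx gy) (ny gx gy).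
Proof.
intros HU Hg. replace 1 with (/ kappa * kappa) by (field; lra).
apply pull_helm; auto.
- replace ((t1 / kappa) ^ 2 + (- sg * t2 / kappa) ^ 2) with ((t1 ^ 2 + (sg * sg) * t2 ^ 2) * (/ kappa) ^ 2) by (field; lra).
  rewrite sg_sq, Rmult_1_l, Ht. ring.
- replace ((t2 / kappa) ^ 2 + (sg * t1 / kappa) ^ 2) with (((sg * sg) * t1 ^ 2 + t2 ^ 2) * (/ kappa) ^ 2) by (field; lra).
  rewrite sg_sq, Rmult_1_l, Ht. ring.
- transitivity (t1 * t2 * (/ kappa) ^ 2 * (1 - sg * sg)). field; lra. rewrite sg_sq. ring.
Qed.

Lemma norigin_polar r p :
  fst x0 + t1 / kappa * (fst norigin + r * cos p) + (- sg * t2 / kappa) * (snd norigin + r * sin p) = r / kappa * (cos p * t1 + sin p * (- sg * t2)) /\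
  snd x0 + t2 / kappa * (fst norigin + r * cos p) + (sg * t1 / kappa) * (snd norigin + r * sin p) = r / kappa * (cos p * t2 + sin p * (sg * t1)).
Proof.
unfold norigin; simpl. split.
- transitivity (fst x0 - t1 * (t1 * fst x0 + t2 * snd x0) + (sg * sg) * t2 * (- t2 * fst x0 + t1 * snd x0)
    + r / kappa * (cos p * t1 + sin p * (- sg * t2))). field; lra.
  rewrite sg_sq. transitivity (fst x0 * (1 - (t1 ^ 2 + t2 ^ 2)) + r / kappa * (cos p * t1 + sin p * (- sg * t2))). ring. rewrite Ht. ring.
- transitivity (snd x0 - t2 * (t1 * fst x0 + t2 * snd x0) - (sg * sg) * t1 * (- t2 * fst x0 + t1 * snd x0)
    + r / kappa * (cos p * t2 + sin p * (sg * t1))). field; lra.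
  rewrite sg_sq. transitivity (snd x0 * (1 - (t1 ^ 2 + t2 ^ 2)) + r / kappa * (cos p * t2 + sin p * (sg * t1))). ring. rewrite Ht. ring.
Qed.

Lemma direction_unit p : (cos p * t1 + sin p * (- sg * t2)) ^ 2 + (cos p * t2 + sin p * (sg * t1)) ^ 2 = 1.
Proof.
transitivity (cos p ^ 2 * (t1 ^ 2 + t2 ^ 2) + (sg * sg) * sin p ^ 2 * (t1 ^ 2 + t2 ^ 2)). ring.
rewrite sg_sq, Ht. generalize (sin2_cos2 p). unfold Rsqr. intros; lra.
Qed.

Lemma norigin_exterior U R : (forall z, R < enorm z -> U z) -> exterior_in (nV U) norigin (kappa * R).
Proof.
intros HR r p Hr. unfold nV, pull_set. cbn [fst snd].
destruct (norigin_polar r p) as [-> ->]. apply HR.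
assert (D := direction_unit p).
set (w1 := cos p * t1 + sin p * (- sg * t2)) in *. set (w2 := cos p * t2 + sin p * (sg * t1)) in *.
destruct (Rle_dec 0 (r / kappa)) as [L|L].
- assert (Q := enorm_scal (r / kappa) (w1, w2) L). cbn [fst snd] in Q. rewrite Q. unfold enorm, dot. simpl.
  replace (w1 * w1 + w2 * w2) with 1 by (rewrite <- D; ring). rewrite sqrt_1, Rmult_1_r.
  apply Rmult_lt_reg_l with kappa; auto. replace (kappa * (r / kappa)) with r by (field; lra). lra.
- apply Rlt_le_trans with 0. 2: apply sqrt_pos.
  assert (r / kappa < 0) by lra. apply Rmult_lt_reg_l with kappa; auto.
  assert (kappa * (r / kappa) < kappa * 0) by (apply Rmult_lt_compat_l; auto).
  replace (kappa * (r / kappa)) with r in * by (field; lra). lra.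
Qed.

Lemma nf_rad U R psi : open U -> 0 <= R -> (forall z, R < enorm z -> U z) -> radiation_solution kappa U psi ->
  rad norigin (nf (re_part psi)) (nx (re_part (d1 psi)) (re_part (d2 psi))) (ny (re_part (d1 psi)) (re_part (d2 psi)))
              (nf (im_part psi)) (nx (im_part (d1 psi)) (im_part (d2 psi))) (ny (im_part (d1 psi)) (im_part (d2 psi))).
Proof.
intros HU HR HRU [H2 _ HS] e He.
assert (Sk : 0 < sqrt kappa) by (apply sqrt_lt_R0; auto).
(* New radii are [kappa] times the old ones and derivatives are divided by [kappa]; with the factor
   [sqrt r] this leaves [/ sqrt kappa]. *)
destruct (HS (e * sqrt kappa)) as [M [HM0 HM]]. { apply Rmult_lt_0_compat; auto. }
exists (kappa * (M + R + 1)). intros r p Hr x y.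
assert (Hrho : M + R + 1 < r / kappa).
{ apply Rmult_lt_reg_l with kappa; auto. replace (kappa * (r / kappa)) with r by (field; lra). auto. }
assert (D := direction_unit p). destruct (norigin_polar r p) as [E1 E2].
unfold nx, ny, nf, pull. fold x y in E1, E2. rewrite !E1, !E2.
set (w1 := cos p * t1 + sin p * (- sg * t2)) in *. set (w2 := cos p * t2 + sin p * (sg * t1)) in *.
set (rho := r / kappa) in *.
assert (Ux : U (rho * w1, rho * w2)).
{ apply HRU. assert (Q := enorm_scal rho (w1, w2) ltac:(lra)). cbn [fst snd] in Q. rewrite Q. unfold enorm, dot. simpl.
  replace (w1 * w1 + w2 * w2) with 1 by (rewrite <- D; ring). rewrite sqrt_1, Rmult_1_r. lra. }
destruct (radial_derive_parts U psi w1 w2 rho HU (class_C_weaken _ _ H2) D ltac:(lra) Ux) as [En Rd].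
specialize (HM _ Ux ltac:(rewrite En; lra)). rewrite En, Rd in HM.
set (z := Cmult _ _) in HM.
assert (Zm := Rmax_Cmod z).
assert (Z1 : Rabs (fst z) < e * sqrt kappa) by (eapply Rle_lt_trans; [eapply Rle_trans; [apply Rmax_l|apply Zm]|auto]).
assert (Z2 : Rabs (snd z) < e * sqrt kappa) by (eapply Rle_lt_trans; [eapply Rle_trans; [apply Rmax_r|apply Zm]|auto]).
assert (Sr : sqrt r = sqrt kappa * sqrt rho).
{ rewrite <- sqrt_mult by lra. f_equal. unfold rho. field. lra. }
assert (Skk : sqrt kappa * sqrt kappa = kappa) by (apply sqrt_sqrt; lra).
assert (Fin : forall A B, Rabs (sqrt rho * B) < e * sqrt kappa -> A = B / kappa -> sqrt r * Rabs A < e).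
{ intros A B HB ->. rewrite <- (Rabs_pos_eq (sqrt r)) by apply sqrt_pos. rewrite <- Rabs_mult, Sr.
  replace (sqrt kappa * sqrt rho * (B / kappa)) with (sqrt rho * B * / sqrt kappa).
  rewrite Rabs_mult, (Rabs_pos_eq (/ sqrt kappa)) by (left; apply Rinv_0_lt_compat; auto).
  apply Rmult_lt_reg_r with (sqrt kappa); auto. rewrite Rmult_assoc, Rinv_l by lra. lra.
  set (q := sqrt kappa) in *. rewrite <- Skk. field. lra. }
unfold re_part, im_part in *.
split.
- apply (Fin _ (w1 * Re (d1 psi (rho * w1, rho * w2)) + w2 * Re (d2 psi (rho * w1, rho * w2)) + kappa * Im (psi (rho * w1, rho * w2)))).
  + replace (sqrt rho * (w1 * Re (d1 psi (rho * w1, rho * w2)) + w2 * Re (d2 psi (rho * w1, rho * w2)) + kappa * Im (psi (rho * w1, rho * w2))))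
     with (fst z). exact Z1. unfold z, Re, Im. simpl. ring.
  + unfold w1, w2. field. lra.
- apply (Fin _ (w1 * Im (d1 psi (rho * w1, rho * w2)) + w2 * Im (d2 psi (rho * w1, rho * w2)) - kappa * Re (psi (rho * w1, rho * w2)))).
  + replace (sqrt rho * (w1 * Im (d1 psi (rho * w1, rho * w2)) + w2 * Im (d2 psi (rho * w1, rho * w2)) - kappa * Re (psi (rho * w1, rho * w2))))
     with (snd z). exact Z2. unfold z, Re, Im. simpl. ring.
  + unfold w1, w2. field. lra.
Qed.
End Normalisation.

Theorem corollary1 :
  forall (U : plane -> Prop) (kappa : R) (k x0 theta : plane)
         (psi1 psi1' : plane -> C),
    exterior_region U ->
    0 < kappa ->
    enorm k = kappa ->
    enorm theta = 1 ->
    (forall x, line x0 theta x -> U x) ->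
    theta <> pscal (/ enorm k) k ->
    pscal (-1) theta <> pscal (/ enorm k) k ->
    radiation_solution kappa U psi1 ->
    radiation_solution kappa U psi1' ->
    (forall x, line x0 theta x ->
       Cmod (Cplus (plane_wave k x) (psi1 x)) ^ 2 =
       Cmod (Cplus (plane_wave k x) (psi1' x)) ^ 2) ->
    forall x, U x -> psi1 x = psi1' x.
Proof.
intros U kappa k x0 [t1 t2] psi psi' HUr Hk Ek Et HL Hth _ Rp Rp' HI.
assert (Ht : t1 ^ 2 + t2 ^ 2 = 1).
{ unfold enorm, dot in Et. cbn [fst snd] in Et.
  assert (Q := sqrt_sqrt (t1 * t1 + t2 * t2) ltac:(nra)). rewrite Et in Q. lra. }
assert (Kk : fst k ^ 2 + snd k ^ 2 = kappa ^ 2).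
{ rewrite <- Ek. unfold enorm, dot. rewrite pow2_sqrt by nra. ring. }
assert (HL' : forall s, U (fst x0 + s * t1, snd x0 + s * t2)) by (intros s; apply HL; exists s; reflexivity).
assert (HU := exterior_open U HUr). assert (CU := exterior_connected U HUr).
destruct (exterior_geometry U x0 t1 t2 HUr Ht HL') as [sg [R0 [Hsg [HR [HRU Hhalf]]]]].
assert (SS := sg_sq sg Hsg).
destruct (radiation_helm kappa U psi Rp) as [F1 H1]. destruct (radiation_helm kappa U psi' Rp') as [F2 H2].
(* The cosine of the angle between [k] and the direction of the line, which is the wave number of
   the plane wave along the rescaled line. *)
set (al := (fst k * t1 + snd k * t2) / kappa).
assert (Hal : al < 1).
(* For two unit vectors the squared distance is twice one minus the cosine, so [al >= 1] would make
   them equal. *)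
{ assert (I : (t1 - fst k / kappa) ^ 2 + (t2 - snd k / kappa) ^ 2 = 2 * (1 - al)).
  { unfold al. transitivity ((t1 ^ 2 + t2 ^ 2) + (fst k ^ 2 + snd k ^ 2) / kappa ^ 2 - 2 * ((fst k * t1 + snd k * t2) / kappa)).
    field; lra. rewrite Ht, Kk. field. lra. }
  assert (I1 := pow2_ge_0 (t1 - fst k / kappa)). assert (I2 := pow2_ge_0 (t2 - snd k / kappa)).
  apply Rnot_le_lt. intros L. destruct (sq_sum_zero (t1 - fst k / kappa) (t2 - snd k / kappa)) as [J1 J2]. lra.
  apply Hth. rewrite Ek. unfold pscal. f_equal; unfold Rdiv in *; lra. }
assert (Up : forall x y, 0 < y ->
   nf x0 t1 t2 sg kappa (re_part psi) x y = nf x0 t1 t2 sg kappa (re_part psi') x y /\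
   nf x0 t1 t2 sg kappa (im_part psi) x y = nf x0 t1 t2 sg kappa (im_part psi') x y).
{ apply (half_plane_uniqueness (nV x0 t1 t2 sg kappa U) (norigin x0 t1 t2 sg kappa) (kappa * R0)
    _ (nx x0 t1 t2 sg kappa (re_part (d1 psi)) (re_part (d2 psi))) (ny x0 t1 t2 sg kappa (re_part (d1 psi)) (re_part (d2 psi)))
    _ (nx x0 t1 t2 sg kappa (im_part (d1 psi)) (im_part (d2 psi))) (ny x0 t1 t2 sg kappa (im_part (d1 psi)) (im_part (d2 psi)))
    _ (nx x0 t1 t2 sg kappa (re_part (d1 psi')) (re_part (d2 psi'))) (ny x0 t1 t2 sg kappa (re_part (d1 psi')) (re_part (d2 psi')))
    _ (nx x0 t1 t2 sg kappa (im_part (d1 psi')) (im_part (d2 psi'))) (ny x0 t1 t2 sg kappa (im_part (d1 psi')) (im_part (d2 psi')))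
    (dot k x0) al).
  - apply pull_open; auto.
  - intros x y Hy. unfold nV, pull_set. cbn [fst snd]. apply Hhalf. simpl.
    replace (sg * (- t2 * (fst x0 + t1 / kappa * x + - sg * t2 / kappa * y - fst x0) + t1 * (snd x0 + t2 / kappa * x + sg * t1 / kappa * y - snd x0)))
      with ((sg * sg) * (t1 ^ 2 + t2 ^ 2) * (y / kappa)) by (field; lra).
    rewrite SS, Ht. rewrite !Rmult_1_l. apply Rmult_le_pos; auto. left; apply Rinv_0_lt_compat; auto.
  - apply norigin_exterior; auto.
  - apply Rmult_le_pos; lra.
  - apply nf_helm; auto.
  - apply nf_helm; auto.
  - apply (nf_rad x0 t1 t2 sg kappa Ht Hsg Hk U R0 psi); auto.
  - apply nf_helm; auto.
  - apply nf_helm; auto.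
  - apply (nf_rad x0 t1 t2 sg kappa Ht Hsg Hk U R0 psi'); auto.
  - exact Hal.
  - intros x. unfold nf, pull. rewrite !Rmult_0_r, !Rplus_0_r.
    assert (Q := HI (fst x0 + t1 / kappa * x, snd x0 + t2 / kappa * x)).
    assert (Lx : line x0 (t1, t2) (fst x0 + t1 / kappa * x, snd x0 + t2 / kappa * x)).
    { exists (x / kappa). unfold padd, pscal. simpl. f_equal; field; lra. }
    specialize (Q Lx). unfold Cmod in Q. rewrite !pow2_sqrt in Q by (apply Rplus_le_le_0_compat; apply pow2_ge_0).
    unfold plane_wave in Q. simpl fst in Q. simpl snd in Q.
    replace (dot k (fst x0 + t1 / kappa * x, snd x0 + t2 / kappa * x)) with (dot k x0 + al * x) in Q.
    exact Q. unfold dot, al. simpl. field. lra. }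
(* A point at distance 1 from the line, on the side away from the curve, from which unique
   continuation starts. *)
set (z0 := (fst x0 - sg * t2, snd x0 + sg * t1) : plane).
assert (Hz0 : U z0).
{ apply Hhalf. unfold z0; simpl. replace (sg * (- t2 * (fst x0 - sg * t2 - fst x0) + t1 * (snd x0 + sg * t1 - snd x0)))
    with ((sg * sg) * (t1 ^ 2 + t2 ^ 2)) by ring. rewrite SS, Ht. lra. }
assert (UpH : forall u v, 0 < sg * (- t2 * (u - fst x0) + t1 * (v - snd x0)) -> re_part psi u v = re_part psi' u v /\ im_part psi u v = im_part psi' u v).
{ intros u v Huv.
  set (X := kappa * (t1 * (u - fst x0) + t2 * (v - snd x0))). set (Y := kappa * (sg * (- t2 * (u - fst x0) + t1 * (v - snd x0)))).
  assert (HY : 0 < Y) by (apply Rmult_lt_0_compat; auto).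
  specialize (Up X Y HY). unfold nf, pull in Up.
  assert (E1 : fst x0 + t1 / kappa * X + - sg * t2 / kappa * Y = u).
  { unfold X, Y. transitivity (fst x0 + t1 * (t1 * (u - fst x0) + t2 * (v - snd x0)) - (sg * sg) * t2 * (- t2 * (u - fst x0) + t1 * (v - snd x0))).
    field; lra. rewrite SS. transitivity (fst x0 + (t1 ^ 2 + t2 ^ 2) * (u - fst x0)). ring. rewrite Ht. ring. }
  assert (E2 : snd x0 + t2 / kappa * X + sg * t1 / kappa * Y = v).
  { unfold X, Y. transitivity (snd x0 + t2 * (t1 * (u - fst x0) + t2 * (v - snd x0)) + (sg * sg) * t1 * (- t2 * (u - fst x0) + t1 * (v - snd x0))).
    field; lra. rewrite SS. transitivity (snd x0 + (t1 ^ 2 + t2 ^ 2) * (v - snd x0)). ring. rewrite Ht. ring. }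
  now rewrite E1, E2 in Up. }
assert (Near : forall g g' : R -> R -> R, (forall u v, 0 < sg * (- t2 * (u - fst x0) + t1 * (v - snd x0)) -> g u v = g' u v) ->
  zero_near (fun x y => 1 * g x y + -1 * g' x y) z0).
(* Offsets below [1 / 4] in each coordinate change the distance to the line by at most [1 / 2], so
   the square stays on the same side. *)
{ intros g g' Hg. apply locally_plane. exists (/ 4). split. lra. intros a b Ha Hb. unfold z0. cbn [fst snd]. rewrite Hg. ring.
  replace (sg * (- t2 * (fst x0 - sg * t2 + a - fst x0) + t1 * (snd x0 + sg * t1 + b - snd x0)))
    with ((sg * sg) * (t1 ^ 2 + t2 ^ 2) + sg * (t1 * b - t2 * a)) by ring. rewrite SS, Ht.
  apply Rabs_def2 in Ha. apply Rabs_def2 in Hb.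
  assert (T1 : -1 <= t1 <= 1) by nra. assert (T2 : -1 <= t2 <= 1) by nra.
  assert (B1 : - / 4 <= t1 * b <= / 4) by nra. assert (B2 : - / 4 <= t2 * a <= / 4) by nra.
  destruct Hsg as [-> | ->]; lra. }
intros [u v] Hx.
assert (Zr := locally_singleton _ _ (unique_continuation kappa U _ _ _ U z0 HU (helm_lin _ _ _ _ _ _ _ _ 1 (-1) F1 F2) CU (fun _ h => h) Hz0
  (Near _ _ (fun u v h => proj1 (UpH u v h))) (u, v) Hx)).
assert (Zi := locally_singleton _ _ (unique_continuation kappa U _ _ _ U z0 HU (helm_lin _ _ _ _ _ _ _ _ 1 (-1) H1 H2) CU (fun _ h => h) Hz0
  (Near _ _ (fun u v h => proj2 (UpH u v h))) (u, v) Hx)).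
simpl in Zr, Zi. unfold re_part, im_part, Re, Im in Zr, Zi.
rewrite (surjective_pairing (psi (u, v))), (surjective_pairing (psi' (u, v))). f_equal; lra.
Qed.
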